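(* Let $\Gamma=\mathrm{SL}_3(\mathbb{Z})$. For a prime $q$ let $\mathbb{F}_q$ be the field with $q$ elements, $P_q=P^2(\mathbb{F}_q)$ the projective plane over $\mathbb{F}_q$, and $\Phi_q:\mathrm{SL}_3(\mathbb{Z})\to\mathrm{Sym}(P_q)$ the action obtained by reducing a matrix modulo $q$ and letting $\mathrm{SL}_3(\mathbb{F}_q)$ act naturally on $P_q$. Then for every $\epsilon>0$ there is a function $f_\epsilon$ on primes with $f_\epsilon(q)\to0$ as $q\to\infty$ such that for every prime $q$ there exists a set $Y\subset P_q$ with $|Y|\ge(1-f_\epsilon(q))|P_q|$, such that for every $x\in Y$ there exists a set $Z_x\subset P_q$ with $|Z_x|\ge(1-f_\epsilon(q))|P_q|$, such that for every $y\in Z_x$ there exists $\gamma\in\Gamma$ with $\|\gamma\|_\infty\le q^{1/3+\epsilon}$ and $\Phi_q(\gamma)x=y$.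
   Context: $\|\gamma\|_\infty$ denotes the maximum of the absolute values of the entries of the matrix $\gamma$. $P^2(\mathbb{F}_q)$ is the set of nonzero vectors in $\mathbb{F}_q^3$ modulo multiplication by $\mathbb{F}_q^\times$. *)

(* Defs.v *)
From HB Require Import structures.
From mathcomp Require Import all_boot all_order all_fingroup all_algebra.

Set Implicit Arguments.
Unset Strict Implicit.
Unset Printing Implicit Defensive.

Import GRing.Theory.
Local Open Scope ring_scope.

Record SL3 (R : comNzRingType) :=
  MkSL3 { SL3_mx :> 'M[R]_3; SL3_det : \det SL3_mx = 1 }.

Section Reduction.
Variable q : nat.

Lemma SL3_mod_subproof (g : SL3 int) :
  \det (map_mx (intr : int -> 'F_q) g) = 1.
Proof. by rewrite det_map_mx SL3_det rmorph1. Qed.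

Definition SL3_mod (g : SL3 int) : SL3 'F_q := MkSL3 (SL3_mod_subproof g).

End Reduction.

Definition mx_maxnorm m n (g : 'M[int]_(m, n)) : nat :=
  \max_(i < m) \max_(j < n) `|g i j|%N.

Section ProjectivePlane.
Variable F : finFieldType.

Definition proj_equiv : rel 'cV[F]_3 :=
  fun v w => [exists a : F, (a != 0) && (w == a *: v)].

Lemma proj_equiv_is_equiv : equivalence_rel proj_equiv.
Proof.
move=> u v w; split.
  by apply/existsP; exists 1; rewrite oner_eq0 scale1r eqxx.
case/existsP=> a /andP[a0 /eqP ->]; apply/existsP/existsP => -[b /andP[b0 /eqP ->]].
  by exists (b / a); rewrite mulf_neq0 ?invr_neq0 // scalerA divfK ?eqxx.
by exists (b * a); rewrite mulf_neq0 // scalerA eqxx.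
Qed.

Definition proj_classes : {set {set 'cV[F]_3}} :=
  equivalence_partition proj_equiv [set v | v != 0].

Record proj_plane :=
  ProjPoint { proj_class :> {set 'cV[F]_3}; _ : proj_class \in proj_classes }.

HB.instance Definition _ := [isSub for proj_class].
HB.instance Definition _ := [Finite of proj_plane by <:].

Lemma SL3_mul_inj (g : SL3 F) : injective (fun v : 'cV[F]_3 => g *m v).
Proof.
move=> v w /(congr1 (mulmx (invmx g))).
by rewrite !mulKmx // unitmxE SL3_det unitr1.
Qed.

Lemma SL3_proj_subproof (g : SL3 F) (x : proj_plane) :
  [set g *m v | v in x] \in proj_classes.
Proof.
case: x => X /= /imsetP[v]; rewrite inE => v0 ->.
apply/imsetP; exists (g *m v).
  by rewrite inE; apply: contra v0 => /eqP gv; apply/eqP;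
     apply: (@SL3_mul_inj g); rewrite mulmx0.
apply/setP => w; apply/imsetP/idP => [[u + ->]|].
  rewrite !inE => /andP[u0 /existsP[a /andP[a0 /eqP eu]]].
  apply/andP; split.
    by apply: contra u0 => /eqP gu; apply/eqP;
       apply: (@SL3_mul_inj g); rewrite mulmx0.
  by apply/existsP; exists a; rewrite a0 eu scalemxAr eqxx.
rewrite !inE => /andP[w0 /existsP[a /andP[a0 /eqP ew]]].
exists (a *: v); last by rewrite -scalemxAr.
rewrite !inE scaler_eq0 negb_or a0 v0 /=.
by apply/existsP; exists a; rewrite a0 eqxx.
Qed.

Definition SL3_proj (g : SL3 F) (x : proj_plane) : proj_plane :=
  ProjPoint (SL3_proj_subproof g x).

Lemma SL3_proj_inj (g : SL3 F) : injective (SL3_proj g).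
Proof.
move=> x y /(congr1 proj_class) /= exy; apply: val_inj.
exact: (imset_inj (@SL3_mul_inj g)) exy.
Qed.

Definition SL3_proj_perm (g : SL3 F) : {perm proj_plane} :=
  perm (@SL3_proj_inj g).

End ProjectivePlane.

(* Permutations compose left to right in MathComp, so for a fixed q this left
   action reverses products of permutations. *)
Definition Phi (q : nat) (g : SL3 int) : {perm proj_plane 'F_q} :=
  SL3_proj_perm (SL3_mod q g).

(* Main.v *)
(* For most points x of the plane, the images of x under matrices of size about
   q^(1/3) are already q^(2-o(1)) in number; a few steps along the elementary
   generators then spread them over almost the whole plane.

   Many images.  Let p range over the primitive vectors of Z^3 whose orthogonal
   plane contains two independent integer vectors of length U, a small constant
   times q^(1/3); there are about U^6, that is about q^2, of them.  Completing a
   basis of the orthogonal plane gives g_p in SL_3(Z) of size O(U) whose first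
   two rows have cross product p.  By Cauchy-Schwarz it suffices to bound the
   number of triples (x, p, p') with g_p x = g_p' x.  For p' <> p, -p there are at
   most O(1) such x, unless g_p - c g_p' has rank 1 modulo q for some c, in which
   case there are O(q).  In the latter case the linear relation K in Z^4 between
   the first two rows of g_p and those of g_p' is nonzero and has
   K_1 K_4 = K_2 K_3 modulo q.  Lattice packing bounds the pairs (p, p') attached
   to K by O((U^3 / |K|)^3), and there are only O(m^2) such K with |K| = m, so that
   the degenerate pairs are O(U^9 log q).

   Spreading.  If the elementary generators barely move a set A, Fourier transform
   in one coordinate turns the indicator of the cone over A into a measure on the
   plane of frequencies which is nearly invariant under the shears and nearly
   supported on small frequencies; by ping-pong it is small.  So the indicator is
   nearly constant along two coordinate directions, hence on affine charts of the
   plane by the Efron-Stein inequality.  Consequently the odds |A| / (n - |A|)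
   increase by a constant factor each time the generators are applied, and
   eps log_2 q applications, which multiply the size of the matrices by q^eps,
   leave out a proportion q^(-e) of the plane. *)
Require Import Defs.
From mathcomp Require Import all_boot all_order all_fingroup all_algebra.
From mathcomp Require Import all_classical all_reals all_analysis.
From mathcomp Require Import ring lra zify.
Import Order.TTheory GRing.Theory Num.Theory.
Import numFieldNormedType.Exports.
Set Implicit Arguments.
Unset Strict Implicit.
Unset Printing Implicit Defensive.
Local Open Scope ring_scope.

(** * Points of the plane and their cones *)

Section ProjectivePoints.
Variable F : finFieldType.
Implicit Types (X Y : proj_plane F) (v w : 'cV[F]_3) (A : {set proj_plane F}).

Lemma mem_pointE X v w : v \in proj_class X ->
  (w \in proj_class X) = proj_equiv v w.
Proof.
case: X => X XP /=; case/imsetP: (XP) => u; rewrite inE => u0 -> {X XP}.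
have tr := proj_equiv_is_equiv (F := F).
rewrite !inE => /andP[v0 uv]; have [_ /(_ uv) <-] := tr u v w.
case: (eqVneq w 0) => // ->; apply/esym/negbTE/negP => /existsP[a /andP[a0]].
by rewrite eq_sym scaler_eq0 (negbTE a0) (negbTE u0).
Qed.

Lemma mem_point_neq0 X v : v \in proj_class X -> v != 0.
Proof. by case: X => X /= /imsetP[u _ ->]; rewrite !inE => /andP[]. Qed.

Lemma point_nonempty X : exists v, v \in proj_class X.
Proof.
case: X => X XP /=; case/imsetP: (XP) => u; rewrite inE => u0 ->; exists u.
rewrite !inE u0; apply/existsP; exists 1.
by rewrite oner_eq0 scale1r eqxx.
Qed.

Lemma point_inj X Y v : v \in proj_class X -> v \in proj_class Y -> X = Y.
Proof.
move=> vX vY; apply: val_inj => /=; apply/setP => w.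
by rewrite (mem_pointE _ vX) (mem_pointE _ vY).
Qed.

Lemma point_exists v : v != 0 -> exists X, v \in proj_class X.
Proof.
move=> v0; pose S := [set w in [set w : 'cV[F]_3 | w != 0] | proj_equiv v w].
have SP : S \in proj_classes F by apply/imsetP; exists v; rewrite ?inE.
exists (ProjPoint SP); rewrite /= !inE v0; apply/existsP; exists 1.
by rewrite oner_eq0 scale1r eqxx.
Qed.

Lemma mem_pointZ X v c : c != 0 -> (c *: v \in proj_class X) = (v \in proj_class X).
Proof.
move=> c0; have imp u d : d != 0 -> u \in proj_class X -> d *: u \in proj_class X.
  by move=> d0 uX; rewrite (mem_pointE _ uX); apply/existsP; exists d; rewrite d0 eqxx.
apply/idP/idP; last exact: imp.
by move/(imp _ c^-1); rewrite scalerA mulVf // scale1r invr_neq0 // => ->.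
Qed.

Lemma card_point X : #|proj_class X| = #|F|.-1.
Proof.
have [v vX] := point_nonempty X; have v0 := mem_point_neq0 vX.
have -> : proj_class X = [set a *: v | a in [set~ (0 : F)]].
  apply/setP => w; rewrite (mem_pointE _ vX); apply/existsP/imsetP.
    by case=> a /andP[a0 /eqP ->]; exists a; rewrite ?inE.
  by case=> a; rewrite !inE => a0 ->; exists a; rewrite a0 eqxx.
rewrite card_imset ?cardsC1 // => a b /eqP; rewrite -subr_eq0 -scalerBl scaler_eq0.
by rewrite (negbTE v0) orbF subr_eq0 => /eqP.
Qed.

(** Passing to the cone turns a set of points into a function on the vector space that is constant
    on punctured lines; Fourier analysis takes place there. *)
Definition cone A : {set 'cV[F]_3} := [set v | [exists X in A, v \in proj_class X]].

Lemma mem_cone A X v : v \in proj_class X -> (v \in cone A) = (X \in A).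
Proof.
move=> vX; rewrite inE; apply/existsP/idP => [[Y /andP[YA vY]]|XA].
  by rewrite (point_inj vX vY).
by exists X; rewrite XA.
Qed.

Lemma cone0 A : 0 \notin cone A.
Proof.
by rewrite inE; apply/negP => /existsP[X /andP[_ /mem_point_neq0]]; rewrite eqxx.
Qed.

Lemma coneZ A c v : c != 0 -> (c *: v \in cone A) = (v \in cone A).
Proof.
by move=> c0; rewrite !inE; apply: eq_existsb => X; rewrite mem_pointZ.
Qed.

Lemma card_cone A : #|cone A| = (#|A| * #|F|.-1)%N.
Proof.
rewrite -sum_nat_const -(eq_bigr _ (fun X _ => card_point X)) -sum1_card.
under [RHS]eq_bigr do rewrite -sum1_card.
rewrite (exchange_big_dep (mem (cone A))) /=; last first.
  by move=> X v XA vX; rewrite (mem_cone _ vX).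
apply: eq_bigr => v; rewrite inE => /existsP[X /andP[XA vX]].
rewrite (big_pred1 X) // => Y /=; apply/andP/eqP => [[_ vY]|->] //.
exact: point_inj vY vX.
Qed.

Lemma card_proj_plane : (#|{: proj_plane F}| * #|F|.-1 = (#|F| ^ 3).-1)%N.
Proof.
rewrite -cardsT -card_cone.
have -> : cone [set: proj_plane F] = [set~ 0].
  apply/setP => v; rewrite !inE; apply/existsP/idP => [[X /andP[_]]|v0].
    exact: mem_point_neq0.
  by have [X vX] := point_exists v0; exists X; rewrite inE.
by rewrite cardsC1 card_mx muln1.
Qed.

Lemma mem_SL3_proj (g : SL3 F) X v :
  (g *m v \in proj_class (SL3_proj g X)) = (v \in proj_class X).
Proof. by rewrite /= mem_imset //; exact: SL3_mul_inj. Qed.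

End ProjectivePoints.

(** * Elementary matrices and the size of products *)

Section Elementary.

Definition elem_mx (i j : 'I_3) (s : int) : 'M[int]_3 := 1%:M + s *: delta_mx i j.

Lemma elem_det (i j : 'I_3) (s : int) : i != j -> \det (elem_mx i j s) = 1.
Proof.
have lower (a b : 'I_3) : (b < a)%N -> \det (elem_mx a b s) = 1.
  move=> ab; rewrite det_trig; last first.
    apply/is_trig_mxP => k l kl; rewrite !mxE.
    have -> : (k == l) = false by apply/negbTE; rewrite -val_eqE /= neq_ltn kl.
    case: eqP => //= [ka|_]; last by rewrite mulr0 addr0.
    case: eqP => //= [lb|_]; last by rewrite mulr0 addr0.
    by move: kl; rewrite ka lb ltnNge ltnW.
  apply: big1 => k _; rewrite !mxE eqxx.
  case: eqP => //= [->|_]; last by rewrite mulr0 addr0.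
  have -> : (a == b) = false by apply/negbTE; rewrite -val_eqE /= neq_ltn ab orbT.
  by rewrite mulr0 addr0.
move=> ij; case: (ltngtP j i) => h; first exact: lower.
  rewrite -det_tr -(lower _ _ h); congr (\det _).
  by apply/matrixP => k l; rewrite !mxE [l == k]eq_sym andbC.
by rewrite (ord_inj h) eqxx in ij.
Qed.

Definition elem i j s (ij : i != j) : SL3 int := MkSL3 (elem_det s ij).

Lemma SL3_mod_elem q i j s (ij : i != j) (v : 'cV['F_q]_3) :
  SL3_mod q (elem s ij) *m v = v + (s%:~R * v j 0) *: delta_mx i 0.
Proof.
rewrite /= /elem_mx map_mxD map_mx1 map_mxZ map_delta_mx mulmxDl mul1mx; congr (_ + _).
apply/matrixP => k l; rewrite !mxE (bigD1 j) //= big1 ?addr0 => [|m /negbTE mj].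
  rewrite !mxE !eqxx !andbT !ord1 eqxx andbT.
  by case: (k == i); rewrite ?mulr1 ?mulr0 ?mul0r.
by rewrite !mxE mj andbF mulr0 mul0r.
Qed.

Lemma mx_maxnormP m n (g : 'M[int]_(m, n)) (B : nat) :
  reflect (forall i j, (`|g i j| <= B)%N) (mx_maxnorm g <= B)%N.
Proof.
apply: (iffP idP) => [h i j|h].
  apply: leq_trans h; apply: leq_trans (leq_bigmax i).
  exact: (leq_bigmax (F := fun j => `|g i j|%N)).
by apply/bigmax_leqP => i _; apply/bigmax_leqP => j _.
Qed.

Lemma elem_mulE i j s (g : 'M[int]_3) k l :
  (elem_mx i j s *m g) k l = g k l + (k == i)%:R * s * g j l.
Proof.
rewrite mulmxDl mul1mx -scalemxAl mxE; congr (_ + _).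
rewrite !mxE (bigD1 j) //= big1 ?addr0 => [|m /negbTE mj]; last by rewrite mxE mj andbF mul0r.
by rewrite mxE eqxx andbT; case: (k == i); rewrite ?mul0r ?mulr0 ?mul1r.
Qed.

(** Only one row changes, by another row with coefficient 0, 1 or -1. This doubling is the price of
    each spreading step. *)
Lemma maxnorm_elem_mul i j s (g : 'M[int]_3) : (`|s| <= 1)%N ->
  (mx_maxnorm (elem_mx i j s *m g) <= 2 * mx_maxnorm g)%N.
Proof.
move=> s1; apply/mx_maxnormP => k l; rewrite elem_mulE.
have /mx_maxnormP h := leqnn (mx_maxnorm g).
have := h k l; have := h j l; case: (k == i); rewrite ?mul0r ?mul1r; last lia.
by have := abszM s (g j l); case: s s1 => [[|[|]]|[|]] //= _; lia.
Qed.

Definition SL3_mul (R : comNzRingType) (g h : SL3 R) : SL3 R.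
Proof. by exists (g *m h); rewrite det_mulmx !SL3_det mulr1. Defined.

Lemma SL3_mod_mul q (g h : SL3 int) (v : 'cV['F_q]_3) :
  SL3_mod q (SL3_mul g h) *m v = SL3_mod q g *m (SL3_mod q h *m v).
Proof. by rewrite /= map_mxM mulmxA. Qed.

Lemma mem_Phi q (g : SL3 int) X (v : 'cV['F_q]_3) :
  (SL3_mod q g *m v \in proj_class (Phi q g X)) = (v \in proj_class X).
Proof. by rewrite /Phi permE mem_SL3_proj. Qed.

Lemma Phi_mul q (g h : SL3 int) X : Phi q (SL3_mul g h) X = Phi q g (Phi q h X).
Proof.
have [v vX] := point_nonempty X.
apply: (@point_inj _ _ _ (SL3_mod q g *m (SL3_mod q h *m v))).
  by rewrite -SL3_mod_mul mem_Phi.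
by rewrite !mem_Phi.
Qed.

End Elementary.

(** * Expansion under the elementary generators *)

Section FourierCharacters.
Variables (R : realType) (q : nat) (q_pr : prime q).
Local Notation F := 'F_q.

Definition angle : R := (pi *+ 2) / q%:R.
(** [cosq] and [sinq] are the real and imaginary parts of the additive character exp(2 pi i t / q),
    kept apart so that everything stays real. *)
Definition cosq (t : F) : R := cos (angle * (t : nat)%:R).
Definition sinq (t : F) : R := sin (angle * (t : nat)%:R).

Let q_gt0 : (0 < q)%N := prime_gt0 q_pr.

Lemma Fp_valD (a b : F) : nat_of_ord (a + b)%R = ((a + b) %% q)%N.
Proof. by rewrite /=; congr (_ %% _)%N; exact: Fp_cast. Qed.

Lemma Fp_val_lt (a : F) : (a < q)%N.
Proof. by rewrite -[X in (_ < X)%N](Fp_cast q_pr) ltn_ord. Qed.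

Lemma angle_mod (n : nat) :
  exists k : nat, angle * n%:R = angle * (n %% q)%:R + (pi *+ 2) *+ k.
Proof.
exists (n %/ q)%N; rewrite {1}(divn_eq n q) natrD natrM.
rewrite mulrDr addrC; congr (_ + _).
rewrite /angle -[RHS]mulr_natr.
have q0 : q%:R != 0 :> R by rewrite pnatr_eq0 -lt0n.
by field.
Qed.

Lemma cosq_mod (n : nat) : cos (angle * n%:R) = cos (angle * (n %% q)%:R).
Proof. by have [k ->] := angle_mod n; rewrite (periodicn (@cosD2pi R)). Qed.

Lemma sinq_mod (n : nat) : sin (angle * n%:R) = sin (angle * (n %% q)%:R).
Proof. by have [k ->] := angle_mod n; rewrite (periodicn (@sinD2pi R)). Qed.

Lemma cosqD a b : cosq (a + b) = cosq a * cosq b - sinq a * sinq b.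
Proof. by rewrite /cosq Fp_valD -cosq_mod natrD mulrDr cosD. Qed.

Lemma sinqD a b : sinq (a + b) = sinq a * cosq b + cosq a * sinq b.
Proof. by rewrite /sinq Fp_valD -sinq_mod natrD mulrDr sinD. Qed.

Lemma cosq2Dsinq2 a : cosq a ^+ 2 + sinq a ^+ 2 = 1.
Proof. exact: cos2Dsin2. Qed.

Lemma cosq0 : cosq 0 = 1.
Proof. by rewrite /cosq mulr0 cos0. Qed.

Lemma sinq0 : sinq 0 = 0.
Proof. by rewrite /sinq mulr0 sin0. Qed.

(** The values at [- a] give the inverse rotation, hence the conjugate one; the addition formulas
    suffice, without the residue that represents [- a]. *)
Lemma cosqN a : cosq (- a) = cosq a.
Proof.
have h1 := cosqD a (- a); have h2 := sinqD a (- a).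
rewrite subrr cosq0 sinq0 in h1 h2.
have h3 := cosq2Dsinq2 a.
have -> : cosq (- a) = cosq a * (cosq a * cosq (- a) - sinq a * sinq (- a)) +
   sinq a * (sinq a * cosq (- a) + cosq a * sinq (- a)).
  by rewrite -[LHS]mul1r -h3; ring.
by rewrite -h1 -h2; ring.
Qed.

Lemma sinqN a : sinq (- a) = - sinq a.
Proof.
have h1 := cosqD a (- a); have h2 := sinqD a (- a).
rewrite subrr cosq0 sinq0 in h1 h2.
have h3 := cosq2Dsinq2 a.
have -> : sinq (- a) = cosq a * (sinq a * cosq (- a) + cosq a * sinq (- a)) -
   sinq a * (cosq a * cosq (- a) - sinq a * sinq (- a)).
  by rewrite -[LHS]mul1r -h3; ring.
by rewrite -h1 -h2; ring.
Qed.

Lemma cosq1_neq1 : cosq 1 != 1.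
Proof.
have q2 := prime_gt1 q_pr.
have q2R : 2 <= q%:R :> R by rewrite ler_nat.
have hpi := pi_gt0 R.
have e1 : nat_of_ord (1%R : F) = 1%N by [].
rewrite /cosq e1 mulr1.
have a0 : 0 < angle by rewrite /angle divr_gt0 ?ltr0n // pmulrn_lgt0.
have api : angle <= pi.
  by rewrite /angle ler_pdivrMr ?ltr0n // mulr2n; nra.
apply/eqP => h; have := @cos_inj R angle 0.
rewrite !itv_boundlr /= !bnd_simp h cos0 (ltW a0) api ?lexx ?pi_ge0 => /(_ isT isT erefl) e.
by rewrite e ltxx in a0.
Qed.

(** Translating the index by 1 and by -1 gives 2 S = 2 cos(2 pi / q) S for the sum S, and this
    cosine is not 1. *)
Lemma sum_cosq : \sum_(c : F) cosq c = 0.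
Proof.
set S := \sum_c _.
have tr (d : F) : \sum_(c : F) cosq (c + d) = S.
  by rewrite /S [RHS](reindex_inj (addIr d)).
have : S + S = (cosq 1 *+ 2) * S.
  rewrite -[X in X + _](tr 1) -[X in _ + X](tr (-1)).
  rewrite -big_split /= mulr_sumr; apply: eq_bigr => c _.
  by rewrite !cosqD cosqN sinqN; ring.
move=> e.
have : (cosq 1 - 1) * S = 0 by lra.
by move/eqP; rewrite mulf_eq0 subr_eq0 (negbTE cosq1_neq1) /= => /eqP.
Qed.

Lemma sum_cosq_scaled (t : F) :
  \sum_(c : F) cosq (c * t) = if t == 0 then q%:R else 0.
Proof.
case: eqVneq => [->|t0].
  under eq_bigr do rewrite mulr0 cosq0.
  by rewrite sumr_const card_Fp.
by rewrite -[RHS]sum_cosq [RHS](reindex_inj (mulIf t0)).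
Qed.

Lemma cosq_le0 (t : F) : (q < 4 * t < 3 * q)%N -> cosq t <= 0.
Proof.
move=> /andP[h1 h2]; rewrite /cosq.
have hpi := pi_gt0 R.
have q0 : 0 < q%:R :> R by rewrite ltr0n.
have {}h1 : q%:R < 4 * (t : nat)%:R :> R by rewrite -natrM ltr_nat.
have {}h2 : 4 * (t : nat)%:R < 3 * q%:R :> R by rewrite -!natrM ltr_nat.
have -> : angle * (t : nat)%:R = (angle * (t : nat)%:R - pi) + pi by ring.
rewrite cosDpi oppr_le0; apply: cos_ge0_pihalf.
have ->: angle * (t : nat)%:R = pi * (2 * (t : nat)%:R / q%:R).
  by rewrite /angle; field; rewrite gt_eqF.
set u : R := _ / _.
have u1 : 1 <= 2 * u by rewrite /u mulrA ler_pdivlMr //; lra.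
have u2 : 2 * u <= 3 by rewrite /u mulrA ler_pdivrMr //; lra.
by apply/andP; split; nra.
Qed.

End FourierCharacters.

(** * Fourier transform in one coordinate and Parseval's identity *)

Section Parseval.
Variables (R : realType) (q : nat) (q_pr : prime q).
Local Notation F := 'F_q.

Definition scale2 (c : F) (y : F * F) : F * F := (c * y.1, c * y.2).

Definition homogeneous (h : F -> F * F -> R) :=
  forall c x y, c != 0 -> h (c * x) (scale2 c y) = h x y.

Definition cos_coef (h : F -> F * F -> R) y := \sum_x h x y * cosq R x.
Definition sin_coef (h : F -> F * F -> R) y := \sum_x h x y * sinq R x.

(* By homogeneity, the frequency-[c] coefficient on the line over [y] is the
   frequency-1 coefficient on the line over [c^-1 y]; so this single function
   of [y] records all nonzero frequencies. *)
Definition energy h y := cos_coef h y ^+ 2 + sin_coef h y ^+ 2.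

Lemma energy_ge0 h y : 0 <= energy h y.
Proof. by rewrite addr_ge0 ?sqr_ge0. Qed.

Lemma scale2_inj c : c != 0 -> injective (scale2 c).
Proof.
move=> c0 [a b] [a' b'] e.
have e1 : c * a = c * a' := congr1 fst e.
have e2 : c * b = c * b' := congr1 snd e.
by rewrite (mulfI c0 e1) (mulfI c0 e2).
Qed.

Lemma scale2_eq0 c y : c != 0 -> (scale2 c y == 0) = (y == 0).
Proof.
by move=> c0; case: y => a b; rewrite !xpair_eqE !mulf_eq0 /= (negbTE c0).
Qed.

Lemma energy_scale h c y : homogeneous h -> c != 0 ->
  energy h (scale2 c y) = \sum_x \sum_x' h x y * h x' y * cosq R (c * (x - x')).
Proof.
move=> hh c0.
have -> : energy h (scale2 c y) =
   (\sum_x h x y * cosq R (c * x)) ^+ 2 + (\sum_x h x y * sinq R (c * x)) ^+ 2.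
  rewrite /energy /cos_coef /sin_coef.
  rewrite (reindex_inj (mulfI c0)) [X in _ + X ^+ 2](reindex_inj (mulfI c0)) /=.
  by congr (_ ^+ 2 + _ ^+ 2); apply: eq_bigr => x _; rewrite hh.
rewrite !expr2 !big_distrlr -big_split /=; apply: eq_bigr => x _.
rewrite -big_split /=; apply: eq_bigr => x' _.
by rewrite mulrBr cosqD // cosqN // sinqN //; ring.
Qed.

(** Plancherel's identity summed over the lines. Each of the [q - 1] nonzero frequencies contributes
    the same total, because scaling by [c] permutes the nonzero pairs; leaving out frequency 0
    subtracts the squared sums. *)
Lemma parseval h : homogeneous h ->
  (q%:R - 1) * (\sum_(y : F * F | y != 0) energy h y) =
  \sum_(y : F * F | y != 0) (q%:R * (\sum_x h x y ^+ 2) - (\sum_x h x y) ^+ 2).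
Proof.
move=> hh.
have cnt : \sum_(c : F | c != 0) (1 : R) = q%:R - 1.
  have := sumr_const (F : finType) (1 : R); rewrite card_Fp // (bigD1 (0 : F)) //=.
  by move=> <-; rewrite addrAC subrr add0r.
rewrite -cnt mulr_suml.
have -> : \sum_(c : F | c != 0) 1 * (\sum_(y : F * F | y != 0) energy h y) =
  \sum_(c : F | c != 0) \sum_(y : F * F | y != 0) \sum_x \sum_x'
     h x y * h x' y * cosq R (c * (x - x')).
  apply: eq_bigr => c c0; rewrite mul1r (reindex_inj (scale2_inj c0)) /=.
  apply: eq_big => y; first by rewrite scale2_eq0.
  by move=> _; rewrite energy_scale.
rewrite exchange_big /=; apply: eq_bigr => y _.
have -> : \sum_(c : F | c != 0) \sum_x \sum_x' h x y * h x' y * cosq R (c * (x - x'))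
  = \sum_x \sum_x' h x y * h x' y * ((if x == x' then q%:R else 0) - 1).
  rewrite exchange_big /=; apply: eq_bigr => x _.
  rewrite exchange_big /=; apply: eq_bigr => x' _.
  rewrite -mulr_sumr; congr (_ * _).
  (* The sum over nonzero [c] is the full character sum minus its term 1 at [c = 0]. *)
  rewrite -[x == x']subr_eq0 -sum_cosq_scaled // [in RHS](bigD1 (0 : F)) //=.
  by rewrite mul0r cosq0 addrAC subrr add0r.
rewrite expr2 big_distrlr /= mulr_sumr -sumrB; apply: eq_bigr => x _.
under eq_bigr do rewrite mulrBr mulr1.
rewrite sumrB; congr (_ - _).
rewrite (bigD1 x) //= eqxx big1 ?addr0; first by rewrite expr2 mulrC.
by move=> x' /negbTE; rewrite eq_sym => ->; rewrite mulr0.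
Qed.

End Parseval.

(** This makes ping-pong possible modulo [q]: two residues from the first quarter add up without
    wrapping around, so the integer representatives can be compared. *)
Lemma half_range (q m n c : nat) : (0 < 4 * m <= q)%N -> (0 < 4 * n <= q)%N ->
  c = (m + n)%N -> (n < c)%N /\ ((0 < 4 * c <= q) || (q < 4 * c < 3 * q))%N.
Proof.
move=> /andP[h1 h2] /andP[h3 h4] ->; split; first lia.
by case: (leqP (4 * (m + n)) q) => ?; [apply/orP; left | apply/orP; right]; apply/andP; split; lia.
Qed.

Lemma small_sum (q m n : nat) : (0 < 4 * m <= q)%N -> (0 < 4 * n <= q)%N -> (m + n < q)%N.
Proof. by move=> /andP[h1 h2] /andP[h3 h4]; lia. Qed.

(** * Ping-pong for measures on the plane of frequencies *)

Section MeasureOnPlane.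
Variables (R : realType) (q : nat) (q_pr : prime q).
Local Notation F := 'F_q.

(** On [wide] residues the cosine is nonpositive, so translations move those coefficients a lot.
    Zero, [wide], [small] and the negatives of [small] cover all residues. *)
Definition wide (t : F) := (q < 4 * t < 3 * q)%N.
Definition small (t : F) := (0 < 4 * t <= q)%N.

Lemma Fp_valN (t : F) : t != 0 -> nat_of_ord (- t)%R = (q - t)%N.
Proof.
move=> t0; have : 0%N = ((t + nat_of_ord (- t)%R) %% q)%N by rewrite -Fp_valD // subrr.
have := Fp_val_lt q_pr t; have := Fp_val_lt q_pr (- t).
have : (t : nat) != 0 by [].
move: (nat_of_ord (- t)%R) (nat_of_ord t) => a b b0 ha hb e.
have : (q %| b + a)%N by rewrite /dvdn -e.
case/dvdnP => k ek; case: k ek => [|[|k]] ek; first lia; first lia.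
by rewrite mulSnr mulSnr in ek; lia.
Qed.

Lemma wideN (t : F) : wide (- t) = wide t.
Proof.
rewrite /wide; case: (eqVneq t 0) => [->|t0]; first by rewrite oppr0.
by rewrite Fp_valN //; have := Fp_val_lt q_pr t; lia.
Qed.

Lemma small_or_wide (t : F) : [|| t == 0, wide t, small t | small (- t)].
Proof.
case: (eqVneq t 0) => //= t0.
rewrite /wide /small Fp_valN //; have := Fp_val_lt q_pr t.
by have : (t : nat) != 0 by []; lia.
Qed.

Definition shear1 (y : F * F) : F * F := (y.1 + y.2, y.2).
Definition shear2 (y : F * F) : F * F := (y.1, y.1 + y.2).
Definition unshear1 (y : F * F) : F * F := (y.1 - y.2, y.2).
Definition unshear2 (y : F * F) : F * F := (y.1, y.2 - y.1).

Lemma shear1K : cancel shear1 unshear1.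
Proof. by case=> a b; rewrite /shear1 /unshear1 /= addrK. Qed.
Lemma shear2K : cancel shear2 unshear2.
Proof. by case=> a b; rewrite /shear2 /unshear2 /= addrC addKr. Qed.

(** The inequality [energy_compose] summed over [P]: ping-pong only needs this one-sided comparison
    of the masses of [P] and its image. The origin is excluded because distances are summed over
    nonzero pairs. *)
Definition almost_invariant (mu : F * F -> R) (D : R) (g : F * F -> F * F) :=
  forall P : pred (F * F), ~~ P 0 ->
  3 / 4 * (\sum_(y | P y) mu y) <= (\sum_(y | P y) mu (g y)) + 3 * D.

Lemma sum_image (mu : F * F -> R) (g g' : F * F -> F * F) (P : pred (F * F)) :
  cancel g g' -> \sum_(y | P y) mu (g y) = \sum_(y | P (g' y)) mu y.
Proof.
move=> gK; rewrite [RHS](reindex_inj (can_inj gK)) /=.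
by apply: eq_bigl => y; rewrite gK.
Qed.

Lemma sum_ind (mu : F * F -> R) (P : pred (F * F)) :
  \sum_(y | P y) mu y = \sum_y (P y)%:R * mu y.
Proof.
by rewrite big_mkcond; apply: eq_bigr => y _; case: (P y); rewrite ?mul1r ?mul0r.
Qed.

(* The two shears send the small first quadrant into the disjoint regions
   [y1 > y2] and [y2 > y1] of the doubled quadrant. *)
Lemma quadrant_bound (mu : F * F -> R) (D : R) :
  (forall y, 0 <= mu y) ->
  \sum_(y : F * F | wide y.1) mu y <= D / 2 ->
  \sum_(y : F * F | wide y.2) mu y <= D / 2 ->
  almost_invariant mu D shear1 -> almost_invariant mu D shear2 ->
  \sum_(y : F * F | small y.1 && small y.2) mu y <= 14 * D.
Proof.
move=> mu0 h1 h2 i1 i2.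
set P := fun y : F * F => small y.1 && small y.2.
have P0 : ~~ P 0 by rewrite /P /small /=.
have := i1 P P0; have := i2 P P0.
rewrite (sum_image _ _ shear1K) (sum_image _ _ shear2K).
set M := \sum_(y | P y) mu y.
(* The two invariance inequalities then add up to 3/2 M <= M + D + 6 D, whence the constant 14. *)
suff : \sum_(y | P (unshear1 y)) mu y + \sum_(y | P (unshear2 y)) mu y <=
   M + \sum_(y : F * F | wide y.1) mu y + \sum_(y : F * F | wide y.2) mu y.
  by move=> *; lra.
rewrite /M (sum_ind mu (fun y => P (unshear1 y))) (sum_ind mu (fun y => P (unshear2 y))).
rewrite (sum_ind mu P) (sum_ind mu (fun y => wide y.1)) (sum_ind mu (fun y => wide y.2)).
rewrite -!big_split /=; apply: ler_sum => y _.
rewrite -!mulrDl ler_wpM2r // -!natrD ler_nat.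
case: y => a b; rewrite /P /=.
set s1 := small (a - b); set s2 := small (b - a).
have k1 : s1 -> small b -> nat_of_ord a = (nat_of_ord (a - b)%R + b)%N.
  rewrite /s1 /small => h3 h4; have := Fp_valD q_pr (a - b) b.
  by rewrite subrK => ->; rewrite modn_small // small_sum.
have k2 : s2 -> small a -> nat_of_ord b = (nat_of_ord (b - a)%R + a)%N.
  rewrite /s2 /small => h3 h4; have := Fp_valD q_pr (b - a) a.
  by rewrite subrK => ->; rewrite modn_small // small_sum.
have {}k1 : s1 -> small b -> (b < a)%N && (small a || wide a).
  by move=> h3 h4; have [-> h] := half_range h3 h4 (k1 h3 h4).
have {}k2 : s2 -> small a -> (a < b)%N && (small b || wide b).
  by move=> h3 h4; have [-> h] := half_range h3 h4 (k2 h3 h4).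
move: k1 k2; case: ltngtP => //= _; case: s1; case: s2; case: (small a);
  case: (small b); case: (wide a); case: (wide b) => //= k1 k2;
  by [have := k1 isT isT | have := k2 isT isT].
Qed.

End MeasureOnPlane.

Section PlaneBound.
Variables (R : realType) (q : nat) (q_pr : prime q).
Local Notation F := 'F_q.

Definition flip2 (y : F * F) : F * F := (y.1, - y.2).

Lemma flip2K : cancel flip2 flip2.
Proof. by case=> a b; rewrite /flip2 /= opprK. Qed.

Lemma almost_invariant_flip (mu : F * F -> R) D g g' :
  (forall y, flip2 (g y) = g' (flip2 y)) ->
  almost_invariant mu D g' -> almost_invariant (mu \o flip2) D g.
Proof.
move=> e i P P0.
have := i (P \o flip2); rewrite /flip2 /= oppr0 => /(_ P0).
rewrite -(sum_image mu _ flip2K) -(sum_image (fun y => mu (g' y)) _ flip2K).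
by under [X in _ <= X + _ -> _]eq_bigr do rewrite -e.
Qed.

Lemma axis_bound (mu : F * F -> R) (D M : R) (g g' : F * F -> F * F) (P Q : pred (F * F)) :
  (forall y, 0 <= mu y) -> cancel g g' -> almost_invariant mu D g ->
  ~~ P 0 -> (forall y, P y -> Q (g y)) ->
  \sum_(y | Q y) mu y <= M -> 3 / 4 * (\sum_(y | P y) mu y) <= M + 3 * D.
Proof.
move=> mu0 gK i P0 PQ hM; apply: (le_trans (i _ P0)).
rewrite lerD2r; apply: le_trans hM.
rewrite [X in _ <= X](reindex_inj (can_inj gK)) /= big_mkcond [X in _ <= X]big_mkcond /=.
apply: ler_sum => y _; case: ifP => hP; first by rewrite PQ.
by case: ifP.
Qed.

(** Nonzero pairs are covered by two wide strips, four quadrants and four half-axes. Negating the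
    second coordinate exchanges the shears with their inverses, which settles the mixed quadrants,
    and a shear pushes each positive half-axis into the first quadrant; the rest follows by symmetry
    under -1. The total D + 4 * 14 D + 4 * 17 D * 4/3 is below 150 D. *)
Lemma plane_bound (mu : F * F -> R) (D : R) :
  (forall y, 0 <= mu y) -> (forall y, mu (scale2 (-1) y) = mu y) ->
  \sum_(y : F * F | wide y.1) mu y <= D / 2 ->
  \sum_(y : F * F | wide y.2) mu y <= D / 2 ->
  almost_invariant mu D (@shear1 q) -> almost_invariant mu D (@shear2 q) ->
  almost_invariant mu D (@unshear1 q) -> almost_invariant mu D (@unshear2 q) ->
  \sum_(y : F * F | y != 0) mu y <= 150 * D.
Proof.
move=> mu0 muN w1 w2 s1 s2 u1 u2.
pose S (P : pred (F * F)) := \sum_(y | P y) mu y.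
have SN (P : pred (F * F)) : S (fun y => P (scale2 (-1) y)) = S P.
  rewrite {1}/S; transitivity (\sum_(y : F * F | P (scale2 (-1) y)) mu (scale2 (-1) y)).
    by apply: eq_bigr.
  by rewrite -(reindex_inj (@scale2_inj q (-1) _)) // oppr_eq0 oner_eq0.
have SF (P : pred (F * F)) : S (fun y => P (flip2 y)) = \sum_(y | P y) mu (flip2 y).
  by rewrite (sum_image _ _ flip2K).
pose pp (y : F * F) := small y.1 && small y.2.
have Hpp : S pp <= 14 * D by apply: quadrant_bound.
have Hpm : S (fun y => pp (flip2 y)) <= 14 * D.
  rewrite SF; apply: (@quadrant_bound R q q_pr (mu \o flip2)) => //=.
  - by rewrite -(SF (fun y => wide y.1)).
  - by rewrite -(SF (fun y => wide y.2)) /S; under eq_bigl do rewrite wideN //.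
  - apply: almost_invariant_flip u1 => -[a b].
    by rewrite /flip2 /shear1 /unshear1 /= opprK.
  - apply: almost_invariant_flip u2 => -[a b].
    by rewrite /flip2 /shear2 /unshear2 /= opprD addrC.
have Hmm : S (fun y => pp (scale2 (-1) y)) <= 14 * D by rewrite SN.
have Hmp : S (fun y => pp (flip2 (scale2 (-1) y))) <= 14 * D.
  by rewrite (SN (fun y => pp (flip2 y))).
pose a1 (y : F * F) := small y.1 && (y.2 == 0).
pose a2 (y : F * F) := (y.1 == 0) && small y.2.
have Ha1 : 3 / 4 * S a1 <= 14 * D + 3 * D.
  apply: (@axis_bound mu D (14 * D) (@shear2 q) (@unshear2 q) a1 pp mu0 (@shear2K q) s2 isT _ Hpp) => // -[a b].
  by rewrite /a1 /pp /= => /andP[h /eqP ->]; rewrite addr0 h.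
have Ha2 : 3 / 4 * S a2 <= 14 * D + 3 * D.
  apply: (@axis_bound mu D (14 * D) (@shear1 q) (@unshear1 q) a2 pp mu0 (@shear1K q) s1 isT _ Hpp) => // -[a b].
  by rewrite /a2 /pp /= => /andP[/eqP -> h]; rewrite add0r h.
have Hb1 := SN a1; have Hb2 := SN a2.
suff : \sum_(y : F * F | y != 0) mu y <=
   \sum_(y : F * F | wide y.1) mu y + \sum_(y : F * F | wide y.2) mu y +
   S pp + S (fun y => pp (flip2 y)) + S (fun y => pp (scale2 (-1) y)) +
   S (fun y => pp (flip2 (scale2 (-1) y))) +
   S a1 + S a2 + S (fun y => a1 (scale2 (-1) y)) + S (fun y => a2 (scale2 (-1) y)).
  have D0 : 0 <= D.
    by have : 0 <= \sum_(y : F * F | wide y.1) mu y by [apply: sumr_ge0]; lra.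
  by lra.
rewrite /S big_mkcond /=.
rewrite (sum_ind mu (fun y => wide y.1)) (sum_ind mu (fun y => wide y.2)).
rewrite (sum_ind mu pp) (sum_ind mu (fun y => pp (flip2 y))).
rewrite (sum_ind mu (fun y => pp (scale2 (-1) y))).
rewrite (sum_ind mu (fun y => pp (flip2 (scale2 (-1) y)))).
rewrite (sum_ind mu a1) (sum_ind mu a2).
rewrite (sum_ind mu (fun y => a1 (scale2 (-1) y))) (sum_ind mu (fun y => a2 (scale2 (-1) y))).
rewrite -!big_split /=; apply: ler_sum => y _.
rewrite -!mulrDl -!natrD; case: ifP => [y0|_]; last by rewrite mulr_ge0.
rewrite -[X in X <= _]mul1r ler_wpM2r // (ler_nat _ 1).
case: y y0 => a b; rewrite xpair_eqE negb_and.
rewrite /pp /a1 /a2 /flip2 /scale2 /= !mulN1r opprK !oppr_eq0.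
have := small_or_wide q_pr a; have := small_or_wide q_pr b.
case: (a == 0); case: (b == 0); case: (wide a); case: (wide b) => //=;
case: (small a); case: (small b); case: (small (- a)); case: (small (- b)) => //=.
Qed.

End PlaneBound.

(** * Variance along one coordinate direction *)

Section DirectionBound.
Variables (R : realType) (q : nat) (q_pr : prime q).
Local Notation F := 'F_q.

Implicit Types (h : F -> F * F -> R) (y : F * F) (l : F * F -> F) (g : F * F -> F * F).

(** Parseval with the subtracted squares dropped, and q <= 2 (q - 1). *)
Lemma energy_sum_le (h : F -> F * F -> R) : homogeneous h ->
  \sum_(y : F * F | y != 0) energy h y <=
  2 * (\sum_(y : F * F | y != 0) \sum_x h x y ^+ 2).
Proof.
move=> hh; have q2 : 2 <= q%:R :> R by rewrite ler_nat prime_gt1.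
have := parseval q_pr hh; rewrite sumrB -mulr_sumr.
set A := \sum_(y | _) energy h y; set B := \sum_(y | _) \sum_x _.
set C := \sum_(y | _) _ ^+ 2 => e.
have C0 : 0 <= C by apply: sumr_ge0 => y _; apply: sqr_ge0.
have A0 : 0 <= A by apply: sumr_ge0 => y _; apply: energy_ge0.
have B0 : 0 <= B by apply: sumr_ge0 => y _; apply: sumr_ge0 => x _; apply: sqr_ge0.
suff : (q%:R - 1) * A <= (q%:R - 1) * (2 * B) by rewrite ler_pM2l //; lra.
by rewrite e; nra.
Qed.

Definition sqdist (h h' : F -> F * F -> R) :=
  \sum_(y : F * F | y != 0) \sum_x (h' x y - h x y) ^+ 2.

Definition translate (h : F -> F * F -> R) (l : F * F -> F) x y := h (x + l y) y.
Definition compose (h : F -> F * F -> R) (g : F * F -> F * F) x y := h x (g y).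

(** Translation multiplies the coefficient by a complex number z of modulus 1, and |z - 1|^2 = 2 - 2
    Re z. *)
Lemma energy_translate h l y :
  energy (fun x y => translate h l x y - h x y) y = (2 - 2 * cosq R (l y)) * energy h y.
Proof.
rewrite /energy.
have -> : cos_coef (fun x y => translate h l x y - h x y) y =
   (cosq R (l y) - 1) * cos_coef h y + sinq R (l y) * sin_coef h y.
  rewrite /cos_coef; under eq_bigr do rewrite mulrBl.
  rewrite sumrB mulrBl mul1r addrAC; congr (_ - _).
  rewrite /translate (reindex_inj (addIr (- l y))) /= /sin_coef !mulr_sumr -big_split /=.
  by apply: eq_bigr => x _; rewrite subrK cosqD // cosqN // sinqN //; ring.
have -> : sin_coef (fun x y => translate h l x y - h x y) y =
   (cosq R (l y) - 1) * sin_coef h y - sinq R (l y) * cos_coef h y.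
  rewrite /sin_coef; under eq_bigr do rewrite mulrBl.
  rewrite sumrB mulrBl mul1r addrAC; congr (_ - _).
  rewrite /translate (reindex_inj (addIr (- l y))) /= /cos_coef !mulr_sumr -sumrB /=.
  by apply: eq_bigr => x _; rewrite subrK sinqD // cosqN // sinqN //; ring.
have := cosq2Dsinq2 R (l y).
set c := cosq _ _; set s := sinq _ _; set A := cos_coef _ _; set B := sin_coef _ _ => e.
have -> : s ^+ 2 = 1 - c ^+ 2 -> 2 - 2 * c = (c - 1) ^+ 2 + s ^+ 2 by move=> ->; ring.
  by ring.
by rewrite -e; ring.
Qed.

(** With a and b the complex coefficients at [g y] and [y], the difference of the two sides is 4 |a
    - 3/4 b|^2. *)
Lemma energy_compose h g y :
  3 / 4 * energy h y <=
  energy h (g y) + 3 * energy (fun x y => compose h g x y - h x y) y.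
Proof.
rewrite /energy.
have -> : cos_coef (fun x y => compose h g x y - h x y) y = cos_coef h (g y) - cos_coef h y.
  by rewrite /cos_coef -sumrB; apply: eq_bigr => x _; rewrite mulrBl.
have -> : sin_coef (fun x y => compose h g x y - h x y) y = sin_coef h (g y) - sin_coef h y.
  by rewrite /sin_coef -sumrB; apply: eq_bigr => x _; rewrite mulrBl.
set a := cos_coef h (g y); set b := sin_coef h (g y).
set a' := cos_coef h y; set b' := sin_coef h y.
have := sqr_ge0 (a - 3 / 4 * a'); have := sqr_ge0 (b - 3 / 4 * b').
by rewrite !expr2 => h1 h2; nra.
Qed.

Lemma energy_opp h y : homogeneous h -> energy h (scale2 (-1) y) = energy h y.
Proof.
move=> hh; rewrite /energy /cos_coef /sin_coef.
have n1 : (-1 : F) != 0 by rewrite oppr_eq0 oner_eq0.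
rewrite (reindex_inj (mulfI n1)) [X in _ + X ^+ 2](reindex_inj (mulfI n1)) /=.
under eq_bigr do rewrite hh // mulN1r cosqN //.
under [X in _ + X ^+ 2]eq_bigr do rewrite hh // mulN1r sinqN // mulrN.
by rewrite sumrN sqrrN.
Qed.

Lemma homogeneous_translate h l : homogeneous h ->
  (forall c y, l (scale2 c y) = c * l y) ->
  homogeneous (fun x y => translate h l x y - h x y).
Proof.
by move=> hh hl c x y c0; rewrite /translate hl -mulrDr !hh.
Qed.

Lemma homogeneous_compose h g : homogeneous h ->
  (forall c y, g (scale2 c y) = scale2 c (g y)) ->
  homogeneous (fun x y => compose h g x y - h x y).
Proof. by move=> hh hg c x y c0; rewrite /compose hg !hh. Qed.

(** By Parseval the left side is (q - 1) / q times the total energy. Near-invariance under the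
    translations keeps the energy off the wide strips, and near-invariance under the shears gives
    [almost_invariant]; [plane_bound] then applies with D = 2 E, the factor 2 being that of
    [energy_sum_le]. *)
Lemma direction_bound (h : F -> F * F -> R) (E : R) : homogeneous h ->
  sqdist h (translate h fst) <= E -> sqdist h (translate h snd) <= E ->
  sqdist h (compose h (@shear1 q)) <= E -> sqdist h (compose h (@shear2 q)) <= E ->
  sqdist h (compose h (@unshear1 q)) <= E -> sqdist h (compose h (@unshear2 q)) <= E ->
  \sum_(y : F * F | y != 0) (\sum_x h x y ^+ 2 - (\sum_x h x y) ^+ 2 / q%:R) <= 300 * E.
Proof.
move=> hh t1 t2 c1 c2 c3 c4.
have q0 : 0 < q%:R :> R by rewrite ltr0n prime_gt0.
(* On wide frequencies the factor 2 - 2 cos is at least 2. *)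
have wideP l (P : pred (F * F)) : (forall c y, l (scale2 c y) = c * l y) -> ~~ P 0 ->
    (forall y, P y -> wide (l y)) -> sqdist h (translate h l) <= E ->
    \sum_(y : F * F | P y) energy h y <= (2 * E) / 2.
  move=> hl P0 Pw ht; have := energy_sum_le (homogeneous_translate hh hl).
  under eq_bigr do rewrite energy_translate.
  rewrite -/(sqdist _ _) => /le_trans/(_ (ler_wpM2l _ ht)) => /(_ (ler0n _ _)) {}ht.
  rewrite ler_pdivlMr // mulr_suml; apply: le_trans ht.
  rewrite big_mkcond [X in _ <= X]big_mkcond /=; apply: ler_sum => y _.
  have e0 := energy_ge0 h y; have := cos_le1 (angle R q * (l y : nat)%:R); rewrite -/(cosq R (l y)) => cl.
  case: ifP => [Py|_]; last by case: ifP => // _; rewrite mulr_ge0 //; lra.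
  have -> : y != 0 by apply: contraNneq P0 => <-.
  by rewrite mulrC ler_wpM2r //; have := cosq_le0 R q_pr (Pw y Py); lra.
have inv g : (forall c y, g (scale2 c y) = scale2 c (g y)) ->
    sqdist h (compose h g) <= E -> almost_invariant (energy h) (2 * E) g.
  move=> hg hc P P0; rewrite mulr_sumr.
  apply: (@le_trans _ _ (\sum_(y | P y) (energy h (g y) +
      3 * energy (fun x y => compose h g x y - h x y) y))).
    by apply: ler_sum => y _; apply: energy_compose.
  rewrite big_split /= -mulr_sumr lerD2l ler_pM2l //.
  apply: (@le_trans _ _ (2 * sqdist h (compose h g))); last by rewrite ler_pM2l.
  apply: le_trans (energy_sum_le (homogeneous_compose hh hg)).
  rewrite big_mkcond [X in _ <= X]big_mkcond /=; apply: ler_sum => y _.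
  case: ifP => [Py|_]; last by case: ifP => // _; apply: energy_ge0.
  by have -> : y != 0 by apply: contraNneq P0 => <-.
have w0 : wide (0 : F) = false by rewrite /wide muln0.
have key : \sum_(y : F * F | y != 0) energy h y <= 150 * (2 * E).
  apply: plane_bound => //.
  - by move=> y; apply: energy_ge0.
  - by move=> y; apply: energy_opp.
  - by apply: (wideP fst) => //=; rewrite w0.
  - by apply: (wideP snd) => //=; rewrite w0.
  - by apply: inv => // c [a b]; rewrite /shear1 /scale2 /= mulrDr.
  - by apply: inv => // c [a b]; rewrite /shear2 /scale2 /= mulrDr.
  - by apply: inv => // c [a b]; rewrite /unshear1 /scale2 /= mulrBr.
  - by apply: inv => // c [a b]; rewrite /unshear2 /scale2 /= mulrBr.
have -> : \sum_(y : F * F | y != 0) (\sum_x h x y ^+ 2 - (\sum_x h x y) ^+ 2 / q%:R) =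
   q%:R^-1 * ((q%:R - 1) * (\sum_(y : F * F | y != 0) energy h y)).
  rewrite parseval // mulr_sumr; apply: eq_bigr => y _.
  by rewrite mulrBr mulrA mulVf ?gt_eqF // mul1r mulrC.
have s0 : 0 <= \sum_(y : F * F | y != 0) energy h y.
  by apply: sumr_ge0 => y _; apply: energy_ge0.
rewrite mulrC ler_pdivrMr //; nra.
Qed.

End DirectionBound.

(** * Indicators of cones and the Efron-Stein inequality *)

Section Expansion.
Variables (R : realType) (q : nat) (q_pr : prime q).
Local Notation F := 'F_q.
Implicit Types (A B : {set proj_plane F}).

Definition vec3 (a b c : F) : 'cV[F]_3 := \col_(i < 3) nth 0 [:: a; b; c] i.

Lemma vec3_eta (v : 'cV[F]_3) :
  vec3 (v ord0 0) (v (lift ord0 ord0) 0) (v (lift ord0 (lift ord0 ord0)) 0) = v.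
Proof.
apply/matrixP => i j; rewrite !mxE (ord1 j).
by case: i => [[|[|[|//]]]] p /=; congr (v _ 0); apply: val_inj.
Qed.

Lemma vec3Z c x y z : c *: vec3 x y z = vec3 (c * x) (c * y) (c * z).
Proof. by apply/matrixP => i j; rewrite !mxE; case: i => [[|[|[|//]]]]. Qed.

(** The Fourier variable is the first coordinate here and the second in [ind2]. The third always
    stays in the pair, since fixing it to a nonzero value gives an affine chart. *)
Definition ind1 A x (y : F * F) : R := (vec3 x y.1 y.2 \in cone A)%:R.
Definition ind2 A x (y : F * F) : R := (vec3 y.1 x y.2 \in cone A)%:R.

Lemma ind1_homogeneous A : homogeneous (ind1 A).
Proof. by move=> c x [a b] c0; rewrite /ind1 /= -vec3Z coneZ. Qed.

Lemma ind2_homogeneous A : homogeneous (ind2 A).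
Proof. by move=> c x [a b] c0; rewrite /ind2 /= -vec3Z coneZ. Qed.

Lemma sum_vec3_1 (f : 'cV[F]_3 -> R) :
  \sum_(y : F * F) \sum_x f (vec3 x y.1 y.2) = \sum_v f v.
Proof.
rewrite pair_bigA /= (reindex (fun p : (F * F) * F => vec3 p.2 p.1.1 p.1.2)) //=.
exists (fun v => ((v (lift ord0 ord0) 0, v (lift ord0 (lift ord0 ord0)) 0), v ord0 0)).
  by move=> [[a b] c] _; rewrite !mxE.
by move=> v _ /=; rewrite vec3_eta.
Qed.

Lemma sum_vec3_2 (f : 'cV[F]_3 -> R) :
  \sum_(y : F * F) \sum_x f (vec3 y.1 x y.2) = \sum_v f v.
Proof.
rewrite pair_bigA /= (reindex (fun p : (F * F) * F => vec3 p.1.1 p.2 p.1.2)) //=.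
exists (fun v => ((v ord0 0, v (lift ord0 (lift ord0 ord0)) 0), v (lift ord0 ord0) 0)).
  by move=> [[a b] c] _; rewrite !mxE.
by move=> v _ /=; rewrite vec3_eta.
Qed.

Lemma sum_cone A : \sum_v ((v \in cone A)%:R : R) = #|cone A|%:R.
Proof. by rewrite -natr_sum -sum1_card [in RHS]big_mkcond. Qed.

(** [g] permutes the vectors, so as many enter the cone of [A] as leave it, and those that leave
    land in the cone of [B] outside that of [A]. *)
Lemma cone_displacement A B (g : SL3 int) : A \subset B -> Phi q g @: A \subset B ->
  \sum_v ((SL3_mod q g *m v \in cone A)%:R - (v \in cone A)%:R) ^+ 2 <=
  2 * (#|cone B|%:R - #|cone A|%:R) :> R.
Proof.
move=> AB gAB; set s := fun v : 'cV[F]_3 => SL3_mod q g *m v.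
have s_inj : injective s by apply: SL3_mul_inj.
have cAB : cone A \subset cone B.
  apply/fintype.subsetP => v; rewrite !inE => /existsP[X /andP[XA vX]].
  by apply/existsP; exists X; rewrite (fintype.subsetP AB).
have sAB v : v \in cone A -> s v \in cone B.
  rewrite inE => /existsP[X /andP[XA vX]]; rewrite (@mem_cone _ _ (Phi q g X)).
    by apply: (fintype.subsetP gAB); apply: imset_f.
  by rewrite mem_Phi.
have -> : \sum_v ((s v \in cone A)%:R - (v \in cone A)%:R) ^+ 2 =
   \sum_v ((s v \in cone A)%:R - (v \in cone A)%:R +
      2 * ((v \in cone A) && (s v \notin cone A))%:R) :> R.
  by apply: eq_bigr => v _; case: (v \in cone A); case: (s v \in cone A) => /=; ring.
rewrite big_split /= sumrB.
have <- : \sum_v ((v \in cone A)%:R : R) = \sum_v (s v \in cone A)%:R.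
  by rewrite [LHS](reindex_inj s_inj).
rewrite subrr add0r -mulr_sumr ler_pM2l //.
rewrite -!sum_cone -sumrB [X in _ <= X](reindex_inj s_inj) /= -natr_sum.
have -> : \sum_v (((s v \in cone B)%:R : R) - (s v \in cone A)%:R) =
  (\sum_v ((s v \in cone B) && (s v \notin cone A)))%N%:R.
  rewrite natr_sum; apply: eq_bigr => v _.
  case sA : (s v \in cone A); last by rewrite subr0 andbT.
  by rewrite (fintype.subsetP cAB) // subrr.
rewrite ler_nat; apply: leq_sum => v _.
by case vA : (v \in cone A) => //=; rewrite sAB.
Qed.

(** The right side minus the left is the sum of the squares of [g] with row and column means
    removed, which is [w a b - m a] below. *)
Lemma efron_stein (g : F -> F -> R) :
  \sum_b \sum_a g a b ^+ 2 - (\sum_b \sum_a g a b) ^+ 2 / q%:R ^+ 2 <=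
  \sum_b (\sum_a g a b ^+ 2 - (\sum_a g a b) ^+ 2 / q%:R) +
  \sum_a (\sum_b g a b ^+ 2 - (\sum_b g a b) ^+ 2 / q%:R).
Proof.
pose r b := \sum_a g a b; pose c a := \sum_b g a b; pose S := \sum_b r b.
pose Q := \sum_b \sum_a g a b ^+ 2.
have q0 : q%:R != 0 :> R by rewrite pnatr_eq0 -lt0n prime_gt0.
have Sc : \sum_a c a = S by rewrite /S /r exchange_big.
have cst (x : R) : \sum_(a : F) x = q%:R * x by rewrite sumr_const card_Fp // mulr_natl.
pose w a b := g a b - r b / q%:R; pose m a := c a / q%:R - S / q%:R ^+ 2.
have sw a : \sum_b w a b = q%:R * m a.
  by rewrite sumrB -mulr_suml -/S -/(c a) /m; field.
have sww b : \sum_a w a b ^+ 2 = \sum_a g a b ^+ 2 - r b ^+ 2 / q%:R.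
  transitivity (\sum_a (g a b ^+ 2 - 2 / q%:R * r b * g a b + (r b / q%:R) ^+ 2)).
    by apply: eq_bigr => a _; rewrite /w; field.
  by rewrite big_split sumrB /= cst -mulr_sumr -/(r b); field.
have smm : q%:R * (\sum_a m a ^+ 2) = (\sum_a c a ^+ 2) / q%:R - S ^+ 2 / q%:R ^+ 2.
  have -> : \sum_a m a ^+ 2 = \sum_a (c a ^+ 2 * q%:R ^- 2 - 2 * S / q%:R ^+ 3 * c a + S ^+ 2 / q%:R ^+ 4).
    by apply: eq_bigr => a _; rewrite /m; field.
  by rewrite big_split sumrB /= cst -mulr_sumr -mulr_suml Sc; field.
have : 0 <= \sum_a \sum_b (w a b - m a) ^+ 2.
  by apply: sumr_ge0 => b _; apply: sumr_ge0 => a _; apply: sqr_ge0.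
have -> : \sum_a \sum_b (w a b - m a) ^+ 2 = \sum_a \sum_b w a b ^+ 2 - q%:R * \sum_a m a ^+ 2.
  rewrite mulr_sumr -sumrB; apply: eq_bigr => a _.
  transitivity (\sum_b (w a b ^+ 2 - 2 * m a * w a b + m a ^+ 2)).
    by apply: eq_bigr => b _; ring.
  by rewrite big_split sumrB /= cst -mulr_sumr sw; ring.
rewrite exchange_big smm /=; under eq_bigr do rewrite sww.
rewrite !sumrB -!mulr_suml [\sum_a \sum_b _ ^+ 2]exchange_big /= -/Q -/r -/S.
rewrite -/(r _) -/(c _).
set U := \sum_a c a ^+ 2; set V := \sum_b r b ^+ 2 => h.
lra.
Qed.

End Expansion.

(** * Expansion of subsets of the projective plane *)

Section ExpansionTheorem.
Variables (R : realType) (q : nat) (q_pr : prime q).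
Local Notation F := 'F_q.
Implicit Types (A B : {set proj_plane F}).

Let o0 : 'I_3 := ord0.
Let o1 : 'I_3 := lift ord0 ord0.
Let o2 : 'I_3 := lift ord0 (lift ord0 ord0).

Lemma elem_vec3 i j s (ij : i != j) (a b c : F) :
  SL3_mod q (elem s ij) *m vec3 a b c =
  let x := s%:~R * nth 0 [:: a; b; c] j in
  vec3 (a + (i == o0)%:R * x) (b + (i == o1)%:R * x) (c + (i == o2)%:R * x).
Proof.
rewrite SL3_mod_elem; apply/matrixP => k l; rewrite !mxE (ord1 l) andbT mulrC.
rewrite [k == i]eq_sym.
by case: k => [[|[|[|//]]]] p.
Qed.

(** [B] absorbs one round of the generators applied to [A], inverses included; in the application
    [A] and [B] are successive sets of reached points. *)
Definition gen_closed A B :=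
  A \subset B /\
  forall i j (ij : i != j) s, (`|s| <= 1)%N -> Phi q (elem s ij) @: A \subset B.

Lemma sqdist_ind1 A B (l : F -> F * F -> F) (g : F * F -> F * F) i j (ij : i != j) s :
  gen_closed A B -> (`|s| <= 1)%N ->
  (forall x y, SL3_mod q (elem s ij) *m vec3 x y.1 y.2 = vec3 (l x y) (g y).1 (g y).2) ->
  sqdist (ind1 R A) (fun x y => ind1 R A (l x y) (g y)) <= 2 * (#|cone B|%:R - #|cone A|%:R).
Proof.
move=> [AB gAB] s1 e; apply: le_trans (cone_displacement R AB (gAB _ _ ij _ s1)).
rewrite -sum_vec3_1 /sqdist big_mkcond; apply: ler_sum => y _; rewrite /ind1.
case: ifP => _; last by apply: sumr_ge0 => x _; apply: sqr_ge0.
by apply: ler_sum => x _; rewrite e.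
Qed.

Lemma sqdist_ind2 A B (l : F -> F * F -> F) (g : F * F -> F * F) i j (ij : i != j) s :
  gen_closed A B -> (`|s| <= 1)%N ->
  (forall x y, SL3_mod q (elem s ij) *m vec3 y.1 x y.2 = vec3 (g y).1 (l x y) (g y).2) ->
  sqdist (ind2 R A) (fun x y => ind2 R A (l x y) (g y)) <= 2 * (#|cone B|%:R - #|cone A|%:R).
Proof.
move=> [AB gAB] s1 e; apply: le_trans (cone_displacement R AB (gAB _ _ ij _ s1)).
rewrite -sum_vec3_2 /sqdist big_mkcond; apply: ler_sum => y _; rewrite /ind2.
case: ifP => _; last by apply: sumr_ge0 => x _; apply: sqr_ge0.
by apply: ler_sum => x _; rewrite e.
Qed.

Let simp := (mul1r, mul0r, addr0, mulN1r).

(** Adding the second or third coordinate to the first translates the Fourier variable; adding these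
    two to each other, with either sign, shears the pair. The constant is 300 times the 2 of
    [cone_displacement]. *)
Lemma variance_ind1 A B : gen_closed A B ->
  \sum_(y : F * F | y != 0)
    (\sum_x ind1 R A x y ^+ 2 - (\sum_x ind1 R A x y) ^+ 2 / q%:R) <=
  600 * (#|cone B|%:R - #|cone A|%:R).
Proof.
move=> AB; have -> : 600 * (#|cone B|%:R - #|cone A|%:R) =
  300 * (2 * (#|cone B|%:R - #|cone A|%:R)) :> R by ring.
apply: direction_bound => //; first exact: ind1_homogeneous.
- refine (sqdist_ind1 (l := fun x y => x + y.1) (g := id) (i := o0) (j := o1) (s := 1) (ij := isT) AB _ _) => //.
  by move=> x [b c]; rewrite elem_vec3 /= !simp.
- refine (sqdist_ind1 (l := fun x y => x + y.2) (g := id) (i := o0) (j := o2) (s := 1) (ij := isT) AB _ _) => //.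
  by move=> x [b c]; rewrite elem_vec3 /= !simp.
- refine (sqdist_ind1 (l := fun x y => x) (g := @shear1 q) (i := o1) (j := o2) (s := 1) (ij := isT) AB _ _) => //.
  by move=> x [b c]; rewrite elem_vec3 /= !simp.
- refine (sqdist_ind1 (l := fun x y => x) (g := @shear2 q) (i := o2) (j := o1) (s := 1) (ij := isT) AB _ _) => //.
  by move=> x [b c]; rewrite elem_vec3 /= !simp addrC.
- refine (sqdist_ind1 (l := fun x y => x) (g := @unshear1 q) (i := o1) (j := o2) (s := -1) (ij := isT) AB _ _) => //.
  by move=> x [b c]; rewrite elem_vec3 /= !simp.
- refine (sqdist_ind1 (l := fun x y => x) (g := @unshear2 q) (i := o2) (j := o1) (s := -1) (ij := isT) AB _ _) => //.
  by move=> x [b c]; rewrite elem_vec3 /= !simp.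
Qed.

Lemma variance_ind2 A B : gen_closed A B ->
  \sum_(y : F * F | y != 0)
    (\sum_x ind2 R A x y ^+ 2 - (\sum_x ind2 R A x y) ^+ 2 / q%:R) <=
  600 * (#|cone B|%:R - #|cone A|%:R).
Proof.
move=> AB; have -> : 600 * (#|cone B|%:R - #|cone A|%:R) =
  300 * (2 * (#|cone B|%:R - #|cone A|%:R)) :> R by ring.
apply: direction_bound => //; first exact: ind2_homogeneous.
- refine (sqdist_ind2 (l := fun x y => x + y.1) (g := id) (i := o1) (j := o0) (s := 1) (ij := isT) AB _ _) => //.
  by move=> x [b c]; rewrite elem_vec3 /= !simp.
- refine (sqdist_ind2 (l := fun x y => x + y.2) (g := id) (i := o1) (j := o2) (s := 1) (ij := isT) AB _ _) => //.
  by move=> x [b c]; rewrite elem_vec3 /= !simp.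
- refine (sqdist_ind2 (l := fun x y => x) (g := @shear1 q) (i := o0) (j := o2) (s := 1) (ij := isT) AB _ _) => //.
  by move=> x [b c]; rewrite elem_vec3 /= !simp.
- refine (sqdist_ind2 (l := fun x y => x) (g := @shear2 q) (i := o2) (j := o0) (s := 1) (ij := isT) AB _ _) => //.
  by move=> x [b c]; rewrite elem_vec3 /= !simp addrC.
- refine (sqdist_ind2 (l := fun x y => x) (g := @unshear1 q) (i := o0) (j := o2) (s := -1) (ij := isT) AB _ _) => //.
  by move=> x [b c]; rewrite elem_vec3 /= !simp.
- refine (sqdist_ind2 (l := fun x y => x) (g := @unshear2 q) (i := o2) (j := o0) (s := -1) (ij := isT) AB _ _) => //.
  by move=> x [b c]; rewrite elem_vec3 /= !simp.
Qed.

Lemma variance_ge0 (f : F -> R) : 0 <= \sum_x f x ^+ 2 - (\sum_x f x) ^+ 2 / q%:R.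
Proof.
have q0 : 0 < q%:R :> R by rewrite ltr0n prime_gt0.
have cst (x : R) : \sum_(a : F) x = q%:R * x by rewrite sumr_const card_Fp // mulr_natl.
have : 0 <= \sum_x (f x - (\sum_x f x) / q%:R) ^+ 2 by apply: sumr_ge0 => x _; apply: sqr_ge0.
set S := \sum_x f x.
have -> : \sum_x (f x - S / q%:R) ^+ 2 =
   \sum_x (f x ^+ 2 - 2 * S / q%:R * f x + (S / q%:R) ^+ 2).
  by apply: eq_bigr => x _; ring.
rewrite big_split sumrB /= cst -mulr_sumr -/S => h.
have -> : \sum_x f x ^+ 2 - S ^+ 2 / q%:R = \sum_x f x ^+ 2 - 2 * S / q%:R * S + q%:R * (S / q%:R) ^+ 2.
  by field; rewrite gt_eqF.
exact: h.
Qed.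

Lemma slices_le (f : F * F -> R) : (forall y, 0 <= f y) ->
  \sum_(c : F | c != 0) \sum_b f (b, c) <= \sum_(y : F * F | y != 0) f y.
Proof.
move=> f0; rewrite pair_big_dep /= (reindex_inj (h := fun y : F * F => (y.2, y.1))) /=; last first.
  by move=> [a b] [a' b'] [-> ->].
rewrite big_mkcond [X in _ <= X]big_mkcond /=; apply: ler_sum => -[b c] _ /=.
rewrite xpair_eqE negb_and; case: (eqVneq c 0) => [->|c0] /=; last by rewrite orbT.
by case: ifP.
Qed.

(** On each of the [q - 1] slices with nonzero last coordinate, the indicator has the same variance
    term a - a^2 / q^2, by homogeneity. Efron-Stein bounds it by the variances along the first two
    coordinates, and the sum over the slices is controlled by [variance_ind1] and
    [variance_ind2]. *)
Lemma expansion A B : gen_closed A B ->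
  exists a : R, [/\ 0 <= a, a <= #|A|%:R, #|A|%:R <= a + q%:R + 1 &
     a * (q%:R ^+ 2 - a) <= 1200 * q%:R ^+ 2 * (#|B|%:R - #|A|%:R)].
Proof.
move=> AB; have q1 : 1 < q%:R :> R by rewrite ltr1n prime_gt1.
(* [a] counts the points of [A] off the line where the last coordinate is 0. *)
pose a : R := \sum_b \sum_x ind1 R A x (b, 1).
have slice c : c != 0 -> \sum_b \sum_x ind1 R A x (b, c) = a.
  move=> c0; rewrite (reindex_inj (mulfI c0)); apply: eq_bigr => b _ /=.
  rewrite (reindex_inj (mulfI c0)); apply: eq_bigr => x _ /=.
  have -> : (c * b, c) = scale2 c (b, 1) by rewrite /scale2 /= mulr1.
  by rewrite ind1_homogeneous.
have cst (x : R) : \sum_(c : F | c != 0) x = (q%:R - 1) * x.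
  have := sumr_const (F : finType) x; rewrite card_Fp // (bigD1 (0 : F)) //=.
  by move=> e; rewrite mulrBl mul1r mulr_natl -e addrAC subrr add0r.
have total : #|cone A|%:R = (q%:R - 1) * a + \sum_b \sum_x ind1 R A x (b, 0).
  rewrite -sum_cone -sum_vec3_1 -(pair_bigA _ (fun b c => \sum_x ind1 R A x (b, c))) /=.
  rewrite exchange_big /= (bigD1 (0 : F)) //= addrC -cst; congr (_ + _).
  by apply: eq_bigr => c c0; apply: slice.
have cardF (C : {set proj_plane F}) : #|cone C|%:R = (q%:R - 1) * #|C|%:R :> R.
  have -> : #|cone C| = (#|C| * q.-1)%N by rewrite card_cone; congr (_ * _.-1)%N; exact (card_Fp q_pr).
  by rewrite natrM mulrC -subn1 natrB // prime_gt0.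
have bot0 : 0 <= \sum_b \sum_x ind1 R A x (b, 0).
  by apply: sumr_ge0 => b _; apply: sumr_ge0 => x _; apply: ler0n.
(* The zero vector is not in the cone; dividing by [q - 1] leaves the [q + 1] points of the line at
   infinity. *)
have bot1 : \sum_b \sum_x ind1 R A x (b, 0) <= q%:R ^+ 2 - 1.
  rewrite (bigD1 (0 : F)) //= (bigD1 (0 : F)) //= {1}/ind1 /=.
  have -> : vec3 0 0 0 \in cone A = false.
    apply/negbTE; have -> : vec3 0 0 0 = 0 :> 'cV[F]_3; last exact: cone0.
    by apply/matrixP => i j; rewrite !mxE; case: i => [[|[|[|//]]]].
  rewrite add0r; apply: (@le_trans _ _ (\sum_(x : F | x != 0) 1 + \sum_(b : F | b != 0) \sum_(x : F) 1)).
    apply: lerD; first by apply: ler_sum => x _; rewrite /ind1; case: (_ \in _).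
    by apply: ler_sum => b _; apply: ler_sum => x _; rewrite /ind1; case: (_ \in _).
  have all1 : \sum_(x : F) (1 : R) = q%:R by rewrite sumr_const card_Fp.
  by under [X in _ + X <= _]eq_bigr do rewrite all1; rewrite !cst expr2; lra.
have idem x y : ind1 R A x y ^+ 2 = ind1 R A x y by rewrite /ind1; case: (_ \in _); rewrite ?expr1n ?expr0n.
exists a; rewrite cardF in total; split.
- by apply: sumr_ge0 => b _; apply: sumr_ge0 => x _; apply: ler0n.
- suff : (q%:R - 1) * a <= (q%:R - 1) * #|A|%:R by rewrite ler_pM2l //; lra.
  by rewrite total; lra.
- suff : (q%:R - 1) * #|A|%:R <= (q%:R - 1) * (a + q%:R + 1) by rewrite ler_pM2l //; lra.
  by rewrite total; move: bot1; rewrite expr2 => ?; lra.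
have v1 := variance_ind1 AB; have v2 := variance_ind2 AB.
rewrite !cardF in v1 v2.
have := le_trans (slices_le (fun y => variance_ge0 (ind1 R A ^~ y))) v1.
have := le_trans (slices_le (fun y => variance_ge0 (ind2 R A ^~ y))) v2.
have es c : c != 0 -> a - a ^+ 2 / q%:R ^+ 2 <=
  \sum_b (\sum_x ind1 R A x (b, c) ^+ 2 - (\sum_x ind1 R A x (b, c)) ^+ 2 / q%:R) +
  \sum_b (\sum_x ind2 R A x (b, c) ^+ 2 - (\sum_x ind2 R A x (b, c)) ^+ 2 / q%:R).
  move=> c0; have := efron_stein q_pr (fun x b => ind1 R A x (b, c)).
  under eq_bigr do under eq_bigr do rewrite idem.
  by rewrite slice.
have : \sum_(c : F | c != 0) (a - a ^+ 2 / q%:R ^+ 2) <= \sum_(c : F | c != 0)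
  (\sum_b (\sum_x ind1 R A x (b, c) ^+ 2 - (\sum_x ind1 R A x (b, c)) ^+ 2 / q%:R) +
   \sum_b (\sum_x ind2 R A x (b, c) ^+ 2 - (\sum_x ind2 R A x (b, c)) ^+ 2 / q%:R)).
  by apply: ler_sum => c c0; apply: es.
rewrite cst big_split /= => h1 h2 h3.
have : (q%:R - 1) * (a - a ^+ 2 / q%:R ^+ 2) <= (q%:R - 1) * (1200 * (#|B|%:R - #|A|%:R)).
  by apply: (le_trans h1); lra.
rewrite ler_pM2l; last by lra.
have q0 : 0 < q%:R ^+ 2 :> R by rewrite exprn_gt0 //; lra.
rewrite -(ler_pM2l q0) => h.
have -> : a * (q%:R ^+ 2 - a) = q%:R ^+ 2 * (a - a ^+ 2 / q%:R ^+ 2).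
  by field; rewrite gt_eqF //; lra.
by apply: (le_trans h); rewrite le_eqVlt; apply/orP; left; apply/eqP; ring.
Qed.

End ExpansionTheorem.

(** * Lattice points orthogonal to an integer vector *)

Section LatticeCount.

Definition bounded_mx m n (B : nat) (A : 'M[int]_(m, n)) := (mx_maxnorm A <= B)%N.

Lemma bounded_mxP m n (B : nat) (A : 'M[int]_(m, n)) :
  reflect (forall i j, (`|A i j| <= B)%N) (bounded_mx B A).
Proof. exact: mx_maxnormP. Qed.

Lemma size_bounded m n (B : nat) (s : seq 'M[int]_(m, n)) :
  uniq s -> all (bounded_mx B) s -> (size s <= (2 * B).+1 ^ (m * n))%N.
Proof.
move=> us /allP hs.
pose enc (A : 'M[int]_(m, n)) : 'M['I_(2 * B).+1]_(m, n) := map_mx (fun z => inord `|z + B%:Z|) A.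
have enc_inj : {in s &, injective enc}.
  move=> A A' /hs/bounded_mxP hA /hs/bounded_mxP hA' /matrixP e.
  apply/matrixP => i j; have := e i j; have := hA i j; have := hA' i j; rewrite !mxE.
  move: (A i j) (A' i j) => x y hy hx /(congr1 val) /=.
  by rewrite !inordK; lia.
rewrite -(size_map enc) -(card_uniqP _); last by rewrite map_inj_in_uniq.
by apply: leq_trans (max_card _) _; rewrite card_mx card_ord.
Qed.

Lemma absz_sum_le (I : finType) (f : I -> int) :
  (`|(\sum_i f i)%R| <= \sum_i `|f i|)%N.
Proof. by elim/big_ind2: _ => // a b c d h1 h2; lia. Qed.

(* Reduction modulo the rows of [V], with the rational coordinates of [y]
   replaced by the row vector [y *m \adj V] over the denominator [\det V]. *)
Lemma reduce_mod_rows k (T : nat) (V : 'M[int]_k) (y : 'rV[int]_k) :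
  \det V != 0 -> bounded_mx T V ->
  exists n : 'rV[int]_k, bounded_mx (k * T) (y - n *m V).
Proof.
move=> D0 /bounded_mxP hV; set D := \det V.
pose t := y *m \adj V; pose n := \row_j (t ord0 j %/ D)%Z; pose r := \row_j (t ord0 j %% D)%Z.
have et : t = D *: n + r.
  by apply/rowP => j; rewrite !mxE mulrC -divz_eq.
exists n; apply/bounded_mxP => i j; rewrite (ord1 i) {i}.
have e : D *: (y - n *m V) = r *m V.
  have : t *m V = D *: y by rewrite -mulmxA mul_adj_mx mul_mx_scalar.
  rewrite et mulmxDl -scalemxAl scalerBr => <-.
  by rewrite addrAC subrr add0r.
have ez : (`|D| * `|(y - n *m V)%R ord0 j| = `|(r *m V)%R ord0 j|)%N.
  by rewrite -e [in RHS]mxE abszM.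
suff : (`|D| * `|(y - n *m V)%R ord0 j| <= `|D| * (k * T))%N by rewrite leq_pmul2l // absz_gt0.
rewrite ez mxE; apply: leq_trans (absz_sum_le _) _.
have -> : (`|D| * (k * T) = \sum_(i < k) `|D| * T)%N.
  by rewrite sum_nat_const card_ord mulnCA.
apply: leq_sum => i _; rewrite abszM leq_mul //.
rewrite mxE; have := ltz_mod (t ord0 i) D0; have := modz_ge0 (t ord0 i) D0; lia.
Qed.

(* Translating the lattice points by small representatives of the [m] residue
   classes packs them disjointly into a larger box. *)
Lemma lattice_packing k (T m : nat) (V : 'M[int]_k) (f : 'rV[int]_k -> int)
    (y0 : 'rV[int]_k) (s : seq 'rV[int]_k) :
  (0 < m)%N -> \det V != 0 -> bounded_mx T V ->
  {morph f : y z / y + z} -> (forall a, {morph f : y / a *: y >-> a * y}) ->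
  (forall i, (m %| f (row i V))%Z) -> (f y0 = 1 %[mod m])%Z ->
  uniq s -> all (bounded_mx T) s -> (forall y, y \in s -> (m %| f y)%Z) ->
  (size s * m <= (2 * (k.+1 * T)).+1 ^ k)%N.
Proof.
move=> m0 D0 hV fD fZ fr fy0 us bs sf.
have f0 : f 0 = 0 by rewrite -(scale0r 0) fZ mul0r.
have fV n : (m %| f (n *m V))%Z.
  rewrite mulmx_sum_row (big_morph f fD f0).
  apply: (@big_ind _ (fun x => (m %| x)%Z)) => [|x y hx hy|i _]; first exact: dvdz0.
    by rewrite rpredD.
  by rewrite fZ dvdz_mull.
(* Since [f y0] is 1 modulo [m], multiples of [y0] meet every residue class; reducing them modulo
   the rows of [V] keeps the class. *)
have [rep hrep] : {rep : nat -> 'rV[int]_k &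
    forall j, bounded_mx (k * T) (rep j) /\ (f (rep j) = j%:Z %[mod m])%Z}.
  refine (boolp.choice (P := fun (j : nat) r => bounded_mx (k * T) r /\ (f r = j%:Z %[mod m])%Z) _) => j.
  have [c hc] := reduce_mod_rows (j%:Z *: y0) D0 hV.
  exists (j%:Z *: y0 - c *m V); split=> //.
  rewrite fD -scaleN1r !fZ mulN1r; have /dvdzP[u ->] := fV c.
  by rewrite addrC -mulNr modzMDl -modzMmr fy0 modzMmr mulr1.
pose ss := [seq y + rep j | y <- s, j <- iota 0 m].
have <- : size ss = (size s * m)%N by rewrite size_allpairs size_iota.
have := @size_bounded 1 k (k.+1 * T) ss; rewrite mul1n; apply.
  apply: allpairs_uniq => //; first exact: iota_uniq.
  move=> [y j] [y' j'] /allpairsP[[a b] /= [as_ bi [-> ->]]].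
  move=> /allpairsP[[a' b'] /= [as' bi' [-> ->]]] e.
  (* [f] is divisible by [m] on [s], so modulo [m] it reads off the index of the translate. *)
  have bb : b = b'.
    have ef : f a + f (rep b) = f a' + f (rep b') by rewrite -[LHS]fD -[RHS]fD e.
    have : (f (rep b) = f (rep b') %[mod m])%Z.
      have /dvdzP[u eu] := sf _ as_; have /dvdzP[u' eu'] := sf _ as'.
      have -> : f (rep b) = (u' - u) * m%:Z + f (rep b').
        by rewrite -[LHS](addKr (f a)) ef eu eu'; ring.
      by rewrite modzMDl.
    rewrite mem_iota /= in bi; rewrite mem_iota /= in bi'.
    by rewrite (hrep b).2 (hrep b').2 !modz_nat !modn_small // => -[].
  have ea : a + rep b' = a' + rep b' by rewrite -[in LHS]bb.
  by rewrite bb (addIr _ ea).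
apply/allP => z /allpairsP[[y j] /= [ys _ ->]]; apply/bounded_mxP => i l.
rewrite mxE; have /bounded_mxP/(_ i l) := allP bs _ ys.
by have /bounded_mxP/(_ i l) := (hrep j).1; move: (rep j i l) (y i l); lia.
Qed.

End LatticeCount.

(** * Primitive vectors, cross products and orthogonal lattices *)

Section Orthogonal.

Definition dot (R : comNzRingType) n (u v : 'rV[R]_n) : R := \sum_i u ord0 i * v ord0 i.

Lemma dotC (R : comNzRingType) n (u v : 'rV[R]_n) : dot u v = dot v u.
Proof. by apply: eq_bigr => i _; rewrite mulrC. Qed.

Lemma dotDl (R : comNzRingType) n (u v w : 'rV[R]_n) : dot (u + v) w = dot u w + dot v w.
Proof. by rewrite -big_split; apply: eq_bigr => i _; rewrite mxE mulrDl. Qed.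

Lemma dotZl (R : comNzRingType) n (a : R) (u w : 'rV[R]_n) : dot (a *: u) w = a * dot u w.
Proof. by rewrite mulr_sumr; apply: eq_bigr => i _; rewrite mxE mulrA. Qed.

Lemma dotZr (R : comNzRingType) n (a : R) (u w : 'rV[R]_n) : dot u (a *: w) = a * dot u w.
Proof. by rewrite dotC dotZl dotC. Qed.

(** Coprimality in Bezout form. The witness serves as the vector of residue 1 in [orthogonal_count]
    and as the unreduced third row in [completion]. *)
Definition primitive n (K : 'rV[int]_n) := exists u, dot u K = 1.

Lemma bezout_row n (w : 'rV[int]_n) : exists u, forall i, (dot u w %| w ord0 i)%Z.
Proof.
suff [u hu] : exists u, forall i, i \in enum 'I_n -> (dot u w %| w ord0 i)%Z.
  by exists u => i; apply: hu; rewrite mem_enum.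
elim: (enum 'I_n) => [|a s [u hu]]; first by exists 0.
have [x [y hxy]] := Bezoutz (dot u w) (w ord0 a).
have e : dot (x *: u + y *: delta_mx 0 a) w = gcdz (dot u w) (w ord0 a).
  rewrite -hxy dotDl !dotZl; congr (_ + _ * _).
  rewrite /dot (bigD1 a) //= big1 => [|i /negbTE ia]; first by rewrite mxE !eqxx mul1r addr0.
  by rewrite mxE ia andbF mul0r.
exists (x *: u + y *: delta_mx 0 a) => i; rewrite e inE => /predU1P[->|is_].
  exact: dvdz_gcdr.
exact: dvdz_trans (dvdz_gcdl _ _) (hu _ is_).
Qed.

Lemma primitive_part n (w : 'rV[int]_n) : w != 0 ->
  exists g K, [/\ g != 0, primitive K & w = g *: K].
Proof.
move=> w0; have [u hu] := bezout_row w.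
have e : w = dot u w *: \row_i (w ord0 i %/ dot u w)%Z.
  by apply/rowP => i; rewrite !mxE mulrC divzK.
have g0 : dot u w != 0 by apply: contraNneq w0 => g0; rewrite e g0 scale0r.
exists (dot u w), (\row_i (w ord0 i %/ dot u w)%Z); split=> //.
by exists u; apply: (mulfI g0); rewrite -dotZr -e mulr1.
Qed.

(** The generalized cross product: signed maximal minors, orthogonal to every row. *)
Definition cross (R : comNzRingType) k (V : 'M[R]_(k, k.+1)) : 'rV[R]_k.+1 :=
  \row_i ((-1) ^+ i * \det (col' i V)).

Lemma dot_cross (R : comNzRingType) k (r : 'rV[R]_k.+1) (V : 'M[R]_(k, k.+1)) :
  dot r (cross V) = \det (col_mx r V : 'M[R]_(1 + k)).
Proof.
rewrite (expand_det_row _ (ord0 : 'I_(1 + k)%N)); apply: eq_bigr => i _.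
have -> : (ord0 : 'I_(1 + k)) = lshift k ord0 by apply: val_inj.
rewrite col_mxEu mxE /cofactor add0n; congr (_ * (_ * \det _)).
apply/matrixP => a b; rewrite !mxE.
have -> : lift (lshift k (ord0 : 'I_1)) a = rshift 1 a by apply: val_inj.
by case: splitP => j; [rewrite /= => h; have := ltn_ord j; rewrite -h | move/addnI/val_inj ->].
Qed.

Lemma cross_orth (R : comNzRingType) k (V : 'M[R]_(k, k.+1)) i : dot (row i V) (cross V) = 0.
Proof.
rewrite dot_cross; apply: (determinant_alternate (i1 := lshift k ord0) (i2 := rshift 1 i)) => //.
by move=> j; rewrite col_mxEu col_mxEd mxE.
Qed.

Lemma bounded_det n (B : nat) (A : 'M[int]_n) :
  bounded_mx B A -> (`|\det A| <= n`! * B ^ n)%N.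
Proof.
move=> /bounded_mxP hA; apply: leq_trans (absz_sum_le _) _.
rewrite -card_Sn -sum_nat_const; apply: leq_sum => s _.
rewrite abszM abszX abszN1 exp1n mul1n.
have -> : (`|(\prod_i A i (s i))%R| = \prod_i `|A i (s i)|)%N.
  by apply: (big_morph _ abszM).
have -> : (B ^ n = \prod_(i < n) B)%N by rewrite prod_nat_const card_ord.
by apply: leq_prod => i _; apply: hA.
Qed.

Lemma bounded_cross k (B : nat) (V : 'M[int]_(k, k.+1)) :
  bounded_mx B V -> bounded_mx (k`! * B ^ k) (cross V).
Proof.
move=> /bounded_mxP hV; apply/bounded_mxP => i j; rewrite mxE abszM abszX abszN1 exp1n mul1n.
by apply: bounded_det; apply/bounded_mxP => a b; rewrite mxE.
Qed.

Lemma dot_split (R : comNzRingType) k (i0 : 'I_k.+1) (u v : 'rV[R]_k.+1) :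
  dot u v = u ord0 i0 * v ord0 i0 + dot (col' i0 u) (col' i0 v).
Proof.
rewrite /dot (bigD1_ord i0) //=; congr (_ + _).
by apply: eq_bigr => i _; rewrite !mxE.
Qed.

(** Deleting coordinate [i0] is injective on the lattice orthogonal to [K], and sends it to vectors
    whose product with the remaining part of [K] is divisible by the deleted coordinate of [K].
    Primitivity supplies a vector of residue 1, so [lattice_packing] applies. *)
Lemma orthogonal_count k (T : nat) (V : 'M[int]_(k, k.+1)) (K : 'rV[int]_k.+1)
    (g : int) (s : seq 'rV[int]_k.+1) (i0 : 'I_k.+1) :
  bounded_mx T V -> g != 0 -> cross V = g *: K -> primitive K ->
  uniq s -> all (bounded_mx T) s -> (forall y, y \in s -> dot y K = 0) ->
  (size s * `|K ord0 i0| <= (2 * (k.+1 * T)).+1 ^ k)%N.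
Proof.
move=> /bounded_mxP hV g0 eK [u uK] us /allP bs sK.
case: (eqVneq (K ord0 i0) 0) => [->|K0]; first by rewrite muln0.
have VK i : dot (row i V) K = 0.
  by apply: (mulfI g0); rewrite -dotZr -eK cross_orth mulr0.
pose f (y : 'rV[int]_k) := dot y (col' i0 K).
have fc y : f (col' i0 y) = dot y K - y ord0 i0 * K ord0 i0.
  by rewrite (dot_split i0 y) addrAC subrr add0r.
rewrite -(size_map (col' i0)).
apply: (@lattice_packing _ _ _ (col' i0 V) f (col' i0 u)).
- by rewrite absz_gt0.
- have := congr1 (fun w : 'rV_k.+1 => w ord0 i0) eK; rewrite !mxE => e.
  by apply: contraNneq K0 => d0; move/eqP: e; rewrite d0 mulr0 eq_sym mulf_eq0 (negbTE g0).
- by apply/bounded_mxP => i j; rewrite mxE.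
- by move=> y z; rewrite /f dotDl.
- by move=> a y; rewrite /f dotZl.
- move=> i; have -> : row i (col' i0 V) = col' i0 (row i V) by apply/rowP => j; rewrite !mxE.
  by rewrite fc VK sub0r rpredN dvdz_mull // dvdzE.
- rewrite fc uK -mulNr addrC; have /dvdzP[c ec] : ((`|K ord0 i0|%N : int) %| K ord0 i0)%Z.
    by rewrite dvdzE.
  by rewrite {1}ec mulrA modzMDl.
- rewrite map_inj_in_uniq // => y z ys zs e.
  have : y ord0 i0 * K ord0 i0 = z ord0 i0 * K ord0 i0.
    by have := fc y; rewrite e fc !sK // !sub0r => /eqP; rewrite eqr_opp => /eqP.
  move/(mulIf K0) => e0; apply/rowP => j.
  case: (unliftP i0 j) => [j' ->|-> //].
  by have /rowP/(_ j') := e; rewrite !mxE.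
- apply/allP => z /mapP[y ys ->]; apply/bounded_mxP => i j; rewrite mxE.
  by have /bounded_mxP := bs _ ys.
- move=> z /mapP[y ys ->]; rewrite fc sK // sub0r rpredN dvdz_mull //.
  by rewrite dvdzE.
Qed.

End Orthogonal.

(** * Integer vectors of given maximum norm *)

Section Shells.

Definition box m n (B : nat) : seq 'M[int]_(m, n) :=
  [seq map_mx (fun i : 'I_(2 * B).+1 => (i : nat)%:Z - B%:Z) A | A <- enum 'M['I_(2 * B).+1]_(m, n)].

Lemma mem_box m n B (A : 'M[int]_(m, n)) : (A \in box m n B) = bounded_mx B A.
Proof.
apply/mapP/bounded_mxP => [[A' _ ->] i j|hA].
  rewrite mxE; have := ltn_ord (A' i j).
  by move: (nat_of_ord (A' i j)) => a ha; clear -ha; lia.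
exists (map_mx (fun z => inord `|z + B%:Z|) A); first by rewrite mem_enum.
apply/matrixP => i j; rewrite !mxE; have := hA i j; move: (A i j) => z hz.
by rewrite inordK; lia.
Qed.

Lemma box_uniq m n B : uniq (box m n B).
Proof.
rewrite map_inj_uniq ?enum_uniq // => A A' /matrixP e; apply/matrixP => i j.
by have := e i j; rewrite !mxE => /addIr [] /ord_inj.
Qed.

Definition orth n (B : nat) (K : 'rV[int]_n) : seq 'rV[int]_n :=
  [seq y <- box 1 n B | dot y K == 0].

Lemma mem_orth n B (K y : 'rV[int]_n) : (y \in orth B K) = bounded_mx B y && (dot y K == 0).
Proof. by rewrite mem_filter mem_box andbC. Qed.

Lemma maxnorm_attained n (K : 'rV[int]_n.+1) : exists j, `|K ord0 j|%N == mx_maxnorm K.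
Proof.
have n0 : (0 < #|'I_n.+1|)%N by rewrite card_ord.
have [j hj] := bigop.eq_bigmax (fun j => `|K ord0 j|%N) n0.
exists j; rewrite eqn_leq; apply/andP; split.
  exact: (mx_maxnormP _ _ (leqnn _)).
by apply/mx_maxnormP => i l; rewrite (ord1 i) -hj; apply: (leq_bigmax (F := fun j => `|K ord0 j|%N)).
Qed.

Lemma size_orth k (T : nat) (V : 'M[int]_(k, k.+1)) (K : 'rV[int]_k.+1) (g : int) :
  bounded_mx T V -> g != 0 -> cross V = g *: K -> primitive K ->
  (size (orth T K) * mx_maxnorm K <= (2 * (k.+1 * T)).+1 ^ k)%N.
Proof.
move=> hV g0 eK pK; have [j /eqP <-] := maxnorm_attained K.
apply: orthogonal_count hV g0 eK pK _ _ _.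
- by rewrite filter_uniq // box_uniq.
- by apply/allP => y; rewrite mem_orth => /andP[].
- by move=> y; rewrite mem_orth => /andP[_ /eqP].
Qed.

(* A vector of the shell is determined by a maximal coordinate and two more. *)
Lemma size_shell n (m : nat) (oth : 'I_n.+1 -> 'I_n.+1 * 'I_n.+1) (s : seq 'rV[int]_n.+1) :
  uniq s -> (forall K, K \in s -> mx_maxnorm K = m) ->
  (forall K K' i, K \in s -> K' \in s -> `|K ord0 i|%N = m -> K ord0 i = K' ord0 i ->
     K ord0 (oth i).1 = K' ord0 (oth i).1 -> K ord0 (oth i).2 = K' ord0 (oth i).2 -> K = K') ->
  (size s <= n.+1 * 2 * (2 * m).+1 ^ 2)%N.
Proof.
move=> us hm inj.
pose I (K : 'rV[int]_n.+1) : 'I_n.+1 := xchoose (maxnorm_attained K).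
have hI (K : 'rV[int]_n.+1) : `|K ord0 (I K)|%N = mx_maxnorm K := eqP (xchooseP (maxnorm_attained K)).
pose c (z : int) : 'I_(2 * m).+1 := inord `|z + m%:Z|.
(* The coordinate at [I K] is [m] or [- m], so its sign determines it. *)
pose enc (K : 'rV[int]_n.+1) := (I K, K ord0 (I K) >= 0, c (K ord0 (oth (I K)).1), c (K ord0 (oth (I K)).2)).
have cinj z z' : (`|z| <= m)%N -> (`|z'| <= m)%N -> c z = c z' -> z = z'.
  move=> hz hz' /(congr1 val) /=; rewrite !inordK; lia.
have enc_inj : {in s &, injective enc}.
  move=> K K' Ks Ks' [eI e0 e1 e2]; have mK := hm _ Ks; have mK' := hm _ Ks'.
  have /mx_maxnormP bK := leqnn (mx_maxnorm K); have /mx_maxnormP bK' := leqnn (mx_maxnorm K').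
  rewrite mK in bK; rewrite mK' in bK'; rewrite -eI in e0 e1 e2.
  have hK := hI K; have hK' := hI K'; rewrite -eI mK' in hK'; rewrite mK in hK.
  apply: (inj _ _ (I K)) => //; last 2 first.
  - exact: cinj e1.
  - exact: cinj e2.
  by move: e0 hK hK'; move: (K ord0 (I K)) (K' ord0 (I K)) => a b; lia.
rewrite -(size_map enc) -(card_uniqP _); last by rewrite map_inj_in_uniq.
apply: leq_trans (max_card _) _.
by rewrite !card_prod !card_ord card_bool !mulnA.
Qed.

Lemma size_shell3 (m : nat) (s : seq 'rV[int]_3) :
  uniq s -> (forall K, K \in s -> mx_maxnorm K = m) -> (size s <= 6 * (2 * m).+1 ^ 2)%N.
Proof.
move=> us hm; apply: (@size_shell 2 m (fun i => (i + 1, i + 2)) s us hm) => K K' i _ _ _ e0 e1 e2.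
apply/rowP => j; have : [|| j == i, j == i + 1 | j == i + 2].
  by case: i {e0 e1 e2} => [[|[|[|//]]]] ?; case: j => [[|[|[|//]]]].
by case/or3P => /eqP ->.
Qed.

(* Cutting [K] into two halves [a] and [b] in dimension 2, this is the
   determinant of [a] and [b]; it vanishes when [b] is a multiple of [a]. *)
Definition det4 (R : comNzRingType) (K : 'rV[R]_4) : R :=
  K ord0 (inord 0) * K ord0 (inord 3) - K ord0 (inord 1) * K ord0 (inord 2).

Lemma ord4P (P : 'I_4 -> Prop) : P (inord 0) -> P (inord 1) -> P (inord 2) -> P (inord 3) ->
  forall i, P i.
Proof.
by move=> h0 h1 h2 h3 i; rewrite -(inord_val i); case: i => [[|[|[|[|//]]]]].
Qed.

(** [x] is invertible modulo [q], so [z] and [z'] are congruent, and they differ by at most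
    [2 * m]. *)
Lemma determined_mod (q m : nat) (x y z t z' : int) : prime q -> (2 * m < q)%N ->
  (0 < m)%N -> `|x|%N = m -> (`|z| <= m)%N -> (`|z'| <= m)%N ->
  (q %| x * z - y * t)%Z -> (q %| x * z' - y * t)%Z -> z = z'.
Proof.
move=> qp mq m0 xm hz hz' d d'.
have : (q %| x * (z - z'))%Z.
  by have := rpredB d d'; rewrite opprB addrA subrK mulrBr.
rewrite dvdzE abszM Euclid_dvdM //= => /orP[|] /dvdn_leq; first lia.
by have [//|ne] := eqVneq z z'; move=> /(_ _)/=; lia.
Qed.

(** The congruence for [det4] determines the partner of the maximal coordinate in its product from
    the other product, whose factors are selected by [oth]. This saves a power of [m] over all
    vectors of the shell. *)
Lemma size_shell4 (q m : nat) (s : seq 'rV[int]_4) : prime q -> (2 * m < q)%N -> (0 < m)%N ->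
  uniq s -> (forall K, K \in s -> mx_maxnorm K = m) ->
  (forall K, K \in s -> (q %| det4 K)%Z) -> (size s <= 8 * (2 * m).+1 ^ 2)%N.
Proof.
move=> qp mq m0 us hm hd.
pose oth (i : 'I_4) : 'I_4 * 'I_4 :=
  if (i == inord 0) || (i == inord 3) then (inord 1, inord 2) else (inord 0, inord 3).
have bK K i : K \in s -> (`|K ord0 i| <= m)%N.
  by move=> /hm <-; apply: (mx_maxnormP _ _ (leqnn _)).
have D (i j : nat) : (i < 4)%N -> (j < 4)%N -> ((inord i : 'I_4) == inord j) = (i == j).
  by move=> hi hj; rewrite -val_eqE /= !inordK.
apply: (@size_shell 3 m oth s us hm) => K K' i Ks Ks'; have := hd _ Ks; have := hd _ Ks'.
rewrite /det4 /oth; elim/ord4P: i; rewrite !D //= => d' d hi e0 e1 e2.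
- rewrite -e0 -e1 -e2 in d'; apply/rowP; elim/ord4P => //.
  by apply: (determined_mod qp mq m0 hi _ _ d d'); apply: bK.
- rewrite -e0 -e1 -e2 -rpredN opprB in d'; rewrite -rpredN opprB in d.
  apply/rowP; elim/ord4P => //.
  by apply: (determined_mod qp mq m0 hi _ _ d d'); apply: bK.
- rewrite -e0 -e1 -e2 -rpredN opprB ![_ * K ord0 (inord 2)]mulrC in d'.
  rewrite -rpredN opprB [_ * K ord0 (inord 2)]mulrC in d.
  apply/rowP; elim/ord4P => //.
  by apply: (determined_mod qp mq m0 hi _ _ d d'); apply: bK.
- rewrite -e0 -e1 -e2 ![_ * K ord0 (inord 3)]mulrC in d'.
  rewrite [_ * K ord0 (inord 3)]mulrC in d.
  apply/rowP; elim/ord4P => //.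
  by apply: (determined_mod qp mq m0 hi _ _ d d'); apply: bK.
Qed.

End Shells.

(** * Sums over shells *)

Section ShellSums.

Lemma sum_by_shells n (s : seq 'rV[int]_n) (F : 'rV[int]_n -> nat) (X : nat -> nat) (M : nat) :
  (forall K, K \in s -> (0 < mx_maxnorm K <= M)%N) ->
  (forall m, (0 < m <= M)%N -> (\sum_(K <- s | mx_maxnorm K == m) F K <= X m)%N) ->
  (\sum_(K <- s) F K <= \sum_(1 <= m < M.+1) X m)%N.
Proof.
move=> hs hX; rewrite big_seq (partition_big (fun K => inord (mx_maxnorm K) : 'I_M.+1) xpredT) //=.
rewrite [X in (_ <= X)%N](_ : _ = \sum_(0 <= m < M.+1) (if m == 0 then 0 else X m))%N; last first.
  rewrite [RHS]big_ltn //= add0n !big_nat; apply: eq_bigr => -[|m] //.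
rewrite big_mkord; apply: leq_sum => i _.
have e : (\sum_(K <- s | (K \in s) && (inord (mx_maxnorm K) == i)) F K =
   \sum_(K <- s | (K \in s) && (mx_maxnorm K == i)) F K)%N.
  apply: eq_bigl => K; apply: andb_id2l => /hs h.
  by rewrite -val_eqE /= inordK //; case/andP: h.
rewrite e -big_seq_cond; case: eqP => [i0|/eqP i0]; last first.
  by apply: hX; rewrite lt0n i0 -ltnS ltn_ord.
rewrite big_seq_cond big1 // => K /andP[/hs h /eqP eK].
by rewrite eK i0 in h.
Qed.

(** On the shell [N K] is at most C / m; the denominators are cleared. *)
Lemma shell_power_sum n (s : seq 'rV[int]_n) (N : 'rV[int]_n -> nat) (C c m e : nat) :
  (size [seq K <- s | mx_maxnorm K == m] <= c * m ^ 2)%N ->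
  (forall K, K \in s -> (N K * mx_maxnorm K <= C)%N) ->
  (m ^ e * (\sum_(K <- s | mx_maxnorm K == m) N K ^ e) <= c * m ^ 2 * C ^ e)%N.
Proof.
move=> hc hN; apply: (@leq_trans (size [seq K <- s | mx_maxnorm K == m] * C ^ e)); last first.
  by rewrite leq_mul2r hc orbT.
rewrite big_distrr /= size_filter -sum1_count big_distrl /=.
rewrite big_seq_cond [X in (_ <= X)%N]big_seq_cond.
apply: leq_sum => K /andP[Ks /eqP <-]; rewrite mul1n -expnMn.
by have [->|e0] := posnP e; rewrite ?expn0 // leq_exp2r // mulnC hN.
Qed.

Lemma shell_const (m : nat) : (0 < m)%N -> ((2 * m).+1 ^ 2 <= 9 * m ^ 2)%N.
Proof. by move=> m0; rewrite (_ : 9 * m ^ 2 = (3 * m) ^ 2)%N ?expnMn // -expnMn leq_sqr; lia. Qed.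

(** At most 54 m^2 vectors of norm m contribute (C / m)^2 each, a constant per shell. *)
Lemma sum_squares_shell3 (s : seq 'rV[int]_3) (N : 'rV[int]_3 -> nat) (C Y : nat) :
  uniq s -> (forall K, K \in s -> (0 < mx_maxnorm K <= Y)%N) ->
  (forall K, K \in s -> (N K * mx_maxnorm K <= C)%N) ->
  (\sum_(K <- s) N K ^ 2 <= 54 * C ^ 2 * Y)%N.
Proof.
move=> us hs hN; apply: (leq_trans (@sum_by_shells _ s _ (fun=> 54 * C ^ 2)%N Y hs _)).
  move=> m /andP[m0 mY].
  have hc : (size [seq K <- s | mx_maxnorm K == m] <= 54 * m ^ 2)%N.
    apply: (@leq_trans (6 * (2 * m).+1 ^ 2)); last first.
      by rewrite (_ : 54 = 6 * 9)%N // -mulnA leq_mul2l shell_const.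
    apply: size_shell3; first exact: filter_uniq.
    by move=> K; rewrite mem_filter => /andP[/eqP].
  have := shell_power_sum 2 hc hN.
  by rewrite [X in (_ <= X)%N](_ : _ = m ^ 2 * (54 * C ^ 2))%N ?leq_pmul2l ?expn_gt0 ?m0 //; lia.
by rewrite sum_nat_const_nat subn1 mulnC.
Qed.

(** Each dyadic block from 2^k to 2^(k+1) contributes at most [X]. *)
Lemma sum_divn_log (X M : nat) :
  (\sum_(1 <= m < M.+1) X %/ m <= X * (trunc_log 2 M).+1)%N.
Proof.
have dyadic k : (\sum_(1 <= m < 2 ^ k) X %/ m <= X * k)%N.
  elim: k => [|k IHk]; first by rewrite big_geq.
  rewrite (@big_cat_nat _ _ _ (2 ^ k)) ?expn_gt0 //=; last by rewrite leq_exp2l.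
  rewrite mulnS addnC leq_add //.
  apply: (@leq_trans (\sum_(2 ^ k <= m < 2 ^ k.+1) X %/ 2 ^ k)).
    rewrite big_nat [X in (_ <= X)%N]big_nat; apply: leq_sum => m /andP[hm _].
    by rewrite leq_div2l ?expn_gt0.
  rewrite sum_nat_const_nat expnS mul2n -addnn addnK mulnC; exact: leq_divM.
apply: leq_trans (dyadic _).
have hM : (M.+1 <= 2 ^ (trunc_log 2 M).+1)%N by rewrite trunc_log_ltn.
by rewrite (@big_cat_nat _ _ _ M.+1 1 (2 ^ _)) //= leq_addr.
Qed.

(** A shell contributes at most 72 m^2 (C / m)^3 = 72 C^3 / m, and the harmonic sum gives the
    logarithm. *)
Lemma sum_cubes_shell4 (q : nat) (s : seq 'rV[int]_4) (N : 'rV[int]_4 -> nat) (C M : nat) :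
  prime q -> (2 * M < q)%N -> uniq s ->
  (forall K, K \in s -> (0 < mx_maxnorm K <= M)%N) ->
  (forall K, K \in s -> (q %| det4 K)%Z) ->
  (forall K, K \in s -> (N K * mx_maxnorm K <= C)%N) ->
  (\sum_(K <- s) N K ^ 3 <= 72 * C ^ 3 * (trunc_log 2 M).+1)%N.
Proof.
move=> qp hq us hs hd hN; apply: leq_trans (sum_divn_log _ _).
apply: (@sum_by_shells _ s _ _ M hs) => m /andP[m0 mY].
have hc : (size [seq K <- s | mx_maxnorm K == m] <= 72 * m ^ 2)%N.
  apply: (@leq_trans (8 * (2 * m).+1 ^ 2)); last first.
    by rewrite (_ : 72 = 8 * 9)%N // -mulnA leq_mul2l shell_const.
  apply: (@size_shell4 q) => //.
  - by apply: leq_ltn_trans hq; rewrite leq_mul2l.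
  - exact: filter_uniq.
  - by move=> K; rewrite mem_filter => /andP[/eqP].
  - by move=> K; rewrite mem_filter => /andP[_ /hd].
have := shell_power_sum 3 hc hN.
set S := (\sum_(K <- s | _) _)%N => h; rewrite leq_divRL //.
rewrite -(@leq_pmul2l (m ^ 2)) ?expn_gt0 ?m0 //.
have -> : (m ^ 2 * (S * m) = m ^ 3 * S)%N by rewrite [(m ^ 3)%N]expnSr mulnAC mulnA.
by rewrite mulnCA mulnA.
Qed.

End ShellSums.

(** * Matrices with prescribed orthogonal planes *)

Section Completion.

(* Cramer's rule in a basis of determinant 1. *)
Lemma unimodular_coords (u1 u2 u3 w1 w2 w3 x1 x2 x3 z1 z2 z3 p1 p2 p3 : int) :
  u2 * w3 - u3 * w2 = p1 -> u3 * w1 - u1 * w3 = p2 -> u1 * w2 - u2 * w1 = p3 ->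
  x1 * p1 + x2 * p2 + x3 * p3 = 1 -> z1 * p1 + z2 * p2 + z3 * p3 = 0 ->
  exists a b : int, [/\ z1 = a * u1 + b * w1, z2 = a * u2 + b * w2 & z3 = a * u3 + b * w3].
Proof.
move=> e1 e2 e3 ex ez.
exists (z1 * (w2 * x3 - w3 * x2) + z2 * (w3 * x1 - w1 * x3) + z3 * (w1 * x2 - w2 * x1)).
exists (z1 * (x2 * u3 - x3 * u2) + z2 * (x3 * u1 - x1 * u3) + z3 * (x1 * u2 - x2 * u1)).
split.
- by rewrite -[LHS]mulr1 -[RHS]addr0 -(mulr0 x1) -ez -ex -e1 -e2 -e3; ring.
- by rewrite -[LHS]mulr1 -[RHS]addr0 -(mulr0 x2) -ez -ex -e1 -e2 -e3; ring.
- by rewrite -[LHS]mulr1 -[RHS]addr0 -(mulr0 x3) -ez -ex -e1 -e2 -e3; ring.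
Qed.

(** This shortens [w] by a multiple of [u]: [b] times the result is [s] minus a remainder smaller
    than |b| times [u]. *)
Lemma reduce_coord (T : nat) (a b s u w : int) : b != 0 -> s = a * u + b * w ->
  (`|s| <= T)%N -> (`|u| <= T)%N -> (`|(w + (a %/ b)%Z * u)%R| <= 2 * T)%N.
Proof.
move=> b0 es hs hu.
have e : b * (w + (a %/ b)%Z * u) = s - (a %% b)%Z * u.
  by rewrite es {2}(divz_eq a b); ring.
have h1 := ltz_mod a b0; have h2 := modz_ge0 a b0.
have : (`|b| * `|(w + (a %/ b)%Z * u)%R| <= `|b| * (2 * T))%N.
  rewrite -abszM e; apply: (@leq_trans (T + `|b| * T)).
    have : (`|((a %% b)%Z * u)%R| <= `|b| * T)%N by rewrite abszM leq_mul //; lia.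
    by move: ((a %% b)%Z * u) => c; lia.
  by rewrite mul2n -addnn mulnDr leq_add2r leq_pmull // absz_gt0.
by rewrite leq_pmul2l // absz_gt0.
Qed.

(** Up to integer multiples of [u] and [w], [x] is p / P plus fractional multiples of them; the
    three parts are bounded by 1, T and 2 T. *)
Lemma reduce_coord2 (T : nat) (P p x a b u w : int) : 0 < P -> (`|p| <= `|P|)%N ->
  P * x - p = a * u + b * w -> (`|u| <= T)%N -> (`|w| <= 2 * T)%N ->
  (`|(x - (a %/ P)%Z * u - (b %/ P)%Z * w)%R| <= 3 * T + 1)%N.
Proof.
move=> P0 hp e hu hw; have Pn0 : P != 0 by rewrite gt_eqF.
have e' : P * (x - (a %/ P)%Z * u - (b %/ P)%Z * w) = p + (a %% P)%Z * u + (b %% P)%Z * w.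
  have -> : P * (x - (a %/ P)%Z * u - (b %/ P)%Z * w) =
    (P * x - p) + p - (a %/ P)%Z * P * u - (b %/ P)%Z * P * w by ring.
  by rewrite e {1}(divz_eq a P) {1}(divz_eq b P); ring.
have ha1 := ltz_mod a Pn0; have ha2 := modz_ge0 a Pn0.
have hb1 := ltz_mod b Pn0; have hb2 := modz_ge0 b Pn0.
rewrite -(@leq_pmul2l `|P|) ?absz_gt0 // -abszM e'.
have h1 : (`|((a %% P)%Z * u)%R| <= `|P| * T)%N by rewrite abszM leq_mul //; lia.
have h2 : (`|((b %% P)%Z * w)%R| <= `|P| * (2 * T))%N by rewrite abszM leq_mul //; lia.
have -> : (`|P| * (3 * T + 1) = `|P| * T + `|P| * (2 * T) + `|P|)%N.
  by rewrite -mulnDr -mulnSr; congr (_ * _)%N; lia.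
move: h1 h2 hp; move: ((a %% P)%Z * u) ((b %% P)%Z * w) (`|P| * T)%N (`|P| * (2 * T))%N => c d t t2.
by move: (`|P|)%N => r; clear; lia.
Qed.

(** The primitive part [u] of the short vector [r] is completed by [w] to an oriented basis of the
    plane orthogonal to [p], and by [v] to a basis of the whole lattice. The second short vector [s]
    serves to shorten [w]. *)
Lemma completion_coords (T : nat) (p1 p2 p3 x1 x2 x3 r1 r2 r3 s1 s2 s3 g u1 u2 u3 a1 a2 a3 : int) :
  x1 * p1 + x2 * p2 + x3 * p3 = 1 ->
  a1 * u1 + a2 * u2 + a3 * u3 = 1 ->
  r1 = g * u1 -> r2 = g * u2 -> r3 = g * u3 ->
  u1 * p1 + u2 * p2 + u3 * p3 = 0 -> s1 * p1 + s2 * p2 + s3 * p3 = 0 ->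
  [|| r2 * s3 - r3 * s2 != 0, r3 * s1 - r1 * s3 != 0 | r1 * s2 - r2 * s1 != 0] ->
  [/\ `|u1| <= T, `|u2| <= T & `|u3| <= T]%N ->
  [/\ `|s1| <= T, `|s2| <= T & `|s3| <= T]%N ->
  exists w1 w2 w3 v1 v2 v3 : int,
   [/\ u2 * w3 - u3 * w2 = p1, u3 * w1 - u1 * w3 = p2 & u1 * w2 - u2 * w1 = p3] /\
   [/\ v1 * p1 + v2 * p2 + v3 * p3 = 1,
      [/\ `|w1| <= 2 * T, `|w2| <= 2 * T & `|w3| <= 2 * T]%N &
      [/\ `|v1| <= 3 * T + 1, `|v2| <= 3 * T + 1 & `|v3| <= 3 * T + 1]%N].
Proof.
move=> ex ea er1 er2 er3 eu es nz [hu1 hu2 hu3] [hs1 hs2 hs3].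
(* This is p x a, and u x (p x a) = (u . a) p - (u . p) a = p. *)
pose y1 := p2 * a3 - p3 * a2; pose y2 := p3 * a1 - p1 * a3; pose y3 := p1 * a2 - p2 * a1.
have c1 : u2 * y3 - u3 * y2 = p1.
  by rewrite -[RHS]mulr1 -[LHS]addr0 -(mulr0 a1) -eu -ea /y2 /y3; ring.
have c2 : u3 * y1 - u1 * y3 = p2.
  by rewrite -[RHS]mulr1 -[LHS]addr0 -(mulr0 a2) -eu -ea /y1 /y3; ring.
have c3 : u1 * y2 - u2 * y1 = p3.
  by rewrite -[RHS]mulr1 -[LHS]addr0 -(mulr0 a3) -eu -ea /y1 /y2; ring.
have [a [b [h1 h2 h3]]] := unimodular_coords c1 c2 c3 ex es.
(* Otherwise [s] would be a multiple of [u], hence parallel to [r]. *)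
have b0 : b != 0.
  apply: contraTneq nz => b0; rewrite b0 !mul0r !addr0 in h1 h2 h3.
  rewrite er1 er2 er3 h1 h2 h3 !negb_or !negbK.
  by apply/and3P; split; apply/eqP; ring.
pose n := (a %/ b)%Z.
have w1b := reduce_coord b0 h1 hs1 hu1; have w2b := reduce_coord b0 h2 hs2 hu2.
have w3b := reduce_coord b0 h3 hs3 hu3; rewrite -/n in w1b w2b w3b.
set w1 := y1 + n * u1 in w1b; set w2 := y2 + n * u2 in w2b; set w3 := y3 + n * u3 in w3b.
have d1 : u2 * w3 - u3 * w2 = p1 by rewrite -c1 /w2 /w3; ring.
have d2 : u3 * w1 - u1 * w3 = p2 by rewrite -c2 /w1 /w3; ring.
have d3 : u1 * w2 - u2 * w1 = p3 by rewrite -c3 /w1 /w2; ring.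
(* With P = |p|^2 the vector P x - p is orthogonal to p, hence an integer combination of u and w. *)
pose P := p1 ^+ 2 + p2 ^+ 2 + p3 ^+ 2.
have ez : (P * x1 - p1) * p1 + (P * x2 - p2) * p2 + (P * x3 - p3) * p3 = 0.
  have -> : (P * x1 - p1) * p1 + (P * x2 - p2) * p2 + (P * x3 - p3) * p3 =
    P * (x1 * p1 + x2 * p2 + x3 * p3) - P by rewrite /P; ring.
  by rewrite ex; ring.
have [a' [b' [k1 k2 k3]]] := unimodular_coords d1 d2 d3 ex ez.
have sq (z : int) : z ^+ 2 = (`|z| ^ 2)%N%:Z by rewrite -abszX gez0_abs // sqr_ge0.
have sqle (z : int) : (`|z| <= `|z| ^ 2)%N by case: `|z|%N => // m; rewrite expnS expn1 leq_pmulr.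
have PE : P = (`|p1| ^ 2 + `|p2| ^ 2 + `|p3| ^ 2)%N%:Z by rewrite /P !sq.
have P0 : 0 < P.
  rewrite PE ltz_nat lt0n !addn_eq0 !expn_eq0 /= !andbT !absz_eq0 !negb_and -orbA.
  by apply: contra_eqT ex; rewrite !negb_or !negbK => /and3P[/eqP-> /eqP-> /eqP->]; rewrite !mulr0.
have hP (z : int) : (`|z| ^ 2 <= `|p1| ^ 2 + `|p2| ^ 2 + `|p3| ^ 2)%N -> (`|z| <= `|P|)%N.
  by move=> h; apply: leq_trans (sqle z) _; rewrite PE.
exists w1, w2, w3, (x1 - (a' %/ P)%Z * u1 - (b' %/ P)%Z * w1),
  (x2 - (a' %/ P)%Z * u2 - (b' %/ P)%Z * w2), (x3 - (a' %/ P)%Z * u3 - (b' %/ P)%Z * w3).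
split=> //; split=> //.
  have ew : w1 * p1 + w2 * p2 + w3 * p3 = 0 by rewrite -d1 -d2 -d3; ring.
  transitivity (x1 * p1 + x2 * p2 + x3 * p3 - (a' %/ P)%Z * (u1 * p1 + u2 * p2 + u3 * p3)
    - (b' %/ P)%Z * (w1 * p1 + w2 * p2 + w3 * p3)); first by ring.
  by rewrite ex eu ew !mulr0 !subr0.
by split; [apply: (reduce_coord2 P0 _ k1) | apply: (reduce_coord2 P0 _ k2) | apply: (reduce_coord2 P0 _ k3)] => //; apply: hP; rewrite ?leq_addl // -?addnA ?leq_addr // addnCA leq_addr.
Qed.

End Completion.

(** * Completing a plane to a matrix of determinant 1 *)

Section MatrixCompletion.

Let i0 : 'I_3 := @Ordinal 3 0 isT.
Let i1 : 'I_3 := @Ordinal 3 1 isT.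
Let i2 : 'I_3 := @Ordinal 3 2 isT.
Let j0 : 'I_2 := @Ordinal 2 0 isT.
Let j1 : 'I_2 := @Ordinal 2 1 isT.

Lemma ord3P (P : 'I_3 -> Prop) : P i0 -> P i1 -> P i2 -> forall i, P i.
Proof.
move=> h0 h1 h2 [[|[|[|//]]] p].
- by rewrite (_ : Ordinal p = i0) //; apply: val_inj.
- by rewrite (_ : Ordinal p = i1) //; apply: val_inj.
- by rewrite (_ : Ordinal p = i2) //; apply: val_inj.
Qed.

Lemma dot3E (R : comNzRingType) (u v : 'rV[R]_3) :
  dot u v = u ord0 i0 * v ord0 i0 + u ord0 i1 * v ord0 i1 + u ord0 i2 * v ord0 i2.
Proof.
rewrite /dot !big_ord_recl big_ord0 addr0 addrA.
by congr (_ * _ + _ * _ + _ * _); congr (_ _ _); apply: val_inj.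
Qed.

Lemma det22 (R : comNzRingType) (A : 'M[R]_2) :
  \det A = A j0 j0 * A j1 j1 - A j0 j1 * A j1 j0.
Proof.
rewrite (expand_det_row _ ord0) !big_ord_recl big_ord0 addr0 /cofactor !det_mx11 !mxE /=.
rewrite expr0 expr1 mul1r mulN1r mulrN.
by congr (_ * _ - _ * _); congr (A _ _); apply: val_inj.
Qed.

Lemma cross3E (R : comNzRingType) (V : 'M[R]_(2, 3)) :
  [/\ cross V ord0 i0 = V j0 i1 * V j1 i2 - V j0 i2 * V j1 i1,
      cross V ord0 i1 = V j0 i2 * V j1 i0 - V j0 i0 * V j1 i2 &
      cross V ord0 i2 = V j0 i0 * V j1 i1 - V j0 i1 * V j1 i0].
Proof.
have L (a b : 'I_3) c : lift a c = b -> forall i, (col' a V) i c = V i b by move=> <- i; rewrite mxE.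
rewrite !mxE !det22 /=; split.
- rewrite (L _ i1 j0) ?(L _ i2 j1) ?(L _ i1 j0); try exact: val_inj.
  by rewrite expr0 mul1r.
- rewrite (L _ i0 j0) ?(L _ i2 j1) ?(L _ i0 j0); try exact: val_inj.
  by rewrite expr1 mulN1r opprB.
- rewrite (L _ i0 j0) ?(L _ i1 j1) ?(L _ i0 j0); try exact: val_inj.
  by rewrite sqrrN expr1n mul1r.
Qed.

Definition mx3 (R : Type) (x0 : R) (a b c d e f g h i : R) : 'M[R]_3 :=
  \matrix_(k, l) nth x0 (nth [::] [:: [:: a; b; c]; [:: d; e; f]; [:: g; h; i]] k) l.

Lemma det_cross (R : comNzRingType) (A : 'M[R]_3) :
  \det A = dot (row ord_max A) (cross (row' ord_max A)).
Proof.
rewrite (expand_det_row _ ord_max); apply: eq_bigr => j _; rewrite !mxE /cofactor.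
congr (_ * (_ * _)); first by rewrite exprD /= sqrrN expr1n mul1r.
by congr (\det _); apply/matrixP => a b; rewrite !mxE.
Qed.

(* The rows of [V] are two independent short vectors in the plane orthogonal
   to [p]. *)
Definition spanned (T : nat) (p : 'rV[int]_3) :=
  primitive p /\ exists (V : 'M[int]_(2, 3)) (g : int), [/\ bounded_mx T V, g != 0 & cross V = g *: p].

(** The rows are u, w, v from [completion_coords], with determinant v . (u x w) = v . p = 1; the
    bound 3 T + 1 is at most 4 T because T > 0. *)
Lemma completion (T : nat) (p : 'rV[int]_3) : spanned T p ->
  exists g : SL3 int, bounded_mx (4 * T) g /\ cross (row' ord_max g) = p.
Proof.
move=> [[x xp] [V [g [/bounded_mxP hV g0 eV]]]].
have orthV i : dot (row i V) p = 0 by apply: (mulfI g0); rewrite -dotZr -eV cross_orth mulr0.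
have p0 : p != 0.
  apply: contra_eq_neq xp => ->; rewrite /dot big1 ?oner_neq0 // => i _.
  by rewrite mxE mulr0.
have cV0 : cross V != 0.
  rewrite eV; apply: contra_neq p0 => /rowP e; apply/rowP => j.
  by apply: (mulfI g0); have := e j; rewrite !mxE mulr0.
have r0 : row j0 V != 0.
  apply: contra_neq cV0 => r0; have [e0 e1 e2] := cross3E V.
  have z j : V j0 j = 0 by have /rowP/(_ j) := r0; rewrite !mxE.
  by apply/rowP; elim/ord3P; rewrite ?e0 ?e1 ?e2 !z !mul0r subr0 mxE.
have [g' [u [g'0 [a au] eu]]] := primitive_part r0.
have ue j : V j0 j = g' * u ord0 j by have /rowP/(_ j) := eu; rewrite !mxE.
have ub j : (`|u ord0 j| <= T)%N.
  have := hV j0 j; rewrite ue abszM; apply: leq_trans.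
  by rewrite leq_pmull // absz_gt0.
have up : dot u p = 0.
  by apply: (mulfI g'0); rewrite -dotZl -eu orthV mulr0.
have sp := orthV j1; rewrite dot3E !mxE in sp; rewrite !dot3E in xp au up.
have T0 : (0 < T)%N.
  rewrite lt0n; apply: contra_neq r0 => T0; apply/rowP => j; rewrite !mxE.
  by have := hV j0 j; rewrite T0 leqn0 absz_eq0 => /eqP.
have [c0 c1 c2] := cross3E V.
have nz : [|| V j0 i1 * V j1 i2 - V j0 i2 * V j1 i1 != 0, V j0 i2 * V j1 i0 - V j0 i0 * V j1 i2 != 0 |
   V j0 i0 * V j1 i1 - V j0 i1 * V j1 i0 != 0].
  rewrite -c0 -c1 -c2; apply: contraR cV0; rewrite !negb_or !negbK => /and3P[/eqP h0 /eqP h1 /eqP h2].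
  by apply/eqP/rowP; elim/ord3P; rewrite ?h0 ?h1 ?h2 mxE.
have [w1 [w2 [w3 [v1 [v2 [v3 [[d1 d2 d3] [ev [hw1 hw2 hw3] [hv1 hv2 hv3]]]]]]]]] :=
  completion_coords xp au (ue i0) (ue i1) (ue i2) up sp nz
   (And3 (ub i0) (ub i1) (ub i2)) (And3 (hV j1 i0) (hV j1 i1) (hV j1 i2)).
pose G := mx3 0 (u ord0 i0) (u ord0 i1) (u ord0 i2) w1 w2 w3 v1 v2 v3.
have ecross : cross (row' ord_max G) = p.
  have [e0 e1 e2] := cross3E (row' ord_max G).
  by apply/rowP; elim/ord3P; rewrite ?e0 ?e1 ?e2 !mxE.
have dG : \det G = 1 by rewrite det_cross ecross dot3E !mxE.
exists (MkSL3 dG); split => //; apply/bounded_mxP => i j /=.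
move: i j; elim/ord3P; elim/ord3P; rewrite !mxE /=;
  by [apply: leq_trans (ub _) _; lia | lia].
Qed.

End MatrixCompletion.

(** * Counting planes spanned by short vectors *)

Section ManyPlanes.

Let i0 : 'I_3 := @Ordinal 3 0 isT.
Let i1 : 'I_3 := @Ordinal 3 1 isT.
Let i2 : 'I_3 := @Ordinal 3 2 isT.
Let j0 : 'I_2 := @Ordinal 2 0 isT.
Let j1 : 'I_2 := @Ordinal 2 1 isT.

(** The box only makes the list finite: [cross V] has entries at most 2 T^2 and is a nonzero
    multiple of [p]. *)
Definition planes (T : nat) : seq 'rV[int]_3 :=
  [seq p <- box 1 3 (2 * T ^ 2) | `[< spanned T p >]].

Lemma mem_planes T p : (p \in planes T) = `[< spanned T p >].
Proof.
rewrite mem_filter mem_box andbC; apply: andb_idl => /asboolP[_ [V [g [hV g0 eV]]]].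
apply/bounded_mxP => i j; have /bounded_mxP/(_ i j) := bounded_cross hV.
rewrite eV mxE abszM; apply: leq_trans; rewrite leq_pmull ?absz_gt0 //.
Qed.

Lemma planes_uniq T : uniq (planes T).
Proof. by rewrite filter_uniq // box_uniq. Qed.

Lemma spanned_neq0 T p : spanned T p -> (0 < mx_maxnorm p)%N.
Proof.
move=> [[x xp] _]; rewrite lt0n; apply: contra_eq_neq xp => p0.
rewrite /dot big1 // => i _; have /mx_maxnormP/(_ ord0 i) := eq_leq p0.
by rewrite leqn0 absz_eq0 => /eqP ->; rewrite mulr0.
Qed.

Lemma planes_count T p : p \in planes T ->
  (size (orth T p) * mx_maxnorm p <= (6 * T).+1 ^ 2)%N.
Proof.
rewrite mem_planes => /asboolP[pp [V [g [hV g0 eV]]]].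
by have := size_orth hV g0 eV pp; rewrite mulnA.
Qed.

(** Both vectors of a pair are orthogonal to the primitive part of their cross product, which
    belongs to [planes T]. *)
Lemma independent_pairs (T : nat) (s : seq 'M[int]_(2, 3)) :
  uniq s -> (forall V, V \in s -> bounded_mx T V /\ cross V != 0) ->
  (size s <= \sum_(p <- planes T) size (orth T p) ^ 2)%N.
Proof.
move=> us hs.
pose t := flatten [seq [seq (col_mx r r' : 'M[int]_(1 + 1, 3)) | r <- orth T p, r' <- orth T p] | p <- planes T].
have -> : (\sum_(p <- planes T) size (orth T p) ^ 2 = size t)%N.
  rewrite size_flatten /shape -map_comp sumnE big_map; apply: eq_bigr => p _.
  by rewrite /= size_allpairs -mulnn.
apply: uniq_leq_size us _ => V /hs[hV c0].
have [g [p [g0 pp eV]]] := primitive_part c0.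
have orthV i : row i V \in orth T p.
  rewrite mem_orth; apply/andP; split.
    by apply/bounded_mxP => a b; rewrite mxE; have /bounded_mxP := hV.
  by apply/eqP; apply: (mulfI g0); rewrite -dotZr -eV cross_orth mulr0.
apply/flatten_mapP; exists p.
  by rewrite mem_planes; apply/asboolP; split => //; exists V, g.
apply/allpairsP; exists (row j0 V, row j1 V); split => //=.
apply/matrixP => i j; rewrite mxE; case: splitP => k e; rewrite mxE;
  by congr (V _ _); apply: val_inj; rewrite /= e (ord1 k).
Qed.

(** Entries below [U] are increased by [U + 1] at positions (0, 0) and (1, 1), which makes the
    corresponding minor positive. *)
Lemma many_independent_pairs (U : nat) : exists s : seq 'M[int]_(2, 3),
  [/\ uniq s, (forall V, V \in s -> bounded_mx (2 * U) V /\ cross V != 0) & size s = (U ^ 6)%N].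
Proof.
pose f (A : 'M['I_U]_(2, 3)) : 'M[int]_(2, 3) :=
  \matrix_(i, j) ((A i j : nat) + (val i == val j) * U.+1)%N%:Z.
exists [seq f A | A <- enum 'M['I_U]_(2, 3)]; split.
- rewrite map_inj_uniq ?enum_uniq // => A A' /matrixP e; apply/matrixP => i j.
  by have := e i j; rewrite !mxE => -[] /addIn/ord_inj.
- move=> V /mapP[A _ ->]; split.
    apply/bounded_mxP => i j; rewrite mxE absz_nat; have := ltn_ord (A i j).
    by move: (nat_of_ord (A i j)) => a ha; case: (_ == _); rewrite ?mul1n ?mul0n; lia.
  apply/eqP => /rowP/(_ i2); have [_ _ ->] := cross3E (f A); rewrite !mxE /=.
  have a1 := ltn_ord (A j0 i1); have a2 := ltn_ord (A j1 i0).
  rewrite !mul1n !mul0n !addn0 -!PoszM => /eqP; rewrite subr_eq0 eqz_nat => /eqP e.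
  have : (A j0 i1 * A j1 i0 <= U * U)%N by rewrite leq_mul // ltnW.
  rewrite -e; apply/negP; rewrite -ltnNge.
  by apply: (@leq_trans (U.+1 * U.+1)); [rewrite ltn_mul | rewrite leq_mul // leq_addl].
- by rewrite size_map -cardE card_mx card_ord.
Qed.

(** [S] counts the pairs in planes of norm above [Y], where each plane has at most C / Y short
    vectors; the other planes are handled by [sum_squares_shell3]. The factor 196 = 14^2 comes from
    12 U + 1 <= 14 U. *)
Lemma planes_inequality (U Y : nat) : (0 < U)%N ->
  exists S : nat, (U ^ 6 <= 54 * (196 * U ^ 2) ^ 2 * Y + S)%N /\
   (Y ^ 2 * S <= (196 * U ^ 2) ^ 2 * size (planes (2 * U)))%N.
Proof.
move=> U0; pose N (p : 'rV[int]_3) := size (orth (2 * U) p); pose C := (196 * U ^ 2)%N.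
have hC p : p \in planes (2 * U) -> (N p * mx_maxnorm p <= C)%N.
  move=> /planes_count h; apply: leq_trans h _.
  rewrite /C (_ : 196 * U ^ 2 = (14 * U) ^ 2)%N ?expnMn // -expnMn leq_sqr; lia.
have [s [us hs es]] := many_independent_pairs U.
have := independent_pairs us hs; rewrite es -/N.
rewrite (bigID (fun p => mx_maxnorm p <= Y)%N) /= => h.
exists (\sum_(p <- planes (2 * U) | ~~ (mx_maxnorm p <= Y)) N p ^ 2)%N; split.
  apply: leq_trans h _; rewrite leq_add2r -big_filter.
  apply: (@sum_squares_shell3 _ N C Y); first by rewrite filter_uniq // planes_uniq.
    move=> K; rewrite mem_filter mem_planes => /andP[-> /asboolP hK].
    by rewrite andbT (spanned_neq0 hK).
  by move=> K; rewrite mem_filter => /andP[_ /hC].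
have -> : (C ^ 2 * size (planes (2 * U)) = \sum_(p <- planes (2 * U)) C ^ 2)%N.
  by rewrite big_const_seq count_predT iter_addn_0.
rewrite big_distrr big_mkcond big_seq [X in (_ <= X)%N]big_seq /=.
apply: leq_sum => p pP; case: ifP => // hY; rewrite -expnMn leq_sqr mulnC.
by apply: leq_trans (hC p pP); rewrite leq_mul2l ltnW ?orbT // ltnNge.
Qed.

(** [Y] is about U^2 divided by 108 * 196^2, so that planes of norm at most [Y] account for at most
    half of the U^6 pairs. The hypothesis makes [Y] positive. *)
Lemma many_planes (R : archiRealFieldType) (U : nat) :
  108 * 196 ^+ 2 <= U%:R ^+ 2 :> R ->
  U%:R ^+ 6 <= 8 * (108 * 196 ^+ 3) ^+ 2 * (size (planes (2 * U)))%:R :> R.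
Proof.
set c : R := 196; have c0 : 0 < c by rewrite ltr0n.
set K : R := 108 * c ^+ 2; have K0 : 0 < K by rewrite mulr_gt0 ?exprn_gt0 // ltr0n.
set u : R := U%:R; set P : R := (size _)%:R => hU.
have u0 : 0 < u.
  rewrite lt0r ler0n andbT; apply: contraTneq hU => ->.
  by rewrite expr0n /= -ltNge.
pose x : R := u ^+ 2 / K.
pose Y := Num.truncn x.
have x1 : 1 <= x by rewrite ler_pdivlMr // mul1r.
have Y1 : Y%:R <= x by rewrite truncn_le; lra.
have Y2 : x < Y%:R + 1 by have := truncnS_gt x; rewrite -natr1.
have Un0 : (0 < U)%N by rewrite -(ltr_nat R).
have [S [h1 h2]] := @planes_inequality U Y Un0.
have {}h1 : u ^+ 6 <= 54 * (c * u ^+ 2) ^+ 2 * Y%:R + S%:R.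
  by rewrite /u /c -!natrX -!natrM -!natrX -!natrM -natrD ler_nat.
have {}h2 : Y%:R ^+ 2 * S%:R <= (c * u ^+ 2) ^+ 2 * P.
  by rewrite /u /c -!natrX -!natrM -!natrX -!natrM ler_nat.
have Y3 : x <= 2 * Y%:R.
  have : (0 < Y)%N by rewrite /Y truncn_gt0.
  by rewrite -(ler_nat R) => ?; lra.
have ux : u ^+ 2 = K * x by rewrite /x mulrC divfK // gt_eqF.
rewrite (_ : u ^+ 6 = (u ^+ 2) ^+ 3) in h1 *; last by rewrite -exprM.
rewrite ux in h1 h2 *; have P0 : 0 <= P by apply: ler0n.
set y : R := Y%:R in Y1 Y2 Y3 h1 h2; set z : R := S%:R in h1 h2.
have hz : (K * x) ^+ 3 / 2 <= z.
  have : K ^+ 3 / 2 * (x ^+ 2 * y) <= K ^+ 3 / 2 * (x ^+ 2 * x).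
    by rewrite ler_pM2l ?divr_gt0 ?exprn_gt0 // ler_wpM2l // sqr_ge0.
  have -> : K ^+ 3 / 2 * (x ^+ 2 * y) = 54 * (c * (K * x)) ^+ 2 * y by rewrite /K; field.
  have -> : K ^+ 3 / 2 * (x ^+ 2 * x) = (K * x) ^+ 3 / 2 by field.
  by move=> ?; lra.
have hy : x ^+ 2 / 4 <= y ^+ 2.
  have -> : x ^+ 2 / 4 = (x / 2) ^+ 2 by field.
  by rewrite ler_sqr ?nnegrE ?divr_ge0 //; lra.
have : x ^+ 2 / 4 * ((K * x) ^+ 3 / 2) <= (c * (K * x)) ^+ 2 * P.
  apply: le_trans h2; apply: ler_pM => //; first by rewrite divr_ge0 ?sqr_ge0.
  by rewrite divr_ge0 // exprn_ge0 // mulr_ge0 // ?ltW //; lra.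
have -> : x ^+ 2 / 4 * ((K * x) ^+ 3 / 2) = x ^+ 2 * ((K * x) ^+ 3 / 8) by field.
have -> : (c * (K * x)) ^+ 2 * P = x ^+ 2 * ((c * K) ^+ 2 * P) by ring.
rewrite ler_pM2l; last by rewrite exprn_gt0 //; lra.
have -> : 108 * c ^+ 3 = c * K by rewrite /K; ring.
by rewrite -mulrA => ?; lra.
Qed.

End ManyPlanes.

(** * Linear relations between the rows of two matrices *)

Section PairKernel.

Lemma dot_row (R : comNzRingType) m n (A : 'M[R]_(m, n)) i (v : 'rV[R]_n) :
  dot (row i A) v = (A *m v^T) i ord0.
Proof. by rewrite mxE; apply: eq_bigr => j _; rewrite !mxE. Qed.

(** Subtracting a multiple of [cross W] kills one coordinate where [cross W] is nonzero; the minor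
    without that column is invertible and kills the rest. *)
Lemma kernel_cross (F : fieldType) k (W : 'M[F]_(k, k.+1)) (v : 'rV[F]_k.+1) :
  cross W != 0 -> (forall i, dot (row i W) v = 0) -> exists c, v = c *: cross W.
Proof.
move=> c0 vW; have /rV0Pn[j cj] := c0.
exists (v ord0 j / cross W ord0 j); apply/eqP; rewrite -subr_eq0; apply/eqP.
set c := _ / _; set w := v - c *: cross W.
have wW i : dot (row i W) w = 0.
  by rewrite dotC dotDl -scaleNr dotZl dotC vW dotC cross_orth mulr0 addr0.
have wj : w ord0 j = 0 by rewrite 3!mxE divfK // subrr.
have h : col' j W *m (col' j w)^T = 0.
  apply/matrixP => i l; rewrite [RHS]mxE.
  have := wW i; rewrite (dot_split j) wj mulr0 add0r => <-.
  by rewrite mxE; apply: eq_bigr => m _; rewrite !mxE (ord1 l).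
have u : col' j W \in unitmx.
  rewrite unitmxE unitfE; apply: contraNneq cj => d0.
  by rewrite mxE d0 mulr0.
have w0 : (col' j w)^T = 0 by rewrite -[LHS](mulKmx u) h mulmx0.
apply/rowP => l; rewrite [RHS]mxE; case: (unliftP j l) => [l' ->|-> //].
by have /matrixP/(_ l' ord0) := w0; rewrite !mxE.
Qed.

Definition top2 (R : comNzRingType) (g : 'M[R]_3) : 'M[R]_(2, 3) := row' ord_max g.

(* [cross (stack g g')] is the linear relation between the first two rows of
   [g] and the first two rows of [g']. *)
Definition stack (R : comNzRingType) (g g' : 'M[R]_3) : 'M[R]_(3, 2 + 2) :=
  (col_mx (top2 g) (top2 g'))^T.

Lemma SL3_primitive (g : SL3 int) : primitive (cross (top2 g)).
Proof. by exists (row ord_max g); rewrite -det_cross SL3_det. Qed.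

(** [g] sends [v] to a multiple of the last unit vector, so [v] is a multiple of the last column of
    the adjugate, which is the cross product. *)
Lemma orth_top2 (g : SL3 int) (v : 'rV[int]_3) :
  (forall i, dot (row i (top2 g)) v = 0) -> exists c, v = c *: cross (top2 g).
Proof.
move=> h; exists (dot (row ord_max g) v).
have e : g *m v^T = dot (row ord_max g) v *: delta_mx ord_max ord0.
  apply/matrixP => i j; rewrite (ord1 j) -dot_row [RHS]mxE [delta_mx _ _ _ _]mxE andbT.
  case: (unliftP ord_max i) => [i' ->|->]; last by rewrite eqxx mulr1.
  rewrite eq_sym (negbTE (neq_lift _ _)) mulr0 -(h i'); congr (dot _ _).
  by apply/rowP => l; rewrite !mxE.
have : v^T = \adj g *m (g *m v^T) by rewrite mulmxA mul_adj_mx SL3_det mul1mx.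
rewrite e -scalemxAr => /matrixP ev; apply/rowP => j.
have := ev j ord0; rewrite !mxE => ->; congr (_ * _).
rewrite (bigD1 ord_max) //= big1 ?addr0 => [|l /negbTE lm]; last first.
  by rewrite [delta_mx _ _ _ _]mxE lm mulr0.
rewrite !mxE !eqxx mulr1 /cofactor.
congr (_ * _); first by rewrite exprD /= sqrrN expr1n mul1r.
by congr (\det _); apply/matrixP => a b; rewrite !mxE.
Qed.

(** Omitting the other row of [g'], of index [rev_ord i], leaves the two rows of [g] and row [i] of
    [g']. *)
Lemma stack_minor (R : comNzRingType) (g g' : 'M[R]_3) (i : 'I_2) :
  \det (col' (rshift 2 (rev_ord i)) (stack g g')) = dot (row i (top2 g')) (cross (top2 g)).
Proof.
rewrite /stack -tr_row' det_tr det_cross; congr (dot _ (cross _)).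
  apply/rowP => j; rewrite !mxE.
  have -> : lift (rshift 2 (rev_ord i)) ord_max = rshift 2 i.
    by apply: val_inj; case: i => [[|[|//]]].
  case: splitP => k /= e; first by have := ltn_ord k; rewrite -e ltnNge leq_addr.
  have -> : k = i by apply: ord_inj; apply: (@addnI 2); rewrite e.
  by rewrite mxE.
apply/matrixP => a b; rewrite !mxE.
have -> : lift (rshift 2 (rev_ord i)) (lift ord_max a) = lshift 2 a.
  apply: val_inj => /=; have a2 : (a < 2)%N := ltn_ord a.
  by rewrite /bump [(2 <= a)%N]leqNgt a2 add0n [(_ <= a)%N]leqNgt ltn_addr.
case: splitP => k /= e; first by (have -> : k = a by apply: ord_inj); rewrite mxE.
by have a2 : (a < 2)%N := ltn_ord a; move: a2; rewrite e ltnNge leq_addr.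
Qed.

(** If all minors vanished, the rows of [top2 g'] would be orthogonal to [cross (top2 g)]; the two
    cross products would be proportional and, being primitive, equal up to sign. *)
Lemma stack_cross_neq0 (g g' : SL3 int) :
  cross (top2 g') != cross (top2 g) -> cross (top2 g') != - cross (top2 g) ->
  cross (stack g g') != 0.
Proof.
move=> n1 n2; apply/negP => /eqP c0.
have [c ec] : exists c, cross (top2 g) = c *: cross (top2 g').
  apply: orth_top2 => i; rewrite -stack_minor.
  have : cross (stack g g') ord0 (rshift 2 (rev_ord i)) = 0 by rewrite c0 mxE.
  by rewrite mxE => /eqP; rewrite mulf_eq0 signr_eq0 /= => /eqP.
have [x] := SL3_primitive g; rewrite ec dotZr => /(congr1 absz) /= /eqP; rewrite abszM muln_eq1.
case/andP=> /eqP cu _.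
have [c1|c1] : c = 1 \/ c = -1.
  by move: cu; clear; case: c => [[|[|n]]|[|n]] // _; [left | right].
  by rewrite ec c1 scale1r eqxx in n1.
by rewrite ec c1 scaleN1r opprK eqxx in n2.
Qed.

End PairKernel.

(** * Pairs of matrices with common images *)

Section CommonImages.

Lemma card_rowspace (F : finFieldType) m n (A : 'M[F]_(m, n)) :
  (#|[set v : 'rV[F]_n | (v <= A)%MS]| <= #|F| ^ \rank A)%N.
Proof.
apply: (@leq_trans #|[set w *m row_base A | w in [set: 'rV[F]_(\rank A)]]|).
  apply: subset_leq_card; apply/fintype.subsetP => v; rewrite inE => vA.
  have /submxP[w ->] : (v <= row_base A)%MS by rewrite eq_row_base.
  by apply: imset_f; rewrite inE.
by apply: leq_trans (leq_imset_card _ _) _; rewrite cardsT card_mx mul1n.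
Qed.

Lemma card_kernel (F : finFieldType) m n (A : 'M[F]_(m, n)) :
  (#|[set x : 'cV[F]_n | A *m x == 0%R]| <= #|F| ^ (n - \rank A))%N.
Proof.
rewrite -mxrank_tr -mxrank_ker; apply: leq_trans (card_rowspace _).
rewrite -(card_imset _ (@trmx_inj F n 1)); apply: subset_leq_card.
apply/fintype.subsetP => v /imsetP[x]; rewrite !inE => /eqP Ax ->.
by apply/sub_kermxP; rewrite -trmx_mul Ax trmx0.
Qed.

Definition common_images (F : finFieldType) (g g' : 'M[F]_3) : {set 'cV[F]_3} :=
  [set x | (x != 0) && [exists c : F, g *m x == c *: (g' *m x)]].

(** The scalar relating the two images is an eigenvalue of g'^-1 g; there are at most three, each
    with a kernel of dimension at most 3 - r. *)
Lemma card_common_images (F : finFieldType) (g g' : 'M[F]_3) (r : nat) :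
  g' \in unitmx -> (forall c, (r <= \rank (g - c *: g')%R)%N) ->
  (#|common_images g g'| <= 3 * #|F| ^ (3 - r))%N.
Proof.
move=> ug' hr; pose A := invmx g' *m g.
pose S := [set c : F | root (char_poly A) c].
have S3 : (#|S| <= 3)%N.
  rewrite cardE -ltnS -(size_char_poly A); apply: max_poly_roots.
  - by rewrite monic_neq0 // char_poly_monic.
  - by apply/allP => c; rewrite mem_enum inE.
  - exact: enum_uniq.
have sub : common_images g g' \subset \bigcup_(c in S) [set x : 'cV[F]_3 | ((g - c *: g') *m x == 0)%R].
  apply/fintype.subsetP => x; rewrite inE => /andP[x0 /existsP[c /eqP e]].
  have gx : (g - c *: g') *m x = 0 by rewrite mulmxBl -scalemxAl e subrr.
  apply/bigcupP; exists c; last by rewrite inE gx.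
  rewrite inE -eigenvalue_root_char; apply: contraNT x0 => ne.
  have : row_free (A - c%:M) by rewrite -kermx_eq0; rewrite /eigenvalue negbK in ne.
  rewrite row_free_unit => u.
  have Ax : (A - c%:M) *m x = 0.
    rewrite mulmxBl -mulmxA e mul_scalar_mx -scalemxAr mulKmx // subrr.
    by [].
  by rewrite -[x](mulKmx u) Ax mulmx0.
apply: leq_trans (subset_leq_card sub) _.
apply: (@leq_trans (\sum_(c in S) #|[set x : 'cV[F]_3 | ((g - c *: g') *m x == 0)%R]|)).
  apply: (big_ind2 (fun (A : {set 'cV[F]_3}) n => (#|A| <= n)%N)) => // [|B m C n hB hC].
    by rewrite cards0.
  by apply: leq_trans (leq_card_setU _ _) _; rewrite leq_add.
apply: (@leq_trans (\sum_(c in S) #|F| ^ (3 - r))); last first.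
  by rewrite sum_nat_const leq_mul2r S3 orbT.
apply: leq_sum => c _; apply: leq_trans (card_kernel _) _.
by rewrite leq_pexp2l ?leq_sub2l // (cardD1 0) inE.
Qed.

Lemma top2_rank (F : fieldType) (A : 'M[F]_3) : (\rank (top2 A) <= \rank A)%N.
Proof.
apply: mxrankS; apply/row_subP => i.
have -> : row i (top2 A) = row (lift ord_max i) A by apply/rowP => j; rewrite !mxE.
exact: row_sub.
Qed.

(** A relation a between the first two rows of g - c g' is a relation (a, -c a) between the four
    stacked rows, and those form a line by [kernel_cross]. *)
Lemma stack_kernel (F : fieldType) (g g' : 'M[F]_3) (c : F) (a : 'rV[F]_2) :
  cross (stack g g') != 0 -> a *m top2 (g - c *: g') = 0 ->
  exists d, row_mx a (- c *: a) = d *: cross (stack g g').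
Proof.
move=> k0 ha; have h : row_mx a (- c *: a) *m col_mx (top2 g) (top2 g') = 0.
  have e : top2 (g - c *: g') = top2 g - c *: top2 g' by apply/matrixP => x y; rewrite !mxE.
  by rewrite mul_row_col -scalemxAl scaleNr scalemxAr -mulmxBr -e.
apply: kernel_cross k0 _ => i; rewrite dot_row.
transitivity ((row_mx a (- c *: a) *m col_mx (top2 g) (top2 g'))^T i ord0); last by rewrite h !mxE.
by rewrite trmx_mul.
Qed.

Lemma det4Z (R : comNzRingType) (d : R) (K : 'rV[R]_4) : det4 (d *: K) = d ^+ 2 * det4 K.
Proof. by rewrite /det4 !mxE; ring. Qed.

Lemma det4_pencil (R : comNzRingType) (c : R) (a : 'rV[R]_2) :
  det4 (row_mx a (- c *: a) : 'rV_(2 + 2)) = 0.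
Proof.
have L k (i : 'I_2) : (k < 4)%N -> k = i -> (row_mx a (- c *: a) : 'rV_(2 + 2)) ord0 (inord k) = a ord0 i.
  move=> k4 ki; rewrite (_ : inord k = lshift 2 i) ?row_mxEl //.
  by apply: val_inj; rewrite /= inordK.
have Rr k (i : 'I_2) : (k < 4)%N -> k = (2 + i)%N ->
    (row_mx a (- c *: a) : 'rV_(2 + 2)) ord0 (inord k) = - c * a ord0 i.
  move=> k4 ki; rewrite (_ : inord k = rshift 2 i) ?row_mxEr ?mxE //.
  by apply: val_inj; rewrite /= inordK.
rewrite /det4 (L _ ord0) // (L 1%N (lift ord0 ord0)) // (Rr 2%N ord0) // (Rr 3%N (lift ord0 ord0)) //.
by ring.
Qed.

(** At rank at most 1 the first two rows of g - c g' are dependent, so the kernel vector is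
    proportional to some (a, -c a), where [det4] vanishes. *)
Lemma collapse_det4 (F : fieldType) (g g' : 'M[F]_3) (c : F) :
  cross (stack g g') != 0 -> (\rank (g - c *: g')%R <= 1)%N ->
  det4 (cross (stack g g') : 'rV_4) = 0.
Proof.
move=> k0 hr; have nf : ~~ row_free (top2 (g - c *: g')).
  by rewrite /row_free neq_ltn (leq_ltn_trans (top2_rank _)) // ltnS.
have /rowV0Pn[a] : kermx (top2 (g - c *: g')) != 0 by rewrite kermx_eq0.
move=> /sub_kermxP ha a0.
have [d ed] := stack_kernel k0 ha.
have d0 : d != 0.
  apply: contraNneq a0 => d0; apply/eqP/rowP => i.
  by have /rowP/(_ (lshift 2 i)) := ed; rewrite d0 scale0r row_mxEl !mxE.
apply/eqP; have := det4_pencil c a; rewrite ed det4Z => /eqP.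
by rewrite mulf_eq0 expf_eq0 (negbTE d0).
Qed.

(** If g = c g', the relations (a, -c a) would fill a plane instead of a line. *)
Lemma stack_independent (F : fieldType) (g g' : 'M[F]_3) (c : F) :
  cross (stack g g') != 0 -> (0 < \rank (g - c *: g')%R)%N.
Proof.
move=> k0; rewrite lt0n mxrank_eq0; apply/negP => /eqP e.
have top0 : top2 (g - c *: g') = 0 by rewrite e; apply/matrixP => i j; rewrite !mxE.
have ker (a : 'rV[F]_2) : exists d, row_mx a (- c *: a) = d *: cross (stack g g').
  by apply: stack_kernel => //; rewrite top0 mulmx0.
have [d1 e1] := ker (delta_mx 0 ord0); have [d2 e2] := ker (delta_mx 0 ord_max).
have /rowP/(_ (lshift 2 ord0)) := e1; rewrite row_mxEl 2!mxE !eqxx /= => h1.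
have /rowP/(_ (lshift 2 ord0)) := e2; rewrite row_mxEl 2!mxE /= => h2.
have /rowP/(_ (lshift 2 ord_max)) := e2; rewrite row_mxEl 2!mxE !eqxx /= => h3.
have d20 : d2 = 0.
  move/esym/eqP: h2; rewrite mulf_eq0 => /orP[/eqP //|/eqP h].
  by move: h1; rewrite h mulr0 => /eqP; rewrite oner_eq0.
by move/eqP: h3; rewrite d20 mul0r oner_eq0.
Qed.

End CommonImages.

(** * Degenerate pairs modulo [q] *)

Section PairCount.
Variables (q : nat) (q_pr : prime q).
Local Notation F := 'F_q.

Lemma intr_Fp_eq0 (z : int) : ((z%:~R : F) == 0) = (q %| z)%Z.
Proof. by rewrite -(dvdz_pcharf (pchar_Fp q_pr)). Qed.

Lemma cross_map (R S : comNzRingType) (f : {rmorphism R -> S}) k (V : 'M[R]_(k, k.+1)) :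
  cross (map_mx f V) = map_mx f (cross V).
Proof.
apply/rowP => j; rewrite !mxE rmorphM rmorphXn rmorphN1 -det_map_mx; congr (_ * \det _).
by apply/matrixP => a b; rewrite !mxE.
Qed.

Lemma stack_map (R S : comNzRingType) (f : R -> S) (g g' : 'M[R]_3) :
  stack (map_mx f g) (map_mx f g') = map_mx f (stack g g').
Proof.
apply/matrixP => a b; rewrite !mxE.
by case: splitP => k _; rewrite !mxE.
Qed.

Lemma primitive_neq0 n (K : 'rV[int]_n) : primitive K -> exists j, K ord0 j != 0.
Proof.
move=> [u uK]; apply/rV0Pn; apply: contra_eq_neq uK => ->.
by rewrite /dot big1 // => i _; rewrite mxE mulr0.
Qed.

Lemma bounded_stack (B : nat) (g g' : 'M[int]_3) :
  bounded_mx B g -> bounded_mx B g' -> bounded_mx B (stack g g').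
Proof.
move=> /bounded_mxP hg /bounded_mxP hg'; apply/bounded_mxP => i j; rewrite !mxE.
by case: splitP => k _; rewrite mxE.
Qed.

Lemma small_not_dvd (z : int) : z != 0 -> (`|z| < q)%N -> ~~ (q %| z)%Z.
Proof. by move=> z0 zq; rewrite dvdzE /= gtnNdvd // absz_gt0. Qed.

(** The minors are at most 3! B^3 < q in absolute value, so neither the content [s] nor any nonzero
    coordinate of [K] vanishes modulo [q], and the congruence for [det4] passes to the primitive
    part. *)
Lemma pair_reduction (B : nat) (g g' : SL3 int) :
  bounded_mx B g -> bounded_mx B g' -> (6 * B ^ 3 < q)%N ->
  cross (top2 g') != cross (top2 g) -> cross (top2 g') != - cross (top2 g) ->
  cross (stack (SL3_mod q g) (SL3_mod q g')) != 0 /\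
  exists K s, [/\ primitive K, bounded_mx (6 * B ^ 3) K, s != 0, cross (stack g g') = s *: K &
    det4 (cross (stack (SL3_mod q g) (SL3_mod q g')) : 'rV_4) = 0 -> (q %| det4 K)%Z].
Proof.
move=> hg hg' hB n1 n2; have c0 := stack_cross_neq0 n1 n2.
have /bounded_mxP cB := bounded_cross (bounded_stack hg hg').
have ec : cross (stack (SL3_mod q g) (SL3_mod q g')) = map_mx intr (cross (stack g g')).
  by rewrite -cross_map -stack_map.
have [s [K [s0 pK eK]]] := primitive_part c0.
have [j Kj] := primitive_neq0 pK.
have KB i : (`|K ord0 i| <= 6 * B ^ 3)%N.
  apply: leq_trans (cB ord0 i); rewrite eK mxE abszM leq_pmull // absz_gt0 //.
have sB : (`|s| <= 6 * B ^ 3)%N.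
  apply: leq_trans (cB ord0 j); rewrite eK mxE abszM leq_pmulr // absz_gt0 //.
have sq : ~~ (q %| s)%Z by rewrite small_not_dvd // (leq_ltn_trans sB).
split.
  apply/rV0Pn; exists j; rewrite ec mxE intr_Fp_eq0 eK mxE dvdzE abszM Euclid_dvdM // negb_or.
  by rewrite -[(q %| `|s|)%N]/(q %| s)%Z sq; apply: small_not_dvd => //; apply: leq_ltn_trans hB.
exists K, s; split => //.
  by apply/bounded_mxP => i l; rewrite (ord1 i).
rewrite ec => d0; have : (q %| det4 (cross (stack g g') : 'rV_4))%Z.
  by rewrite -intr_Fp_eq0 -d0 /det4 !mxE rmorphB !rmorphM.
rewrite eK det4Z dvdzE abszM abszX Euclid_dvdM // Euclid_dvdX //.
by rewrite -[(q %| `|s|)%N]/(q %| s)%Z (negbTE sq).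
Qed.

(** The short matrix [V] is recorded because [size_orth] needs it to bound the number of short
    vectors orthogonal to [K]. *)
Definition degenerate_kernels (B : nat) : seq 'rV[int]_4 :=
  [seq K <- box 1 4 (6 * B ^ 3) | `[< [/\ primitive K, (q %| det4 K)%Z &
     exists (V : 'M[int]_(3, 4)) s, [/\ bounded_mx B V, s != 0 & cross V = s *: K]] >]].

Lemma sum_degenerate_kernels (B : nat) : (0 < B)%N -> (12 * B ^ 3 < q)%N ->
  (\sum_(K <- degenerate_kernels B) size (orth B K) ^ 3 <=
   72 * ((9 * B) ^ 3) ^ 3 * (trunc_log 2 q).+1)%N.
Proof.
move=> B0 hB; apply: (@leq_trans (72 * ((9 * B) ^ 3) ^ 3 * (trunc_log 2 (6 * B ^ 3)).+1)); last first.
  rewrite leq_mul2l ltnS leq_trunc_log ?orbT //.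
  by apply: leq_trans (ltnW hB); rewrite leq_mul2r orbT.
apply: (@sum_cubes_shell4 q) => //.
- by rewrite mulnA.
- by rewrite filter_uniq // box_uniq.
- move=> K; rewrite mem_filter mem_box => /andP[/asboolP[pK _ _] hK].
  rewrite [(_ <= 6 * _)%N]hK andbT; have [j] := primitive_neq0 pK.
  rewrite -absz_gt0 => /leq_trans; apply.
  by apply: (mx_maxnormP _ _ (leqnn _)).
- by move=> K; rewrite mem_filter => /andP[/asboolP[]].
- move=> K; rewrite mem_filter => /andP[/asboolP[pK _ [V [s [hV s0 eV]]]] _].
  apply: leq_trans (size_orth hV s0 eV pK) _.
  by rewrite leq_exp2r // mulnA; move: B0; clear; case: B => // n _; rewrite [(9 * _)%N](mulnDl 8 1) mul1n -addn1 leq_add.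
Qed.

(** Meant for the stacks of degenerate pairs, whose three rows are short vectors orthogonal to the
    same kernel vector. *)
Lemma triple_count n (s : seq 'M[int]_(3, n)) (I : eqType) (ks : seq I) (t : I -> seq 'rV[int]_n) :
  uniq s -> (forall V, V \in s -> exists2 k, k \in ks & forall i, row i V \in t k) ->
  (size s <= \sum_(k <- ks) size (t k) ^ 3)%N.
Proof.
move=> us hs.
pose f k := [seq (col_mx r M : 'M[int]_(1 + 2, n)) | r <- t k,
   M <- [seq (col_mx r r' : 'M[int]_(1 + 1, n)) | r <- t k, r' <- t k]].
have -> : (\sum_(k <- ks) size (t k) ^ 3 = size (flatten [seq f k | k <- ks]))%N.
  rewrite size_flatten /shape -map_comp sumnE big_map; apply: eq_bigr => k _.
  by rewrite /= !size_allpairs mulnn -expnS.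
apply: uniq_leq_size us _ => V /hs[k kks hk].
apply/flatten_mapP; exists k => //.
apply/allpairsP; exists (row (@Ordinal 3 0 isT) V,
  col_mx (row (@Ordinal 3 1 isT) V) (row (@Ordinal 3 2 isT) V) : 'M[int]_(1 + 1, n)); split => //=.
  apply/allpairsP; exists (row (@Ordinal 3 1 isT) V, row (@Ordinal 3 2 isT) V).
  by split => /=.
apply/matrixP => i j; rewrite mxE; case: splitP => a ea.
  by rewrite mxE; congr (V _ _); apply: val_inj; rewrite /= ea (ord1 a).
rewrite mxE; case: splitP => b eb; rewrite mxE; congr (V _ _); apply: val_inj;
  by rewrite /= ea eb (ord1 b).
Qed.

End PairCount.

(** * Common images summed over all pairs *)

Section TotalCount.
Variables (q : nat) (q_pr : prime q) (U : nat).
Local Notation F := 'F_q.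
Let B := (4 * (2 * U))%N.
Let P := planes (2 * U).
Hypotheses (U_gt0 : (0 < U)%N) (B_small : (12 * B ^ 3 < q)%N).

Definition frame_choice (gam : 'rV[int]_3 -> SL3 int) :=
  forall p, p \in P -> bounded_mx B (gam p) /\ cross (top2 (gam p)) = p.

Lemma frames_exist : {gam | frame_choice gam}.
Proof.
have h p : exists g : SL3 int, spanned (2 * U) p -> bounded_mx B g /\ cross (top2 g) = p.
  case: (EM (spanned (2 * U) p)) => [/completion[g hg]|ns]; first by exists g.
  (* The identity is a default value where no frame is required. *)
  by exists (MkSL3 (det1 int 3)) => /ns.
have [gam hgam] := boolp.choice h.
by exists gam => p; rewrite mem_planes => /asboolP; apply: hgam.
Qed.

Variables (gam : 'rV[int]_3 -> SL3 int) (gamP : frame_choice gam).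

Definition common (p p' : 'rV[int]_3) : nat :=
  #|common_images (SL3_mod q (gam p)) (SL3_mod q (gam p'))|.

Definition degenerate (p p' : 'rV[int]_3) : bool :=
  [&& p' != p, p' != - p &
    [exists c : F, (\rank (SL3_mx (SL3_mod q (gam p)) - c *: SL3_mx (SL3_mod q (gam p')))%R <= 1)%N]].

Lemma card_Fq_mx m n : #|{: 'M[F]_(m, n)}| = (q ^ (m * n))%N.
Proof. by rewrite card_mx card_Fp. Qed.

(** The trivial bound serves for p' = p and p' = -p. Otherwise [card_common_images] applies, with
    rank at least 2 for generic pairs and at least 1 for degenerate ones. *)
Lemma common_bound p p' : p \in P -> p' \in P ->
  (common p p' <= (p' == p) * q ^ 3 + (p' == - p) * q ^ 3 + 3 * q + degenerate p p' * (3 * q ^ 2))%N.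
Proof.
move=> /gamP[bp cp] /gamP[bp' cp'].
have triv : (common p p' <= q ^ 3)%N.
  by apply: leq_trans (max_card _) _; rewrite card_Fq_mx.
case: (eqVneq p' p) => [e|n1]; first by rewrite mul1n -!addnA (leq_trans triv) ?leq_addr.
case: (eqVneq p' (- p)) => [e|n2]; first by rewrite mul1n mul0n add0n -!addnA (leq_trans triv) ?leq_addr.
rewrite !mul0n !add0n.
have hB6 : (6 * B ^ 3 < q)%N by apply: leq_ltn_trans B_small; rewrite leq_mul2r orbT.
have d1 : cross (top2 (gam p')) != cross (top2 (gam p)) by rewrite cp cp'.
have d2 : cross (top2 (gam p')) != - cross (top2 (gam p)) by rewrite cp cp'.
have [c0 _] := pair_reduction q_pr bp bp' hB6 d1 d2.
have u : SL3_mx (SL3_mod q (gam p')) \in unitmx by rewrite unitmxE SL3_det unitr1.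
have cF : #|F| = q := card_Fp q_pr.
have rank1 c := stack_independent c c0.
rewrite /degenerate n1 n2 /=; case: (boolP [exists c : F, _]) => [_|ne].
  rewrite mul1n; apply: leq_trans (leq_addl _ _).
  by have := card_common_images u rank1; rewrite cF.
rewrite mul0n addn0; have rank2 c : (2 <= \rank (SL3_mx (SL3_mod q (gam p)) - c *: SL3_mx (SL3_mod q (gam p')))%R)%N.
  by move: ne; rewrite negb_exists => /forallP/(_ c); rewrite -ltnNge.
by have := card_common_images u rank2; rewrite cF expn1.
Qed.

(** Each degenerate pair gives a kernel vector in the list by [collapse_det4], and is recovered from
    its stack because the first two rows of [gam p] determine [p]. *)
Lemma degenerate_count :
  (\sum_(p <- P) \sum_(p' <- P) degenerate p p' <=
   \sum_(K <- degenerate_kernels q B) size (orth B K) ^ 3)%N.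
Proof.
have hB6 : (6 * B ^ 3 < q)%N by apply: leq_ltn_trans B_small; rewrite leq_mul2r orbT.
pose pairs := [seq z <- [seq (p, p') | p <- P, p' <- P] | degenerate z.1 z.2].
pose s := [seq stack (gam z.1) (gam z.2) | z <- pairs].
have -> : (\sum_(p <- P) \sum_(p' <- P) degenerate p p' = size s)%N.
  rewrite size_map size_filter -sum1_count [RHS]big_mkcond /= big_allpairs_dep.
  by apply: eq_bigr => p _; apply: eq_bigr => p' _; case: degenerate.
have pairsP z : z \in pairs -> [/\ z.1 \in P, z.2 \in P & degenerate z.1 z.2].
  by rewrite mem_filter => /andP[dz /allpairsP[[a b] /= [ha hb ez]]]; rewrite ez in dz *.
apply: triple_count.
  rewrite map_inj_in_uniq; last first.
    move=> z z' /pairsP[z1 z2 _] /pairsP[z1' z2' _] /trmx_inj/eq_col_mx[e1 e2].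
    rewrite (surjective_pairing z) (surjective_pairing z').
    by rewrite -(gamP z1).2 -(gamP z2).2 -(gamP z1').2 -(gamP z2').2 e1 e2.
  rewrite filter_uniq // allpairs_uniq ?planes_uniq //.
  by move=> [a b] [a' b'] _ _ /= [-> ->].
move=> V /mapP[[p p'] /pairsP[/= /gamP[bp cp] /gamP[bp' cp'] /and3P[n1 n2 /existsP[c hc]]] ->].
have d1 : cross (top2 (gam p')) != cross (top2 (gam p)) by rewrite cp cp'.
have d2 : cross (top2 (gam p')) != - cross (top2 (gam p)) by rewrite cp cp'.
have [c0 [K [s' [pK bK s0 eK dK]]]] := pair_reduction q_pr bp bp' hB6 d1 d2.
have bW := bounded_stack bp bp'.
exists K.
  rewrite mem_filter mem_box bK andbT; apply/asboolP; split => //.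
    by apply: dK; apply: collapse_det4 hc.
  by exists (stack (gam p) (gam p')), s'.
move=> i; rewrite mem_orth; apply/andP; split.
  by apply/bounded_mxP => a b; rewrite mxE; have /bounded_mxP := bW.
by apply/eqP; apply: (mulfI s0); rewrite -dotZr -eK cross_orth mulr0.
Qed.

Lemma sum_eq_seq (s : seq 'rV[int]_3) (x : 'rV[int]_3) :
  uniq s -> (\sum_(y <- s) (y == x) <= 1)%N.
Proof.
move=> us; have -> : (\sum_(y <- s) (y == x) = count_mem x s)%N.
  by rewrite -sum1_count [RHS]big_mkcond; apply: eq_bigr => y _ /=; case: (y == x).
by rewrite count_uniq_mem // leq_b1.
Qed.

Lemma total_common :
  (\sum_(p <- P) \sum_(p' <- P) common p p' <=
    2 * size P * q ^ 3 + 3 * q * size P ^ 2 +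
    3 * q ^ 2 * (72 * ((9 * B) ^ 3) ^ 3 * (trunc_log 2 q).+1))%N.
Proof.
have B_gt0 : (0 < B)%N by rewrite !muln_gt0 U_gt0.
have inner p : p \in P -> (\sum_(p' <- P) common p p' <=
   2 * q ^ 3 + 3 * q * size P + (3 * q ^ 2) * \sum_(p' <- P) degenerate p p')%N.
  move=> pP; apply: (@leq_trans (\sum_(p' <- P) ((p' == p) * q ^ 3 + (p' == - p) * q ^ 3 +
     3 * q + degenerate p p' * (3 * q ^ 2)))).
    by rewrite big_seq [X in (_ <= X)%N]big_seq; apply: leq_sum => p' p'P; apply: common_bound.
  rewrite 3!big_split /= -!big_distrl /= big_const_seq count_predT iter_addn_0.
  apply: leq_add; last by rewrite mulnC.
  apply: leq_add; last by rewrite mulnAC.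
  rewrite mulSn mul1n.
  by apply: leq_add; rewrite -[X in (_ <= X)%N]mul1n leq_mul2r sum_eq_seq ?planes_uniq ?orbT.
apply: (@leq_trans (\sum_(p <- P) (2 * q ^ 3 + 3 * q * size P + (3 * q ^ 2) * \sum_(p' <- P) degenerate p p'))).
  by rewrite big_seq [X in (_ <= X)%N]big_seq; apply: leq_sum.
rewrite 2!big_split /= !big_const_seq count_predT !iter_addn_0 -big_distrr /=.
rewrite leq_add //.
  by rewrite leq_add // ?[(2 * size P * _)%N]mulnAC // -mulnA mulnn.
by rewrite leq_mul2l (leq_trans degenerate_count) ?orbT // sum_degenerate_kernels.
Qed.

End TotalCount.

(** * From large orbits to almost all of the plane *)

Section Growth.
Variables (R : realType) (q : nat) (q_pr : prime q).
Local Notation F := 'F_q.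

Let n : R := #|{: proj_plane F}|%:R.
Let c : R := 4800^-1.

Lemma card_planeR : n = q%:R ^+ 2 + q%:R + 1.
Proof.
have q1 : 1 < q%:R :> R by rewrite ltr1n prime_gt1.
have e : (#|{: proj_plane F}| * q.-1 = (q ^ 3).-1)%N.
  exact (etrans (congr1 (fun m => (#|{: proj_plane F}| * m.-1)%N) (esym (card_Fp q_pr)))
    (etrans (card_proj_plane F) (congr1 (fun m => (m ^ 3).-1) (card_Fp q_pr)))).
have {}e : n * (q%:R - 1) = q%:R ^+ 3 - 1.
  have q0 := prime_gt0 q_pr.
  have <- : q.-1%:R = q%:R - 1 :> R by rewrite -subn1 natrB.
  rewrite -natrM e -subn1 natrB ?expn_gt0 ?q0 // natrX //.
have : (n - (q%:R ^+ 2 + q%:R + 1)) * (q%:R - 1) = 0 by rewrite mulrBl e; ring.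
by move/eqP; rewrite mulf_eq0 !subr_eq0 [_ == 1]gt_eqF // orbF => /eqP.
Qed.

Let c_gt0 : 0 < c.
Proof. by rewrite invr_gt0 ltr0n. Qed.

(* The odds [#|A| / (n - #|A|)] grow by the factor [1 + c], with the
   denominators cleared since [B] may be the whole plane. *)
Lemma growth_step (A B : {set proj_plane F}) : gen_closed A B ->
  2 * (q%:R + 1) <= #|A|%:R :> R -> 2 * (q%:R + 1) <= n - #|A|%:R ->
  (1 + c) * #|A|%:R * (n - #|B|%:R) <= #|B|%:R * (n - #|A|%:R).
Proof.
move=> /(expansion R q_pr)[a [a0 aA Aa h]]; have en := card_planeR.
have q1 : 1 < q%:R :> R by rewrite ltr1n prime_gt1.
set x : R := #|A|%:R in aA Aa h *; set y : R := #|B|%:R in h * => hx hn.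
have n0 : 0 < n by lra.
have c0 := c_gt0.
have step : x + c * x * (n - x) / n <= y.
  (* The line at infinity has [q + 1] points, at most half of [x] and of [n - x]; the loss of a
     factor 4 turns 1200 into 4800. *)
  have h1 : x / 2 * ((n - x) / 2) <= a * (q%:R ^+ 2 - a) by apply: ler_pM; lra.
  have hx0 : 0 < x by lra.
  have hn0 : 0 < n - x by lra.
  move: h; rewrite (_ : 1200 = (4 * c)^-1); last by rewrite /c; field.
  move=> /(le_trans h1); rewrite -[X in _ <= X -> _]mulrA ler_pdivlMl ?mulr_gt0 // => h2.
  have q20 : 0 < q%:R ^+ 2 :> R by rewrite exprn_gt0 //; lra.
  have {}h2 : c * x * (n - x) <= q%:R ^+ 2 * (y - x).
    by apply: le_trans h2; rewrite le_eqVlt; apply/orP; left; apply/eqP; field.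
  have yx : 0 <= y - x.
    have : 0 <= q%:R ^+ 2 * (y - x) by apply: le_trans h2; rewrite !mulr_ge0 // ltW.
    by rewrite pmulr_rge0.
  rewrite -lerBrDl ler_pdivrMr // [X in _ <= X]mulrC; apply: (le_trans h2).
  by apply: ler_wpM2r => //; lra.
(* The goal rearranges to (1 + c) x n <= y (n + c x). *)
have : (x + c * x * (n - x) / n) * (n + c * x) <= y * (n + c * x).
  by apply: ler_wpM2r => //; rewrite addr_ge0 ?mulr_ge0 ?ltW //; lra.
have -> : (x + c * x * (n - x) / n) * (n + c * x) =
   (1 + c) * x * n + (c * x) ^+ 2 * (n - x) / n by field; rewrite gt_eqF.
have : 0 <= (c * x) ^+ 2 * (n - x) / n.
  by rewrite divr_ge0 ?mulr_ge0 ?sqr_ge0 //; lra.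
move=> h1 h2; lra.
Qed.

(** Iteration of [growth_step]. It can only stop when the complement is too small, and by
    monotonicity the complement then stays small. *)
Lemma growth (A : nat -> {set proj_plane F}) (k : nat) :
  (forall i, gen_closed (A i) (A i.+1)) -> 2 * (q%:R + 1) <= #|A 0%N|%:R :> R ->
  n - #|A k|%:R < 2 * (q%:R + 1) \/
  (1 + c) ^+ k * #|A 0%N|%:R * (n - #|A k|%:R) <= n ^+ 2.
Proof.
move=> hA h0; have q1 : 1 < q%:R :> R by rewrite ltr1n prime_gt1.
have le_n i : #|A i|%:R <= n by rewrite ler_nat max_card.
have mono i : #|A i|%:R <= #|A i.+1|%:R :> R.
  by rewrite ler_nat subset_leq_card //; case: (hA i).
have A0 i : #|A 0%N|%:R <= #|A i|%:R :> R.
  by elim: i => // i IHi; apply: le_trans (mono i).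
have [key|key] : n - #|A k|%:R < 2 * (q%:R + 1) \/
  (1 + c) ^+ k * #|A 0%N|%:R * (n - #|A k|%:R) <= #|A k|%:R * (n - #|A 0%N|%:R).
  elim: k => [|k IHk]; first by right; rewrite expr0 mul1r lexx.
  case: (ltP (n - #|A k.+1|%:R) (2 * (q%:R + 1))) => h; first by left.
  right; have hk : 2 * (q%:R + 1) <= n - #|A k|%:R by have := mono k; lra.
  case: IHk => [|IHk]; first by lra.
  have st := growth_step (hA k) (le_trans h0 (A0 k)) hk.
  set x : R := #|A k|%:R in IHk st hk *; set y : R := #|A k.+1|%:R in st h *.
  set z : R := #|A 0%N|%:R in IHk h0 *.
  have x0 : 0 < x by have := A0 k; rewrite -/z -/x; lra.
  rewrite -(ler_pM2l (_ : 0 < x * (n - x))); last by rewrite mulr_gt0 //; lra.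
  have -> : x * (n - x) * ((1 + c) ^+ k.+1 * z * (n - y)) =
     ((1 + c) ^+ k * z * (n - x)) * ((1 + c) * x * (n - y)) by rewrite exprS; ring.
  have -> : x * (n - x) * (y * (n - z)) = (x * (n - z)) * (y * (n - x)) by ring.
  have c0 : 0 <= 1 + c := addr_ge0 ler01 (ltW c_gt0).
  apply: ler_pM => //; first by rewrite !mulr_ge0 ?exprn_ge0 //; lra.
  by rewrite !mulr_ge0 //; lra.
  by left.
right; apply: (le_trans key); rewrite expr2.
by apply: ler_pM; have := le_n 0%N; have := le_n k; have := A0 k; lra.
Qed.

End Growth.

(** * Collisions and the number of images *)

Section OrbitCount.

(** Cauchy-Schwarz for the fibre sizes [n y]: they add up to the length of [s], and their squares
    count the colliding pairs. *)
Lemma collision_bound (I : eqType) (T : finType) (f : I -> T) (s : seq I) (A : {set T}) :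
  (forall i, i \in s -> f i \in A) ->
  (size s ^ 2 <= #|A| * \sum_(i <- s) \sum_(j <- s) (f i == f j))%N.
Proof.
move=> hA; pose n y := (\sum_(i <- s) (f i == y))%N.
have pick (F : T -> nat) : (\sum_(i <- s) F (f i) = \sum_(y in A) n y * F y)%N.
  under [RHS]eq_bigr do rewrite big_distrl /=.
  rewrite [RHS]exchange_big /= big_seq [RHS]big_seq; apply: eq_bigr => i /hA fA.
  rewrite (bigD1 (f i)) //= eqxx mul1n big1 ?addn0 // => y /andP[_ /negbTE].
  by rewrite eq_sym => ->.
have e1 : (size s = \sum_(y in A) n y)%N.
  have := pick (fun=> 1%N); rewrite sum1_size => ->.
  by apply: eq_bigr => y _; rewrite muln1.
have e2 : (\sum_(i <- s) \sum_(j <- s) (f i == f j) = \sum_(y in A) n y ^ 2)%N.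
  transitivity (\sum_(i <- s) n (f i))%N.
    by apply: eq_bigr => i _; apply: eq_bigr => j _; rewrite eq_sym.
  by rewrite pick; apply: eq_bigr => y _; rewrite mulnn.
rewrite e1 e2 -(leq_pmul2l (isT : 0 < 2)%N) -mulnn big_distrlr /= big_distrr /=.
have -> : (2 * (#|A| * \sum_(y in A) n y ^ 2) = \sum_(y in A) \sum_(z in A) (n y ^ 2 + n z ^ 2))%N.
  under [RHS]eq_bigr do rewrite big_split /= sum_nat_const.
  by rewrite big_split /= sum_nat_const -big_distrr /= mul2n addnn.
apply: leq_sum => y _; rewrite big_distrr; apply: leq_sum => z _.
exact: (nat_Cauchy (n y) (n z)).1.
Qed.

Variables (q : nat) (q_pr : prime q).
Local Notation F := 'F_q.
Variables (P : seq 'rV[int]_3) (gam : 'rV[int]_3 -> SL3 int).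

Definition collisions (X : proj_plane F) : nat :=
  (\sum_(p <- P) \sum_(p' <- P) (Phi q (gam p) X == Phi q (gam p') X))%N.

(** A point where two matrices collide contributes its [q - 1] representatives to their common
    images. *)
Lemma sum_collisions :
  (q.-1 * \sum_X collisions X <= \sum_(p <- P) \sum_(p' <- P) common q gam p p')%N.
Proof.
rewrite exchange_big big_distrr /=; apply: leq_sum => p _.
rewrite exchange_big big_distrr /=; apply: leq_sum => p' _.
pose A := [set X | Phi q (gam p) X == Phi q (gam p') X].
have -> : (\sum_X (Phi q (gam p) X == Phi q (gam p') X) = #|A|)%N.
  by rewrite -sum1_card [RHS]big_mkcond; apply: eq_bigr => X _; rewrite inE; case: eqP.
have cA : (#|cone A| = #|A| * q.-1)%N.
  exact (etrans (card_cone A) (congr1 (fun m => (#|A| * m.-1)%N) (card_Fp q_pr))).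
rewrite mulnC -cA; apply: subset_leq_card; apply/fintype.subsetP => v.
rewrite inE => /existsP[X /andP[]]; rewrite inE => /eqP e vX.
rewrite inE (mem_point_neq0 vX) /=.
have h1 : SL3_mod q (gam p) *m v \in proj_class (Phi q (gam p) X) by rewrite mem_Phi.
have h2 : SL3_mod q (gam p') *m v \in proj_class (Phi q (gam p) X) by rewrite e mem_Phi.
rewrite (mem_pointE _ h2) in h1; case/existsP: h1 => c /andP[_ hc].
by apply/existsP; exists c.
Qed.

End OrbitCount.

(** * Points reached by matrices of bounded size *)

Section Reach.
Variables (R : realType) (q : nat) (q_pr : prime q).
Local Notation F := 'F_q.

Definition reach (X : proj_plane F) (M : nat) : {set proj_plane F} :=
  [set y | `[< exists g : SL3 int, (mx_maxnorm g <= M)%N /\ Phi q g X = y >]].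

Lemma reachP X M y : reflect (exists g : SL3 int, (mx_maxnorm g <= M)%N /\ Phi q g X = y)
  (y \in reach X M).
Proof. by rewrite inE; apply: asboolP. Qed.

Lemma gen_closed_reach X M : gen_closed (reach X M) (reach X (2 * M)).
Proof.
split=> [|i j ij s s1]; apply/fintype.subsetP => y.
  case/reachP=> g [hg <-]; apply/reachP; exists g; split => //.
  by apply: leq_trans hg _; rewrite leq_pmull.
case/imsetP=> z /reachP[g [hg <-]] ->; apply/reachP; exists (SL3_mul (elem s ij) g).
rewrite Phi_mul; split => //; apply: leq_trans (maxnorm_elem_mul _ _ _ s1) _.
by rewrite leq_mul2l hg orbT.
Qed.

Variables (U : nat).
Hypotheses (U_large : 108 * 196 ^+ 2 <= U%:R ^+ 2 :> R) (U_le : (20 * U%:R) ^+ 3 <= q%:R :> R)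
  (U_ge : q%:R <= (40 * U%:R) ^+ 3 :> R).

Let P := planes (2 * U).
Let u : R := U%:R.
Let Q : R := q%:R.
Let c1 : R := 8 * (108 * 196 ^+ 3) ^+ 2.
Let L : R := (trunc_log 2 q).+1%:R.
Let c2 : R := 2 * (5 + 216 * 47 ^+ 3).

Lemma frame_size_gt0 : (0 < U)%N.
Proof.
rewrite lt0n; apply/eqP => U0; move: U_large; rewrite U0 expr0n /= leNgt.
by rewrite mulr_gt0 ?exprn_gt0 ?ltr0n.
Qed.

(** 12 * 8^3 = 6144 is below 20^3 = 8000. *)
Lemma frame_size_small : (12 * (4 * (2 * U)) ^ 3 < q)%N.
Proof.
have U0 := frame_size_gt0.
have h : ((20 * U) ^ 3 <= q)%N by rewrite -(ler_nat R) natrX natrM.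
apply: leq_trans h.
have -> : (12 * (4 * (2 * U)) ^ 3 = 12 * (4 * 2) ^ 3 * U ^ 3)%N by rewrite mulnA expnMn mulnA.
by rewrite [((20 * U) ^ 3)%N]expnMn ltn_pmul2r ?expn_gt0 ?U0.
Qed.

(** The box containing the planes has (16 U^2 + 1)^3 vectors, and 16 U^2 + 1 <= 400 U^2. *)
Lemma planes_size_le : (size P)%:R <= Q ^+ 2 :> R.
Proof.
have U0 := frame_size_gt0.
have h : (size P <= (20 ^ 3 * U ^ 3) ^ 2)%N.
  apply: (@leq_trans ((2 * (2 * (2 * U) ^ 2)).+1 ^ (1 * 3))).
    apply: size_bounded; first exact: planes_uniq.
    by apply/allP => p; rewrite mem_filter mem_box => /andP[].
  have -> : ((20 ^ 3 * U ^ 3) ^ 2 = ((20 * U) ^ 2) ^ 3)%N by rewrite -expnMn -!expnM.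
  rewrite mul1n leq_exp2r // !expnMn (_ : 2 ^ 2 = 4)%N // (_ : 20 ^ 2 = 400)%N //.
  have : (0 < U ^ 2)%N by rewrite expn_gt0 U0.
  by move: (U ^ 2)%N => m; clear; lia.
apply: (@le_trans _ _ (((20 * u) ^+ 3) ^+ 2)).
  by move: h; rewrite -expnMn -(ler_nat R) !natrX natrM.
by rewrite ler_sqr ?nnegrE ?exprn_ge0 ?mulr_ge0.
Qed.

(** Every term of [total_common] is at most a multiple of L Q^5, and dividing by q - 1 >= q / 2
    leaves Q^4. The 47 comes from (72 U)^3 <= 47 (20 U)^3. *)
Lemma collisions_le gam : frame_choice U gam ->
  \sum_(X : proj_plane F) (collisions P gam X)%:R <= c2 * L * Q ^+ 4 :> R.
Proof.
move=> gamP; have U0 := frame_size_gt0.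
have Q2 : 2 <= Q by rewrite ler_nat prime_gt1.
have h1 := sum_collisions q_pr P gam.
have h2 := total_common q_pr U0 frame_size_small gamP.
have := leq_trans h1 h2; rewrite -(ler_nat R) natrM natr_sum.
set E := \sum_X _; have E0 : 0 <= E by apply: sumr_ge0.
have -> : q.-1%:R = Q - 1 :> R by rewrite -subn1 natrB ?prime_gt0.
rewrite !(natrX, natrD, natrM) -/L -/Q -/P.
set s : R := (size P)%:R; have sQ : s <= Q ^+ 2 := planes_size_le.
have s0 : 0 <= s by apply: ler0n.
have L1 : 1 <= L by rewrite ler1n.
pose w : R := (9 * (4 * (2 * u))) ^+ 3.
have wQ : w <= 47 * Q.
  apply: (@le_trans _ _ (47 * (20 * u) ^+ 3)); last by rewrite ler_pM2l ?ltr0n.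
  have -> : w = 18 ^+ 3 * (4 * u) ^+ 3 by rewrite /w; ring.
  have -> : 47 * (20 * u) ^+ 3 = (47 * 5 ^+ 3) * (4 * u) ^+ 3 by ring.
  apply: ler_wpM2r; first by rewrite exprn_ge0 // mulr_ge0.
  by rewrite -!natrX -natrM ler_nat.
have w0 : 0 <= w by rewrite exprn_ge0 // !mulr_ge0.
rewrite -/u -/w => h.
pose K : R := 216 * 47 ^+ 3.
have K0 : 0 <= K by rewrite mulr_ge0 ?exprn_ge0.
have t3 : 3 * Q ^+ 2 * (72 * w ^+ 3 * L) <= K * L * Q ^+ 5.
  have -> : K * L * Q ^+ 5 = 3 * Q ^+ 2 * (72 * (47 * Q) ^+ 3 * L) by rewrite /K; ring.
  have Q0 : 0 <= Q by lra.
  apply: ler_wpM2l; first by rewrite mulr_ge0 // exprn_ge0.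
  apply: ler_wpM2r; first by lra.
  by apply: ler_wpM2l => //; rewrite lerXn2r // nnegrE mulr_ge0.
have Q5 : 0 <= Q ^+ 5 by rewrite exprn_ge0 //; lra.
have t1 : 2 * s * Q ^+ 3 <= 2 * Q ^+ 5.
  have -> : 2 * Q ^+ 5 = 2 * Q ^+ 2 * Q ^+ 3 by ring.
  by rewrite ler_wpM2r ?exprn_ge0 //; lra.
have t2 : 3 * Q * s ^+ 2 <= 3 * Q ^+ 5.
  have -> : 3 * Q ^+ 5 = 3 * Q * (Q ^+ 2) ^+ 2 by ring.
  by rewrite ler_wpM2l ?ler_sqr ?nnegrE ?sqr_ge0 //; lra.
have t4 : 5 * Q ^+ 5 <= 5 * L * Q ^+ 5 by rewrite ler_wpM2r //; lra.
have t5 : (Q - 1) * E <= (5 + K) * L * Q ^+ 5 by rewrite mulrDl mulrDl; lra.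
rewrite -(ler_pM2l (_ : 0 < Q / 2)); last by lra.
have -> : Q / 2 * (c2 * L * Q ^+ 4) = (5 + K) * L * Q ^+ 5 by rewrite /c2 -/K; field.
by apply: le_trans t5; rewrite ler_wpM2r //; lra.
Qed.

(** [collision_bound] for the images of [X], where the number of matrices is at least U^6 / c1 and U
    is at least q^(1/3) / 40. *)
Lemma reach_large gam (X : proj_plane F) : frame_choice U gam ->
  Q ^+ 4 <= (c1 * (40 ^+ 3) ^+ 2) ^+ 2 * #|reach X (8 * U)|%:R * (collisions P gam X)%:R.
Proof.
move=> gamP.
have h : (size P ^ 2 <= #|reach X (8 * U)| * collisions P gam X)%N.
  apply: collision_bound => p pP; apply/reachP; exists (gam p); split => //.
  by have [hb _] := gamP p pP; move: hb; rewrite /bounded_mx mulnA.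
have {}h : (size P)%:R ^+ 2 <= #|reach X (8 * U)|%:R * (collisions P gam X)%:R :> R.
  by rewrite -natrX -natrM ler_nat.
have h1 := many_planes U_large; rewrite -/c1 -/u -/P in h1.
rewrite -mulrA; apply: (@le_trans _ _ ((c1 * (40 ^+ 3) ^+ 2) ^+ 2 * (size P)%:R ^+ 2)); last first.
  by rewrite ler_wpM2l ?sqr_ge0.
have c1_ge0 : 0 <= c1 := mulr_ge0 (ler0n _ _) (sqr_ge0 _).
have -> : Q ^+ 4 = (Q ^+ 2) ^+ 2 by rewrite -exprM.
rewrite -exprMn ler_sqr ?nnegrE ?sqr_ge0 //; last first.
  by apply: mulr_ge0 => //; apply: mulr_ge0 => //; apply: sqr_ge0.
apply: (@le_trans _ _ (((40 * u) ^+ 3) ^+ 2)).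
  by rewrite ler_sqr ?nnegrE // exprn_ge0 // mulr_ge0.
have -> : ((40 * u) ^+ 3) ^+ 2 = (40 ^+ 3) ^+ 2 * u ^+ 6 by ring.
move: (sqr_ge0 (40 ^+ 3 : R)); move: ((40 ^+ 3 : R) ^+ 2) => A A0.
rewrite [c1 * A]mulrC -[A * c1 * _]mulrA; exact: ler_wpM2l.
Qed.

End Reach.

(** * Inequalities for [Q = q] and a small power [h] of it *)

Section Arithmetic.
Variable R : realFieldType.
Implicit Types Q h C n : R.

(** Markov's inequality for the [n - y] points with at least Q^2 h^2 collisions: one factor [h]
    absorbs the logarithm [L], the other is the gain. *)
Lemma few_exceptions Q h C c2 c3 L n y : 1 < Q -> 1 <= h -> 0 <= c2 -> c2 * c3 <= C ->
  Q ^+ 2 <= n -> L <= c3 * h -> 0 <= C -> Q ^+ 2 * h ^+ 2 * (n - y) <= c2 * L * Q ^+ 4 ->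
  (1 - C / h) * n <= y.
Proof.
move=> Q1 h1 c20 hC Qn hL C0 H; have h0 : 0 < h by lra.
have Q0 : 0 < Q ^+ 2 by rewrite exprn_gt0 //; lra.
suff : h * (n - y) <= C * n.
  move=> H'; have : n - y <= C * n / h by rewrite ler_pdivlMr // mulrC.
  by rewrite mulrBl mul1r mulrAC => ?; lra.
have H1 : c2 * L * Q ^+ 4 <= C * h * Q ^+ 4.
  apply: ler_wpM2r; first by rewrite exprn_ge0 //; lra.
  apply: (@le_trans _ _ (c2 * (c3 * h))); first exact: ler_wpM2l.
  by rewrite mulrA; apply: ler_wpM2r => //; lra.
have : Q ^+ 2 * h * (h * (n - y)) <= Q ^+ 2 * h * (C * Q ^+ 2).
  have -> : Q ^+ 2 * h * (h * (n - y)) = Q ^+ 2 * h ^+ 2 * (n - y) by ring.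
  have -> : Q ^+ 2 * h * (C * Q ^+ 2) = C * h * Q ^+ 4 by ring.
  exact: le_trans H1.
rewrite (ler_pM2l (mulr_gt0 Q0 h0)) => /le_trans; apply; exact: ler_wpM2l.
Qed.

(** If a < 4 Q, then Q^2 <= c5 a h^2 < 4 c5 Q h^2 <= Q h^3 <= Q^2, a contradiction. *)
Lemma large_start Q h c5 a w : 1 < Q -> 1 <= h -> h ^+ 4 <= Q -> 4 * c5 <= h -> 0 <= c5 ->
  0 <= a -> Q ^+ 4 <= c5 * a * w -> w <= Q ^+ 2 * h ^+ 2 ->
  Q ^+ 2 <= c5 * a * h ^+ 2 /\ 2 * (Q + 1) <= a.
Proof.
move=> Q1 h1 hQ hc c50 a0 H1 H2; have Q0 : 0 < Q by lra.
have H : Q ^+ 2 <= c5 * a * h ^+ 2.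
  rewrite -(ler_pM2l (exprn_gt0 2 Q0)).
  have -> : Q ^+ 2 * Q ^+ 2 = Q ^+ 4 by ring.
  apply: (le_trans H1); have -> : Q ^+ 2 * (c5 * a * h ^+ 2) = c5 * a * (Q ^+ 2 * h ^+ 2) by ring.
  by apply: ler_wpM2l => //; apply: mulr_ge0.
split=> //; apply: (@le_trans _ _ (4 * Q)); first by lra.
rewrite leNgt; apply/negP => ha.
have h20 : 0 <= h ^+ 2 := sqr_ge0 h.
have A1 : c5 * a * h ^+ 2 <= c5 * (4 * Q) * h ^+ 2.
  by apply: ler_wpM2r => //; apply: ler_wpM2l => //; exact: ltW.
have A2 : c5 * (4 * Q) * h ^+ 2 <= h ^+ 3 * Q.
  have -> : c5 * (4 * Q) * h ^+ 2 = (4 * c5) * (h ^+ 2 * Q) by ring.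
  have -> : h ^+ 3 * Q = h * (h ^+ 2 * Q) by ring.
  by apply: ler_wpM2r => //; apply: mulr_ge0 => //; lra.
have A3 : c5 * a * h ^+ 2 < c5 * (4 * Q) * h ^+ 2 \/ c5 = 0.
  case: (eqVneq c5 0) => [|c5n]; [by right | left].
  have c5p : 0 < c5 by rewrite lt0r c5n.
  by rewrite (ltr_pM2r (exprn_gt0 2 (lt_le_trans ltr01 h1))) (ltr_pM2l c5p).
have A4 : h ^+ 3 <= h ^+ 4 by apply: ler_weXn2l.
have A5 : h ^+ 3 * Q <= Q * Q by apply: ler_wpM2r; lra.
have Q2 : 0 < Q ^+ 2 by rewrite exprn_gt0.
case: A3 => [A3|c5z]; last by move: H; rewrite c5z !mul0r; lra.
by move: H A1 A2 A3 A5; rewrite expr2; lra.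
Qed.

Lemma near_full Q h C n b : 1 < Q -> 1 <= h -> h <= Q -> 4 <= C -> Q ^+ 2 <= n ->
  n - b < 2 * (Q + 1) -> (1 - C / h) * n <= b.
Proof.
move=> Q1 h1 hQ hC Qn H; have h0 : 0 < h by lra.
suff : n - b <= C * n / h by rewrite mulrBl mul1r mulrAC => ?; lra.
rewrite ler_pdivlMr //; apply: (@le_trans _ _ (4 * Q * Q)).
  apply: (@le_trans _ _ (4 * Q * h)); first by apply: ler_wpM2r; lra.
  by apply: ler_wpM2l; lra.
rewrite -mulrA -expr2; apply: (@le_trans _ _ (4 * n)); first by rewrite ler_pM2l.
by apply: ler_wpM2r => //; apply: le_trans Qn; apply: sqr_ge0.
Qed.

(** The growth h^4 outweighs the loss h^2 in the starting set: n - b is at most 2 c5 n^2 / (h Q)^2,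
    and n <= 3 Q^2. *)
Lemma grown Q h C n a b c5 G : 1 < Q -> 1 <= h -> 0 <= c5 -> 6 * c5 <= C -> n <= 3 * Q ^+ 2 ->
  0 < n -> 0 <= a -> Q ^+ 2 <= c5 * a * h ^+ 2 -> h ^+ 4 / 2 <= G -> G * a * (n - b) <= n ^+ 2 ->
  (1 - C / h) * n <= b.
Proof.
move=> Q1 h1 c50 hC nQ n0 a0 H1 H2 H3; have h0 : 0 < h by lra.
suff : n - b <= C * n / h by rewrite mulrBl mul1r mulrAC => ?; lra.
rewrite ler_pdivlMr //; set d := n - b in H3 *.
case: (leP d 0) => [d0|d0].
  apply: (@le_trans _ _ 0); first by rewrite pmulr_lle0.
  by rewrite mulr_ge0 ?(ltW n0) //; lra.
have h4 : 0 < h ^+ 2 by rewrite exprn_gt0.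
have S1 : h ^+ 4 / 2 * a * d <= n ^+ 2.
  by apply: le_trans H3; apply: ler_wpM2r; [exact: ltW | apply: ler_wpM2r].
have S2 : h ^+ 2 * (h ^+ 2 * Q ^+ 2 * d) <= h ^+ 2 * (2 * c5 * n ^+ 2).
  apply: (@le_trans _ _ (h ^+ 2 * (h ^+ 2 * (c5 * a * h ^+ 2) * d))).
    apply: ler_wpM2l; first exact: ltW.
    by apply: ler_wpM2r; [exact: ltW | apply: ler_wpM2l; [exact: ltW|]].
  have -> : h ^+ 2 * (h ^+ 2 * (c5 * a * h ^+ 2) * d) = h ^+ 2 * (2 * c5) * (h ^+ 4 / 2 * a * d) by field.
  rewrite [X in _ <= X]mulrA; apply: ler_wpM2l => //.
  by rewrite mulr_ge0 ?(ltW h4) //; lra.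
rewrite ler_pM2l // in S2.
have S3 : n * (h ^+ 2 * d) <= n * (6 * c5 * n).
  have -> : n * (6 * c5 * n) = 3 * (2 * c5 * n ^+ 2) by ring.
  apply: (@le_trans _ _ (3 * (h ^+ 2 * Q ^+ 2 * d))); last by rewrite ler_pM2l.
  have -> : 3 * (h ^+ 2 * Q ^+ 2 * d) = 3 * Q ^+ 2 * (h ^+ 2 * d) by ring.
  by apply: ler_wpM2r => //; rewrite mulr_ge0 ?ltW.
rewrite ler_pM2l // in S3.
apply: (@le_trans _ _ (h ^+ 2 * d)).
  rewrite mulrC; apply: ler_wpM2r; first exact: ltW.
  by rewrite expr2 ler_peMr // ltW.
by apply: (le_trans S3); apply: ler_wpM2r => //; exact: ltW.
Qed.

End Arithmetic.

(** * Choice of the parameters *)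

Section Final.
Variable R : realType.

Lemma decay_cvg (C e : R) : 0 < e ->
  (C * q%:R `^ (- e) @[q --> within [set q | prime q]%classic \oo] --> (0 : R))%classic.
Proof.
move=> e0; apply: cvg_within_filter; apply/cvgrPdist_lt => r r0.
near=> q; rewrite sub0r normrN normrM powRN [X in _ * X]ger0_norm ?invr_ge0 ?powR_ge0 //.
have hq : ((`|C| + 1) / r) `^ e^-1 < q%:R by near: q; exact: nbhs_infty_gtr.
have x0 : 0 < (`|C| + 1) / r by rewrite divr_gt0 // ltr_wpDl.
have q0 : 0 < q%:R :> R by apply: le_lt_trans hq; exact: powR_ge0.
rewrite ltr_pdivrMr ?powR_gt0 //.
have : (`|C| + 1) / r < q%:R `^ e.
  have -> : (`|C| + 1) / r = (((`|C| + 1) / r) `^ e^-1) `^ e.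
    by rewrite -powRrM mulVf ?powRr1 ?ltW // gt_eqF.
  by apply: gt0_ltr_powR => //; rewrite nnegrE ?powR_ge0 ?ltW.
by rewrite ltr_pdivrMr // mulrC; apply: lt_trans; rewrite ltrDl.
Unshelve. all: by end_near. Qed.

(** This follows from ln x < x at x = q^e. *)
Lemma trunc_log_le (q : nat) (e : R) : (0 < q)%N -> 0 < e -> 1 <= q%:R `^ e ->
  (trunc_log 2 q).+1%:R <= (1 + (e * ln 2)^-1) * q%:R `^ e.
Proof.
move=> q0 e0 h1; set h := q%:R `^ e in h1 *; have qR : 0 < q%:R :> R by rewrite ltr0n.
have l2 : 0 < ln 2 :> R by apply: ln_gt0; rewrite ltr1n.
have h0 : 0 < h by lra.
have : ((trunc_log 2 q)%:R : R) * ln 2 <= ln q%:R.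
  rewrite mulr_natl -lnXn // -natrX ler_ln ?posrE ?ltr0n ?expn_gt0 // ler_nat.
  by rewrite trunc_logP.
have lh : e * ln q%:R < h by rewrite -ln_powR; exact: ln_sublinear.
rewrite -(ler_pM2l e0) => H.
have : (trunc_log 2 q)%:R <= (e * ln 2)^-1 * h.
  rewrite ler_pdivlMl ?mulr_gt0 //; apply: le_trans (ltW lh); apply: le_trans H.
  by rewrite le_eqVlt; apply/orP; left; apply/eqP; ring.
by rewrite -natr1 mulrDl mul1r => ?; lra.
Qed.

(** [k] is the integer part of eps log_2 Q; the factor 1/2 pays for the rounding, since 1 + c <=
    2. *)
Lemma growth_exponent (eps c Q : R) : 0 < eps -> 0 < c -> c <= 1 -> 1 < Q ->
  exists k : nat, 2 ^+ k <= Q `^ eps /\ Q `^ (eps * ln (1 + c) / ln 2) / 2 <= (1 + c) ^+ k.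
Proof.
move=> eps0 c0 c1 Q1; have Q0 : 0 < Q by lra.
have l2 : 0 < ln 2 :> R by apply: ln_gt0; rewrite ltr1n.
have lQ : 0 < ln Q by apply: ln_gt0.
have lc : 0 < ln (1 + c) by apply: ln_gt0; lra.
pose x := eps * ln Q / ln 2; have x0 : 0 <= x by rewrite ltW // !mulr_gt0 ?invr_gt0.
have powE (y : R) : Q `^ y = expR (y * ln Q) by rewrite /powR gt_eqF.
have /andP[k1 k2] := truncn_itv x0.
exists (Num.truncn x); set k := Num.truncn x in k1 k2 *; split.
  have -> : (2 : R) ^+ k = expR (k%:R * ln 2) by rewrite expRM_natl lnK // posrE.
  by rewrite powE ler_expR -ler_pdivlMr.
rewrite ler_pdivrMr //; apply: (@le_trans _ _ ((1 + c) ^+ k.+1)); last first.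
  by rewrite exprSr ler_wpM2l ?exprn_ge0 //; lra.
have -> : (1 + c) ^+ k.+1 = expR (k.+1%:R * ln (1 + c)).
  by rewrite expRM_natl lnK // posrE; lra.
rewrite powE ler_expR.
have -> : eps * ln (1 + c) / ln 2 * ln Q = x * ln (1 + c) by rewrite /x; field; rewrite gt_eqF.
by rewrite ler_pM2r // ltW.
Qed.

(** [U] is the integer part of q^(1/3) / 20; a lower bound of 11 * 196 is enough because 11^2 >=
    108. *)
Lemma box_side_exists (q : nat) : (20 * (11 * 196 + 1)) ^+ 3 <= q%:R :> R ->
  exists U : nat, [/\ 108 * 196 ^+ 2 <= U%:R ^+ 2 :> R, 20 * U%:R <= q%:R `^ 3^-1 :> R,
   (20 * U%:R) ^+ 3 <= q%:R :> R & q%:R <= (40 * U%:R) ^+ 3 :> R].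
Proof.
set N : R := 11 * 196 => hq; set Q : R := q%:R in hq *.
have N0 : 1 <= N by rewrite /N -natrM ler1n.
have Q0 : 0 <= Q := ler0n _ _.
pose r : R := Q `^ 3^-1; have r0 : 0 <= r := powR_ge0 _ _.
have r3 : r ^+ 3 = Q by rewrite -powR_mulrn // -powRrM mulVf ?powRr1 // pnatr_eq0.
have rN : 20 * (N + 1) <= r.
  rewrite leNgt; apply/negP => h.
  have : r ^+ 3 < (20 * (N + 1)) ^+ 3 by rewrite ltrXn2r ?nnegrE //; lra.
  by rewrite r3; lra.
have x0 : 0 <= r / 20 by lra.
have /andP[u1 u2] := truncn_itv x0.
exists (Num.truncn (r / 20)); set U := Num.truncn _ in u1 u2 *.
rewrite -[U.+1%:R]natr1 in u2; set u : R := U%:R in u1 u2 *.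
have u20 : 20 * u <= r by lra.
have uN : N <= u by lra.
split => //.
- apply: (@le_trans _ _ (N ^+ 2)); last by rewrite ler_sqr ?nnegrE //; lra.
  rewrite /N exprMn; apply: ler_wpM2r; first exact: sqr_ge0.
  by rewrite -natrX ler_nat.
- by rewrite -r3 lerXn2r ?nnegrE // mulr_ge0.
- by rewrite -r3 lerXn2r ?nnegrE //; lra.
Qed.

(** [Y] consists of the points with at most Q^2 h^2 collisions. From such a point the frames reach
    enough points for [growth] to start, and [k] rounds of generators lead to [near_full] or
    [grown]. *)
Lemma expansion_of_orbits (q U k : nat) (h C c3 : R) (q_pr : prime q) :
  let c1 : R := 8 * (108 * 196 ^+ 3) ^+ 2 in let c2 : R := 2 * (5 + 216 * 47 ^+ 3) in
  let c5 : R := (c1 * (40 ^+ 3) ^+ 2) ^+ 2 in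
  108 * 196 ^+ 2 <= U%:R ^+ 2 :> R -> (20 * U%:R) ^+ 3 <= q%:R :> R ->
  q%:R <= (40 * U%:R) ^+ 3 :> R ->
  1 <= h -> h ^+ 4 <= q%:R -> h ^+ 4 / 2 <= (1 + 4800^-1) ^+ k ->
  (trunc_log 2 q).+1%:R <= c3 * h ->
  4 <= C -> c2 * c3 <= C -> 4 * c5 <= h -> 6 * c5 <= C ->
  exists Y : {set proj_plane 'F_q},
    (1 - C / h) * #|{: proj_plane 'F_q}|%:R <= #|Y|%:R /\
    forall X, X \in Y ->
    (1 - C / h) * #|{: proj_plane 'F_q}|%:R <= #|reach X (2 ^ k * (8 * U))|%:R.
Proof.
move=> c1 c2 c5 Ul U1 U2 h1 hQ hk hL C4 hc2 hc5 hc5'.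
have [gam gamP] := @frames_exist U.
have K1 := collisions_le q_pr Ul U1 gamP; rewrite -/c2 in K1.
have K2 (X : proj_plane _) := reach_large Ul U2 X gamP; rewrite -/c1 -/c5 in K2.
set n : R := #|{: proj_plane 'F_q}|%:R; set Q : R := q%:R in hQ K1 K2 *.
have en : n = Q ^+ 2 + Q + 1 := card_planeR R q_pr.
have Q1 : 1 < Q by rewrite ltr1n prime_gt1.
have c50 : 0 <= c5 := sqr_ge0 _.
have c20 : 0 <= c2 := mulr_ge0 (ler0n _ _) (addr_ge0 (ler0n _ _)
  (mulr_ge0 (ler0n _ _) (exprn_ge0 _ (ler0n _ _)))).
have Qn : Q ^+ 2 <= n by rewrite en; clear -Q1; lra.
have QQ : Q <= Q ^+ 2 by rewrite expr2; clear -Q1; nra.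
have nQ : n <= 3 * Q ^+ 2 by rewrite en; clear -Q1 QQ; lra.
have n0 : 0 < n by rewrite en; clear -Q1 QQ; lra.
have h4 : h <= Q.
  by apply: le_trans hQ; rewrite -[X in X <= _]expr1; apply: ler_weXn2l.
move: c1 c2 c5 hc2 hc5 hc5' K1 K2 c50 c20 => _ c2 c5 hc2 hc5 hc5' K1 K2 c50 c20.
pose w (X : proj_plane 'F_q) : R := (collisions (planes (2 * U)) gam X)%:R.
pose Y : {set proj_plane 'F_q} := [set X | w X <= Q ^+ 2 * h ^+ 2].
exists Y; split.
  apply: (few_exceptions Q1 h1 c20 hc2 Qn hL); first by clear -C4; lra.
  apply: le_trans K1; have -> : n - #|Y|%:R = #|~: Y|%:R.
    by rewrite /n -(cardsC Y) natrD addrAC subrr add0r.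
  rewrite mulr_natr -sumr_const big_mkcond /=.
  apply: ler_sum => X _; case: ifP => [|_]; last exact: ler0n.
  by rewrite !inE -ltNge => /ltW.
move=> X; rewrite inE => hX.
have [S1 S2] := large_start Q1 h1 hQ hc5 c50 (ler0n _ _) (K2 X) hX.
have gA i : gen_closed (reach X (2 ^ i * (8 * U))) (reach X (2 ^ i.+1 * (8 * U))).
  by rewrite expnS -mulnA; apply: gen_closed_reach.
have A0 : reach X (2 ^ 0 * (8 * U)) = reach X (8 * U) by rewrite mul1n.
have [G|G] := @growth R q q_pr (fun i => reach X (2 ^ i * (8 * U))) k gA
  (eq_rect_r (fun A : {set _} => 2 * (Q + 1) <= #|A|%:R) S2 A0).
  exact: near_full Q1 h1 h4 C4 Qn G.
rewrite A0 in G.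
exact: grown Q1 h1 c50 hc5' nQ n0 (ler0n _ _) S1 hk G.
Qed.

Lemma lifting_exponent (eps : R) : 0 < eps ->
  exists C e : R, 0 < e /\ forall q : nat, prime q ->
  exists Y : {set proj_plane 'F_q},
    (1 - C * q%:R `^ (- e)) * #|{: proj_plane 'F_q}|%:R <= #|Y|%:R /\
    forall X, X \in Y -> exists Z : {set proj_plane 'F_q},
    (1 - C * q%:R `^ (- e)) * #|{: proj_plane 'F_q}|%:R <= #|Z|%:R /\
    forall y, y \in Z -> exists g : SL3 int,
      (mx_maxnorm g)%:R <= (q%:R : R) `^ (3^-1 + eps) /\ Phi q g X = y.
Proof.
move=> eps0.
have l2 : 0 < ln 2 :> R by apply: ln_gt0; rewrite ltr1n.
pose c : R := 4800^-1; have c0 : 0 < c by rewrite invr_gt0 ltr0n.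
have c1 : c <= 1 by rewrite invf_le1 ?ltr0n // ler1n.
have lc : 0 < ln (1 + c) by apply: ln_gt0; rewrite ltrDl.
pose beta := eps * ln (1 + c) / ln 2; have beta0 : 0 < beta by rewrite !mulr_gt0 ?invr_gt0.
(* For h = q^e, the first bound keeps h^4 below twice the growth (1 + c)^k and the second keeps it
   below q. *)
have [e [e0 [e1 e2]]] : exists e : R, 0 < e /\ (4 * e <= beta /\ 4 * e <= 1).
  move: (beta) beta0 => b b0; clear -b0.
  by case: (leP b 1) => ?; [exists (b / 4) | exists (1 / 4)]; lra.
pose c3 := 1 + (e * ln 2)^-1.
have [c2 [c5 [c20 [c50 key]]]] : exists c2 c5 : R, 0 <= c2 /\ (0 <= c5 /\
  forall (q U k : nat) (h C : R), prime q ->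
  108 * 196 ^+ 2 <= U%:R ^+ 2 :> R -> (20 * U%:R) ^+ 3 <= q%:R :> R ->
  q%:R <= (40 * U%:R) ^+ 3 :> R -> 1 <= h -> h ^+ 4 <= q%:R -> h ^+ 4 / 2 <= (1 + c) ^+ k ->
  (trunc_log 2 q).+1%:R <= c3 * h -> 4 <= C -> c2 * c3 <= C -> 4 * c5 <= h -> 6 * c5 <= C ->
  exists Y : {set proj_plane 'F_q},
    (1 - C / h) * #|{: proj_plane 'F_q}|%:R <= #|Y|%:R /\
    forall X, X \in Y ->
    (1 - C / h) * #|{: proj_plane 'F_q}|%:R <= #|reach X (2 ^ k * (8 * U))|%:R).
  exists (2 * (5 + 216 * 47 ^+ 3)), (((8 * (108 * 196 ^+ 3) ^+ 2) * (40 ^+ 3) ^+ 2) ^+ 2).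
  split; last split; last first.
  - move=> q U k h C q_pr; exact: (@expansion_of_orbits q U k h C c3 q_pr).
  - exact: sqr_ge0.
  - exact: mulr_ge0 (ler0n _ _) (addr_ge0 (ler0n _ _) (mulr_ge0 (ler0n _ _) (exprn_ge0 _ (ler0n _ _)))).
pose M : R := (20 * (11 * 196 + 1)) ^+ 3.
have M0 : 0 <= M by apply: exprn_ge0; apply: mulr_ge0 => //; apply: addr_ge0 => //; apply: mulr_ge0.
have box := @box_side_exists; rewrite -/M in box.
move: M M0 box => M M0 box.
have c30 : 0 <= c3 by rewrite addr_ge0 // invr_ge0 mulr_ge0 ?ltW.
(* The sum of all thresholds, so that h > C implies every largeness condition. *)
pose C := 4 + c2 * c3 + 6 * c5 + M.
have c23 : 0 <= c2 * c3 by rewrite mulr_ge0.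
have [C4 [C23 [C5 CM]]] : 4 <= C /\ (c2 * c3 <= C /\ (6 * c5 <= C /\ M <= C)).
  by rewrite /C; clear -M0 c50 c23; do !split; lra.
exists C, e; split => // q q_pr; set n : R := #|_|%:R.
have q1 : 1 < q%:R :> R by rewrite ltr1n prime_gt1.
pose h : R := q%:R `^ e; have h0 : 0 < h := powR_gt0 _ (lt_trans ltr01 q1).
rewrite powRN -/h.
have n0 : 0 <= n := ler0n _ _.
(* For h <= C the proportion 1 - C / h is not positive and the empty set will do. *)
case: (leP h C) => hC.
  exists (finset.set0 : {set proj_plane 'F_q}); split; last by move=> X; rewrite inE.
  rewrite cards0; apply: mulr_le0_ge0 => //.
  by rewrite subr_le0 ler_pdivlMr // mul1r.
have h1 : 1 <= h by clear -C4 hC; lra.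
have hq4 : h ^+ 4 = q%:R `^ (4 * e) by rewrite -powR_mulrn ?powR_ge0 // -powRrM mulrC.
have hQ : h ^+ 4 <= q%:R by rewrite hq4; apply: ler1_powR => //; exact: ltW.
have hqM : M <= q%:R.
  apply: (le_trans CM); apply: (le_trans (ltW hC)); apply: le_trans hQ.
  by rewrite -[X in X <= _]expr1; apply: ler_weXn2l.
have [U [u1 u2 u3 u4]] := box q hqM.
have [k [k1 k2]] := growth_exponent eps0 c0 c1 q1; rewrite -/beta in k2.
have hk : h ^+ 4 / 2 <= (1 + c) ^+ k.
  apply: le_trans k2; rewrite ler_pM2r ?invr_gt0 // hq4.
  by apply: ler_powR => //; exact: ltW.
have hL : (trunc_log 2 q).+1%:R <= c3 * h by apply: trunc_log_le => //; exact: prime_gt0.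
have hc5 : 4 * c5 <= h by clear -C5 hC c50; lra.
have [Y [hY hZ]] := key q U k h C q_pr u1 u3 u4 h1 hQ hk hL C4 C23 hc5 C5.
exists Y; split => // X XY; exists (reach X (2 ^ k * (8 * U))); split; first exact: hZ.
move=> y /reachP[g [hg gX]]; exists g; split => //.
(* The two factors are compared separately: 2^k <= q^eps and 8 U <= 20 U <= q^(1/3). *)
rewrite [_ + eps]addrC powRD; last by rewrite (gt_eqF (lt_trans ltr01 q1)) implybT.
apply: (@le_trans _ _ ((2 ^ k * (8 * U))%N%:R)); first by rewrite ler_nat.
rewrite natrM natrX; apply: ler_pM => //.
apply: le_trans u2; rewrite natrM; apply: ler_wpM2r => //.
by rewrite ler_nat.
Qed.

End Final.

Theorem theorem1p3 (R : realType) (eps : R) (heps : 0 < eps) :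
  exists f : nat -> R,
    (f q @[q --> within [set q | prime q]%classic \oo] --> (0 : R))%classic /\
    forall q : nat, prime q ->
    exists Y : {set proj_plane 'F_q},
      (1 - f q) * #|{: proj_plane 'F_q}|%:R <= #|Y|%:R /\
      forall x : proj_plane 'F_q, x \in Y ->
      exists Z : {set proj_plane 'F_q},
        (1 - f q) * #|{: proj_plane 'F_q}|%:R <= #|Z|%:R /\
        forall y : proj_plane 'F_q, y \in Z ->
        exists g : SL3 int,
          (mx_maxnorm g)%:R <= (q%:R : R) `^ (3%:R^-1 + eps) /\
          Phi q g x = y.
Proof.
have [C [e [e0 H]]] := lifting_exponent heps.
by exists (fun q => C * q%:R `^ (- e)); split; [exact: decay_cvg | exact: H].
Qed.
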